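(* Let $m>1$, $\Phi=\Phi_m$, $k\in\mathbb{N}$, $\sigma>0$, and consider the geometry $F=F_{k,\sigma}$. The strong $(\Phi,\varphi)$-Sobolev Orlicz bump inequality $$\Phi^{(-1)}\left(\int_{B(0,r_0)}\Phi\left(T_{B(0,r_0)}g\right)d\mu_{r_0}\right)\le C\varphi(r_0)\,\|g\|_{L^1(\mu_{r_0})}$$ holds if (either) $k\ge2$ and $\sigma>0$ and $$\varphi(r_0)=r_0^{\,1-C_m\frac{\left(\ln^{(k)}\frac1{r_0}\right)^{\sigma(m-1)}}{\ln\frac1{r_0}}}\qquad\text{for }0<r_0\le\beta_{m,\sigma},$$ for positive constants $C_m$ and $\beta_{m,\sigma}$ depending only on $m$ and $\sigma$; (or) $k=1$ and $\sigma<\frac1{m-1}$ and $$\varphi(r_0)=r_0^{\,1-C_m\frac{1}{\left(\ln\frac1{r_0}\right)^{1-\sigma(m-1)}}}\qquad\text{for }0<r_0\le\beta_{m,\sigma},$$ for positive constants $C_m$ and $\beta_{m,\sigma}$ depending only on $m$ and $\sigma$. Conversely, the standard $(\Phi,\varphi)$-Sobolev inequality $$\Phi^{(-1)}\left(\int_{B(0,r_0)}\Phi(|w|)\,d\mu_{r_0}\right)\le C\varphi(r_0)\,\|\nabla_Aw\|_{L^1(\mu_{r_0})},\qquad w\text{ Lipschitz with compact support in }B(0,r_0),$$ with $\Phi=\Phi_m$, $m>1$, fails if $k=1$ and $\sigma>\frac1{m-1}$.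
   Context: $F_{k,\sigma}(r)=\left(\ln\frac1r\right)\left(\ln^{(k)}\frac1r\right)^\sigma$ for small $r>0$ ($\ln^{(k)}$ the $k$-fold iterated logarithm), $f(x)=e^{-F(|x|)}$, $f(0)=0$. $d$ is the control metric of $dt^2=dx^2+\frac1{f(x)^2}dy^2$ in the plane, $B(x,r)$ its balls, $|\cdot|$ Lebesgue measure, $d\mu_{r_0}=\frac{dx}{|B(0,r_0)|}$ on $B(0,r_0)$, $\nabla_Aw=\left(\frac{\partial w}{\partial x_1},f(x_1)\frac{\partial w}{\partial x_2}\right)$. For $E=e^{2^m}$: $\Phi_m(t)=e^{\left((\ln t)^{1/m}+1\right)^m}$ for $t\ge E$, $\Phi_m(t)=\frac{\Phi_m(E)}{E}t$ for $0\le t\le E$; $\Phi^{(-1)}$ is the inverse function. In the strong inequality, $g$ ranges over nonnegative functions in $L^1(\mu_{r_0})$ and $C$ is independent of $r_0$ and $g$. Operator. For $x_1,t>0$ let $h^*(x_1,t)=\int_{x_1}^{x_1+t}\frac{f(u)^2}{\sqrt{f(x_1+t)^2-f(u)^2}}du$; let $r^*(x_1,r)\in(0,r)$ be determined by $r=\int_{x_1}^{x_1+r^*}\frac{f(x_1+r^* )}{\sqrt{f(x_1+r^* )^2-f(u)^2}}du$. For $x=(x_1,x_2)$, $x_1>0$, and $r>0$ put $\rho_0=r$ and $\rho_{k+1}=r^*(x_1,\rho_k)$ if $\rho_k\ge\frac1{|F'(x_1)|}$, $\rho_{k+1}=\frac12\rho_k$ otherwise; let $E(x,\rho_k)$ be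 the set of $y$ with $x_1+\rho_{k+1}\le y_1<x_1+\rho_k$ and $|y_2-x_2|<h^*(x_1,y_1-x_1)$ (if $\rho_k\ge\frac1{|F'(x_1)|}$), respectively $|y_2-x_2|<h^*(x_1,r^*(x_1,\rho_k))$ (if $\rho_k<\frac1{|F'(x_1)|}$); and $\Gamma(x,r)=\bigcup_{k\ge1}E(x,\rho_k)$ (for $x_1<0$ everything is defined by reflection in the vertical axis). With $\widehat d(x,y)=\min\left\{d(x,y),\frac{1}{|F'(x_1+d(x,y))|}\right\}$, set $$K_{B(0,r)}(x,y)=\frac{\widehat d(x,y)}{|B(x,d(x,y))|}\mathbf 1_{\Gamma(x,r)}(y),\qquad T_{B(0,r)}g(x)=\int_{B(0,r)}K_{B(0,r)}(x,y)g(y)\,dy .$$ ''Fails'' in the converse means that for small $r_0$ the inequality does not hold with any finite value of $C\varphi(r_0)$.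
   Formalization: In the case k≥2 the threshold β may depend on k as well as on m and σ, because ln^{(k)}(1/r0) and F_{k,σ} are defined only for r0 below a bound depending on k; C_m still depends only on m and σ. *)

(* Defs.v *)
From HB Require Import structures.
From mathcomp Require Import all_boot all_order all_algebra.
From mathcomp Require Import all_classical all_reals all_analysis.

Set Implicit Arguments.
Unset Strict Implicit.
Unset Printing Implicit Defensive.
Import Order.TTheory GRing.Theory Num.Theory.
Import numFieldNormedType.Exports.

Local Open Scope classical_set_scope.
Local Open Scope ring_scope.

(* Points of the plane are pairs; the norm of [R * R] is the sup norm, which is
   only used to say "Lipschitz", "compact" and "differentiable". *)

(* [iter k (@ln R) x] is the k-fold iterated logarithm of [x].  Only small
   [r > 0] are meaningful: further out the total functions [ln] and [powR] take
   conventional values.  This does not influence small balls, since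
   |x_1 - y_1| <= d(x, y). *)
Definition Fks (R : realType) (k : nat) (sigma r : R) : R :=
  ln (r^-1) * (iter k (@ln R) (r^-1)) `^ sigma.

Section Geometry.
Variables (R : realType) (F : R -> R).

Definition fF (x : R) : R := if x == 0 then 0 else expR (- F `|x|).

(* [v] is subunit at [p]: (v . xi)^2 <= xi_1^2 + f(p_1)^2 xi_2^2 for all xi,
   i.e. v_1^2 + v_2^2 / f(p_1)^2 <= 1, with v_2 = 0 forced where f vanishes. *)
Definition subunit_vector (p v : R * R) : Prop :=
  forall xi : R * R,
    (v.1 * xi.1 + v.2 * xi.2) ^+ 2 <= xi.1 ^+ 2 + (fF p.1 * xi.2) ^+ 2.

Definition subunit_curve (T : R) (gamma : R -> R * R) : Prop :=
  [lipschitz gamma t | t in `[0, T]] /\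
  {ae (@lebesgue_measure R), forall t, t \in `]0, T[ ->
     derivable gamma t 1 /\ subunit_vector (gamma t) (derive1 gamma t)}.

(* Control metric of dt^2 = dx^2 + f(x)^-2 dy^2. *)
Definition cdist (x y : R * R) : R :=
  inf [set T | 0 < T /\
    exists gamma, [/\ subunit_curve T gamma, gamma 0 = x & gamma T = y]].

Definition cball (x : R * R) (r : R) : set (R * R) := [set y | cdist x y < r].

Definition leb2 : {measure set (measurableTypeR R * measurableTypeR R) -> \bar R} :=
  (@lebesgue_measure R \x @lebesgue_measure R)%E.

Definition vol (A : set (R * R)) : R := fine (leb2 A).

Lemma vol_ge0 A : 0 <= vol A.
Proof. exact: fine_ge0 (measure_ge0 _ _). Qed.

(* The measure dx / |B(0, r0)|; the integrals below are over B(0, r0). *)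
Definition mu0 (r0 : R) :
    {measure set (measurableTypeR R * measurableTypeR R) -> \bar R} :=
  mscale ((NngNum (vol_ge0 (cball (0%R, 0%R) r0)))%:num^-1)%:nng leb2.

Definition hstar (x1 t : R) : R :=
  (\int[@lebesgue_measure R]_(u in `[x1, (x1 + t)%R])
     (fF u ^+ 2 / Num.sqrt (fF (x1 + t) ^+ 2 - fF u ^+ 2)))%R.

Definition rstar (x1 r : R) : R :=
  xget 0 [set s | 0 < s < r /\
    r%:E = (\int[@lebesgue_measure R]_(u in `[x1, (x1 + s)%R])
       (fF (x1 + s) / Num.sqrt (fF (x1 + s) ^+ 2 - fF u ^+ 2))%:E)%E].

Definition next_rho (x1 rho : R) : R :=
  if `|derive1 F x1|^-1 <= rho then rstar x1 rho else rho / 2.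

Definition rho_seq (x1 r : R) (k : nat) : R := iter k (next_rho x1) r.

Definition Eset (x : R * R) (rho : R) : set (R * R) :=
  [set y | x.1 + next_rho x.1 rho <= y.1 < x.1 + rho /\
    `|y.2 - x.2| < if `|derive1 F x.1|^-1 <= rho
                   then hstar x.1 (y.1 - x.1)
                   else hstar x.1 (rstar x.1 rho)].

Definition Gamma (x : R * R) (r : R) : set (R * R) :=
  \bigcup_(k in [set k : nat | (1 <= k)%N]) Eset x (rho_seq x.1 r k).

Definition dhat (x y : R * R) : R :=
  Num.min (cdist x y) (`|derive1 F (x.1 + cdist x y)|^-1).

Definition kernel_right (r : R) (x y : R * R) : R :=
  dhat x y / vol (cball x (cdist x y)) * \1_(Gamma x r) y.

Definition reflect (x : R * R) : R * R := (- x.1, x.2).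

(* The value 0 on the null set x_1 = 0 is a convention. *)
Definition kernelT (r : R) (x y : R * R) : R :=
  if 0 < x.1 then kernel_right r x y
  else if x.1 < 0 then kernel_right r (reflect x) (reflect y)
  else 0.

Definition opT (r : R) (g : R * R -> R) (x : R * R) : \bar R :=
  (\int[leb2]_(y in cball (0%R, 0%R) r) (kernelT r x y * g y)%:E)%E.

(* |nabla_A w| *)
Definition norm_gradA (w : R * R -> R) (x : R * R) : R :=
  Num.sqrt (('D_(1, 0) w x) ^+ 2 + (fF x.1 * 'D_(0, 1) w x) ^+ 2).

End Geometry.

Definition Phi (R : realType) (m t : R) : R :=
  let E := expR (2 `^ m) in
  let bump s := expR ((ln s `^ m^-1 + 1) `^ m) in
  if E <= t then bump t else bump E / E * t.

Definition Phi_inv (R : realType) (m : R) : R -> R :=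
  'pinv_(fun=> 0) [set t | 0 <= t] (Phi m).

(* In the two inequalities [er_map] extends Phi and its inverse to [+oo], which
   they fix; [c] stands for the product C phi(r0). *)
Definition strong_sobolev_orlicz (R : realType) (F : R -> R) (m r0 c : R) : Prop :=
  forall g : R * R -> R,
    (forall y, cball F (0%R, 0%R) r0 y -> 0 <= g y) ->
    (mu0 F r0).-integrable (cball F (0%R, 0%R) r0) (EFin \o g) ->
    (er_map (Phi_inv m)
       (\int[mu0 F r0]_(x in cball F (0%R, 0%R) r0) er_map (Phi m) (opT F r0 g x))
     <= c%:E * \int[mu0 F r0]_(x in cball F (0%R, 0%R) r0) `|g x|%:E)%E.

Definition standard_sobolev_orlicz (R : realType) (F : R -> R) (m r0 c : R) : Prop :=
  forall w : R * R -> R,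
    lipschitz w ->
    compact (closure [set x | w x != 0]) ->
    closure [set x | w x != 0] `<=` cball F (0%R, 0%R) r0 ->
    (er_map (Phi_inv m)
       (\int[mu0 F r0]_(x in cball F (0%R, 0%R) r0) (Phi m `|w x|)%:E)
     <= c%:E * \int[mu0 F r0]_(x in cball F (0%R, 0%R) r0) (norm_gradA F w x)%:E)%E.

(* Main.v *)
(** Let [g] be the [sigma]-th power of the iterated logarithm of [1/r], so that
    [F r = g r * ln (1/r)], and let [S = r / g r], which is comparable to [1/|F'|].
    A box of size [t] by [t * f (y1)] next to [x] lies in the ball [B(x, C t)], hence
    the kernel is at most [C / (f S)(y1) * (1 + S (y1) / t)], where [t] is the larger
    of [y1 - x1] and [|y2 - x2| / f (y1)]; it lives on [|y2 - x2| <= C (f S)(y1)].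
    Since [Phi t / t] is nondecreasing, Jensen's inequality and Tonelli's theorem
    reduce the strong inequality to bounding the integral in [x] of
    [Phi (a K(x, y))] for fixed [y].  As [Phi (c t) <= C c^(3/2) Phi t], the
    singularity of the kernel is harmless and that integral is at most
    [C y1 (f S)(y1) Phi (C a / (f S)(y1))].  Comparing it with
    [|B| Phi (C phi(r0) a |B|^-1)] amounts to
    [2^m (Q (1 + L) g (y1))^(1 - 1/m) <= L + C_m g (r0)^(m-1) + C], where
    [L = ln (r0 / y1)].  This is Young's inequality as long as [g (y1)] and [g (r0)]
    are comparable; for smaller [y1] the left side is sublinear in [L], which for
    [k = 1] is where [sigma < 1 / (m - 1)] enters.

    Conversely, tent functions of integral one on the boxes
    [|x1| <= e, |x2| <= e f(e)] have gradients bounded in [L^1], whereas the integral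
    of [Phi] over them is at least a constant times [e exp ((ln 1/f(e))^(1 - 1/m))],
    and this diverges as [e -> 0] when [(1 + sigma) (1 - 1/m) > 1]. *)
From HB Require Import structures.
Require Import Defs.
From mathcomp Require Import all_boot all_order all_algebra.
From mathcomp Require Import all_classical all_reals all_analysis.
From mathcomp Require Import measurable_realfun ring lra.
Import Order.TTheory GRing.Theory Num.Theory.
Import numFieldNormedType.Exports.
Set Implicit Arguments.
Unset Strict Implicit.
Unset Printing Implicit Defensive.

Local Open Scope classical_set_scope.
Local Open Scope ring_scope.

(* On nested real expressions the conversion test behind this hint is exponential. *)
#[local] Remove Hints Order.PreorderTheory.lexx : core.
#[local] Hint Extern 0 (is_true (Order.le ?x ?x)) => apply: lexx : core.
Opaque powR ln expR.

(** * The Young function *)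

(** The kernel contains an infimum over curves and a choice of radius, and its measurability is
    never established. All estimates of it pass through the explicit measurable majorant
    [kernel_major], and integrals of possibly nonmeasurable functions are compared as suprema over
    simple functions.

    The exponent 3/2 has to lie strictly between 1 and 2. Above 1, a power of [c] absorbs the factor
    [exp (C (ln c)^(1 - 1/m))] by which [bump m c] exceeds [c]. Below 2, bounding the ratio of scale
    to distance by a geometric mean of two one-variable ratios leaves the exponent (3/2)/2 = 3/4 in
    each variable, which is integrable.

    The geometry rests on increments of [F]: two-sided bounds of [F u - F v] by [ln (v / u)] times a
    value of [g], and slow variation of [g] between [v^2] and [v]. The constants of the geometry
    enter only the factor [C]. The loss [C_m] comes from Young's inequality alone, with a constant
    free of [k]. *)

(* [Phi m t] is [exp (elog m (ln t))] for large [t]. *)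
HB.lock Definition elog (R : realType) (m x : R) : R := (x `^ m^-1 + 1) `^ m.
HB.lock Definition bump (R : realType) (m t : R) : R := expR (elog m (ln t)).
HB.lock Definition Ebump (R : realType) (m : R) : R := expR (2 `^ m).

Section bump.
Variable R : realType.
Implicit Types (m p s t x y z : R).

Lemma expRln x : 0 < x -> expR (ln x) = x.
Proof. by move=> x0; rewrite lnK// posrE. Qed.

Lemma powR_convex p t x y : 1 <= p -> 0 <= t <= 1 -> 0 <= x -> 0 <= y ->
  (t * x + (1 - t) * y) `^ p <= t * x `^ p + (1 - t) * y `^ p.
Proof.
move=> p1 /andP[t0 t1] x0 y0.
have := @convex_powR R p p1 (Itv01 t0 t1) x y.
by rewrite !inE/= !in_itv/= !andbT => /(_ x0 y0); rewrite !convRE.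
Qed.

Lemma PhiE m t :
  Phi m t = if Ebump m <= t then bump m t else bump m (Ebump m) / Ebump m * t.
Proof. by rewrite /Phi bump.unlock elog.unlock Ebump.unlock. Qed.

Lemma elogE m x : 0 < m -> 0 < x -> elog m x = x * (1 + x `^ (- m^-1)) `^ m.
Proof.
move=> m0 x0; have q0 : 0 < x `^ m^-1 by rewrite powR_gt0.
rewrite elog.unlock.
have -> : x `^ m^-1 + 1 = x `^ m^-1 * (1 + x `^ (- m^-1)).
  by rewrite powRN; field; rewrite gt_eqF.
rewrite powRM ?powR_ge0 ?addr_ge0 ?powR_ge0//.
by rewrite -powRrM mulVf ?gt_eqF// powRr1// ltW.
Qed.

Lemma elog_ge1 m x : 0 <= m -> 1 <= elog m x.
Proof.
move=> m0; rewrite elog.unlock -[leLHS](powRr0 (x `^ m^-1 + 1)).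
by rewrite ler_powR// lerDr powR_ge0.
Qed.

(** By [elogE] the quotient [elog m x / x] is nonincreasing, whence subadditivity. This is what
    makes [bump] submultiplicative. *)
Lemma elogD m x y : 0 < m -> 0 <= x -> 0 <= y ->
  elog m (x + y) <= elog m x + elog m y.
Proof.
move=> m0; rewrite le_eqVlt => /predU1P[<- _|x0].
  by rewrite add0r lerDr (le_trans ler01)// elog_ge1// ltW.
rewrite le_eqVlt => /predU1P[<-|y0].
  by rewrite addr0 lerDl (le_trans ler01)// elog_ge1// ltW.
rewrite !elogE ?addr_gt0// mulrDl.
have H a b : 0 < a -> 0 <= b ->
    (1 + (a + b) `^ (- m^-1)) `^ m <= (1 + a `^ (- m^-1)) `^ m.
  move=> a0 b0; apply: ge0_ler_powR; first exact: ltW.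
  - by rewrite nnegrE addr_ge0// powR_ge0.
  - by rewrite nnegrE addr_ge0// powR_ge0.
  rewrite lerD2l !powRN lef_pV2 ?posrE ?powR_gt0// ?ltr_wpDr//.
  by rewrite ge0_ler_powR ?nnegrE ?invr_ge0 ?addr_ge0 ?lerDl// ltW.
rewrite lerD ?ler_pM2l//; first by rewrite H// ltW.
by rewrite [x + y]addrC H// ltW.
Qed.

(** With [z = x^(1/m)] the difference is [(z + 1)^m - z^m], which grows because [t^m] is convex: for
    [z <= w] the points [z + 1] and [w] are convex combinations of [z] and [w + 1] with
    complementary weights, and the two convexity inequalities add up. Hence [Phi t / t] is
    nondecreasing. *)
Lemma elogB_homo m x y : 1 <= m -> 0 <= x -> x <= y ->
  elog m x - x <= elog m y - y.
Proof.
move=> m1 x0 xy; have m0 : 0 < m by rewrite (lt_le_trans ltr01).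
have y0 : 0 <= y by rewrite (le_trans x0).
pose z := x `^ m^-1; pose w := y `^ m^-1.
have z0 : 0 <= z by rewrite powR_ge0.
have zw : z <= w by rewrite ge0_ler_powR ?nnegrE ?invr_ge0 ?(ltW m0).
have xE : x = z `^ m by rewrite -powRrM mulVf ?gt_eqF// powRr1.
have yE : y = w `^ m by rewrite -powRrM mulVf ?gt_eqF// powRr1.
rewrite !elog.unlock -/z -/w [in leLHS]xE [in leRHS]yE.
clearbody z w; clear xE yE; pose a := (w + 1 - z)^-1.
have a0 : 0 < w + 1 - z by lra.
have ha : 0 <= a <= 1 by rewrite invr_ge0 (ltW a0) invf_le1//; lra.
have e1 : z + 1 = (1 - a) * z + (1 - (1 - a)) * (w + 1).
  by rewrite /a; field; rewrite gt_eqF.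
have e2 : w = a * z + (1 - a) * (w + 1).
  by rewrite /a; field; rewrite gt_eqF.
have w10 : 0 <= w + 1 by lra.
have := @powR_convex m a z (w + 1) m1 ha z0 w10; rewrite -e2 => h2.
have ha' : 0 <= 1 - a <= 1 by move: ha; lra.
have := @powR_convex m (1 - a) z (w + 1) m1 ha' z0 w10; rewrite -e1 => h1.
by move: h1 h2; lra.
Qed.

Lemma elog_lb m x : 1 <= m -> 0 < x -> x + x `^ (1 - m^-1) <= elog m x.
Proof.
move=> m1 x0; have m0 : 0 < m by rewrite (lt_le_trans ltr01).
have xn : x != 0 by rewrite gt_eqF.
rewrite elogE// powRD ?xn ?implybT//.
rewrite powRr1 ?(ltW x0)//.
rewrite -[X in X + _]mulr1 -mulrDr ler_pM2l//.
by rewrite le1r_powR// lerDl powR_ge0.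
Qed.

(** For [x >= 1] the number [s = x^(-1/m)] lies in [0, 1], where the chord of the convex function
    [(1 + s)^m] gives [1 + s (2^m - 1)]. For [x < 1] the left side is at most [2^m]. *)
Lemma elog_ub m x : 1 <= m -> 0 <= x ->
  elog m x <= x + 2 `^ m * (1 + x `^ (1 - m^-1)).
Proof.
move=> m1 x0; have m0 : 0 < m by rewrite (lt_le_trans ltr01).
have p0 : 0 <= x `^ (1 - m^-1) by rewrite powR_ge0.
have t0 : 0 <= 2 `^ m :> R by rewrite powR_ge0.
have [x1|x1] := leP 1 x.
  have x00 : 0 < x by rewrite (lt_le_trans ltr01).
  pose s := x `^ (- m^-1).
  have s0 : 0 <= s by rewrite powR_ge0.
  have s1 : s <= 1.
    by rewrite -(powRr0 x) ler_powR// oppr_le0 invr_ge0 ltW.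
  have -> : elog m x = x * (1 + s) `^ m by rewrite elogE.
  have -> : x `^ (1 - m^-1) = x * s.
    have xn : x != 0 by rewrite gt_eqF.
  by rewrite powRD ?xn ?implybT ?powRr1.
  have hs : 0 <= 1 - s <= 1 by lra.
  have := @powR_convex m (1 - s) 1 2 m1 hs ler01 (ler0n _ _).
  rewrite powR1/=.
  have -> : (1 - s) * 1 + (1 - (1 - s)) * 2 = 1 + s by ring.
  move=> h; apply: (@le_trans _ _ (x * ((1 - s) * 1 + (1 - (1 - s)) * 2 `^ m))).
    by rewrite ler_pM2l.
  have : 0 <= x * s by rewrite mulr_ge0.
  nra.
apply: (@le_trans _ _ (2 `^ m)).
  rewrite elog.unlock; apply: ge0_ler_powR; rewrite ?nnegrE ?(ltW m0)//.
    by rewrite addr_ge0// powR_ge0.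
  rewrite (_ : 2 = 1 + 1)// lerD2r (le_trans _ (_ : 1 `^ m^-1 <= 1))//; last first.
    by rewrite powR1.
  by rewrite ge0_ler_powR ?nnegrE ?invr_ge0 ?(ltW m0)// ltW.
nra.
Qed.

Lemma Ebump_ge1 m : 1 <= Ebump m.
Proof. by rewrite Ebump.unlock -expR0 ler_expR powR_ge0. Qed.

Lemma Ebump_gt0 m : 0 < Ebump m. Proof. by rewrite Ebump.unlock expR_gt0. Qed.

Lemma bump_gt0 m t : 0 < bump m t. Proof. by rewrite bump.unlock expR_gt0. Qed.

Lemma bumpM m s t : 0 < m -> 1 <= s -> 1 <= t ->
  bump m (s * t) <= bump m s * bump m t.
Proof.
move=> m0 s1 t1; rewrite !bump.unlock -expRD ler_expR.
rewrite lnM ?posrE ?(lt_le_trans ltr01)//.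
by rewrite elogD// ln_ge0.
Qed.

Lemma bump_ratio m s t : 1 <= m -> 1 <= s -> s <= t ->
  bump m s / s <= bump m t / t.
Proof.
move=> m1 s1 st; have t1 := le_trans s1 st.
have s0 : 0 < s by rewrite (lt_le_trans ltr01).
have t0 : 0 < t by rewrite (lt_le_trans ltr01).
rewrite !bump.unlock -{2}(expRln s0) -{2}(expRln t0) -!expRB ler_expR.
by rewrite elogB_homo ?ln_ge0// ler_ln.
Qed.

Lemma Phi_ge0 m t : 0 <= t -> 0 <= Phi m t.
Proof.
move=> t0; rewrite PhiE; case: ifP => _; first exact/ltW/bump_gt0.
by rewrite mulr_ge0// divr_ge0// ltW ?bump_gt0 ?Ebump_gt0.
Qed.

Lemma Phi0 m : Phi m 0 = 0 :> R.
Proof. by rewrite PhiE leNgt Ebump_gt0/= mulr0. Qed.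

Lemma Phi_ratio m s t : 1 <= m -> 0 < s -> s <= t -> Phi m s / s <= Phi m t / t.
Proof.
move=> m1 s0 st; have t0 : 0 < t by rewrite (lt_le_trans s0).
rewrite !PhiE; case: ifPn => hs.
  by rewrite (le_trans hs st) bump_ratio// (le_trans (Ebump_ge1 m)).
rewrite mulfK ?gt_eqF//; case: ifPn => ht; last by rewrite mulfK ?gt_eqF.
by rewrite bump_ratio// Ebump_ge1.
Qed.

Lemma ler_Phi m s t : 1 <= m -> 0 <= s -> s <= t -> Phi m s <= Phi m t.
Proof.
move=> m1; rewrite le_eqVlt => /predU1P[<- t0|s0 st]; first by rewrite Phi0 Phi_ge0.
have t0 : 0 < t by rewrite (lt_le_trans s0).
have := Phi_ratio m1 s0 st; rewrite ler_pdivrMr// => /le_trans; apply.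
rewrite -mulrA ler_piMr ?Phi_ge0 ?(ltW t0)//.
by rewrite mulrC ler_pdivrMr// mul1r.
Qed.

Lemma Phi_gt0 m t : 1 <= m -> 0 < t -> 0 < Phi m t.
Proof.
move=> m1 t0; rewrite PhiE; case: ifP => _; first exact: bump_gt0.
by rewrite mulr_gt0// divr_gt0 ?bump_gt0 ?Ebump_gt0.
Qed.

Lemma ltr_Phi m s t : 1 <= m -> 0 <= s -> s < t -> Phi m s < Phi m t.
Proof.
move=> m1; rewrite le_eqVlt => /predU1P[<- t0|s0 st]; first by rewrite Phi0 Phi_gt0.
have t0 : 0 < t by rewrite (lt_trans s0).
have := Phi_ratio m1 s0 (ltW st); rewrite ler_pdivrMr// => /le_lt_trans; apply.
rewrite -mulrA gtr_pMr ?Phi_gt0//.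
by rewrite mulrC ltr_pdivrMr// mul1r.
Qed.

Lemma Phi_inj m : 1 <= m -> {in [set t : R | 0 <= t] &, injective (Phi m)}.
Proof.
move=> m1 x y; rewrite !inE/= => x0 y0 e.
case: (ltgtP x y) => // h.
  by have := ltr_Phi m1 x0 h; rewrite e ltxx.
by have := ltr_Phi m1 y0 h; rewrite e ltxx.
Qed.

(** If [t] and [c t] lie on the same side of [Ebump m], this is submultiplicativity of [bump],
    respectively linearity together with [c <= bump m c]. If they straddle it, then
    [c t = s * Ebump m] with [1 <= s <= c], and [bump m s <= (bump m c / c) s] by monotonicity of
    the ratio. *)
Lemma PhiM m c t : 1 <= m -> 1 <= c -> 0 <= t -> Phi m (c * t) <= bump m c * Phi m t.
Proof.
move=> m1 c1 t0; have m0 : 0 < m by rewrite (lt_le_trans ltr01).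
have c0 : 0 < c by rewrite (lt_le_trans ltr01).
rewrite !PhiE; case: (leP (Ebump m) t) => ht.
  rewrite (_ : _ <= c * t) ?(le_trans ht) ?ler_peMl//.
  by rewrite bumpM// (le_trans (Ebump_ge1 m)).
case: (leP (Ebump m) (c * t)) => hct; last first.
  have -> : bump m c * (bump m (Ebump m) / Ebump m * t) =
    bump m c * t * (bump m (Ebump m) / Ebump m) by ring.
  have -> : bump m (Ebump m) / Ebump m * (c * t) =
    c * t * (bump m (Ebump m) / Ebump m) by ring.
  rewrite ler_wpM2r ?divr_ge0 ?(ltW (bump_gt0 _ _)) ?(ltW (Ebump_gt0 _))//.
  rewrite ler_wpM2r// bump.unlock -[leLHS](expRln c0) ler_expR.
  have : 0 <= ln c by rewrite ln_ge0.
  have h0 := elog_ge1 0 (ltW m0).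
  by move=> /(elogB_homo m1 (lexx 0)); lra.
have t00 : 0 < t.
  rewrite lt0r t0 andbT; apply: contraTN hct => /eqP ->.
  by rewrite mulr0 -ltNge Ebump_gt0.
pose s := c * t / Ebump m.
have s1 : 1 <= s by rewrite /s ler_pdivlMr ?Ebump_gt0// mul1r.
have sc : s <= c by rewrite /s ler_pdivrMr ?Ebump_gt0// ler_pM2l// ltW.
have -> : c * t = s * Ebump m by rewrite /s mulfVK// gt_eqF// Ebump_gt0.
apply: (le_trans (bumpM m0 s1 (Ebump_ge1 m))).
have := bump_ratio m1 s1 sc; rewrite ler_pdivrMr ?(lt_le_trans ltr01)// => h.
apply: (@le_trans _ _ (bump m c / c * s * bump m (Ebump m))).
  by rewrite ler_wpM2r// ltW// bump_gt0.
rewrite le_eqVlt; apply/orP; left; apply/eqP; rewrite /s.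
by field; rewrite ?gt_eqF ?Ebump_gt0.
Qed.

Lemma bump_ub m c : 1 <= m -> 1 <= c ->
  bump m c <= c * expR (2 `^ m * (1 + ln c `^ (1 - m^-1))).
Proof.
move=> m1 c1; have c0 : 0 < c by rewrite (lt_le_trans ltr01).
rewrite bump.unlock -[X in X * _](expRln c0).
by rewrite -expRD ler_expR elog_ub// ln_ge0.
Qed.

(** [Y = K^m G^(m - 1)] is the fixed point of the map [X -> K (X G)^(1 - 1/m)]. Below [Y]
    monotonicity bounds the value by [Y]; above it sublinearity bounds the value by [X]. *)
Lemma young_gap (m K X G : R) : 1 <= m -> 0 < K -> 0 < X -> 0 < G ->
  K * (X * G) `^ (1 - m^-1) <= X + K `^ m * G `^ (m - 1).
Proof.
move=> m1 K0 X0 G0; have m0 : 0 < m by rewrite (lt_le_trans ltr01).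
have q0 : 0 <= 1 - m^-1 by rewrite subr_ge0 invf_le1.
set Y := K `^ m * G `^ (m - 1).
have Y0 : 0 < Y by rewrite mulr_gt0 ?powR_gt0.
have YE : K * (Y * G) `^ (1 - m^-1) = Y.
  have K_ : K * K `^ (m - 1) = K `^ m by rewrite mulr_powRB1// ltW.
  have -> : Y * G = (K * G) `^ m.
    rewrite /Y powRM ?ltW// -mulrA; congr (_ * _).
    by rewrite mulrC mulr_powRB1// ltW.
  rewrite -powRrM (_ : m * (1 - m^-1) = m - 1); last by field; rewrite gt_eqF.
  by rewrite powRM ?ltW// mulrA K_.
have mono a b : 0 <= a -> a <= b ->
    K * (a * G) `^ (1 - m^-1) <= K * (b * G) `^ (1 - m^-1).
  move=> a0 ab; have b0 := le_trans a0 ab.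
  rewrite ler_pM2l// ge0_ler_powR ?nnegrE ?mulr_ge0 ?(ltW G0)//.
  by rewrite ler_pM2r.
case: (leP X Y) => XY.
  by rewrite (le_trans (mono _ _ (ltW X0) XY))// YE lerDr ltW.
suff h : K * (X * G) `^ (1 - m^-1) <= X by rewrite (le_trans h)// lerDl ltW.
have X1 : 1 <= X / Y by rewrite ler_pdivlMr// mul1r ltW.
have -> : X * G = X / Y * (Y * G) by rewrite mulrA divfK ?gt_eqF.
rewrite powRM; last 2 first.
  by rewrite (le_trans ler01).
  by rewrite mulr_ge0// ltW.
rewrite mulrCA YE (@le_trans _ _ (X / Y * Y))//; last by rewrite divfK// gt_eqF.
by rewrite ler_pM2r// ler1_powR// lerBlDr lerDl invr_ge0 ltW.
Qed.

(** [young_gap] with [G = 1] and [K = 2 * 2^m] absorbs the sublinear exponent [2^m (ln c)^(1 - 1/m)]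
    of [bump_ub] into [(ln c) / 2] plus a constant. *)
Lemma bump_power m : 1 <= m -> exists2 C, 0 < C &
  forall c, 1 <= c -> bump m c <= C * c `^ (3 / 2).
Proof.
move=> m1; have m0 : 0 < m by rewrite (lt_le_trans ltr01).
have t0 : 0 < 2 `^ m :> R by rewrite powR_gt0.
pose K := 2 * 2 `^ m.
exists (expR (2 `^ m + K `^ m + 2)); first exact: expR_gt0.
move=> c c1; apply: (le_trans (bump_ub m1 c1)).
have c0 : 0 < c by rewrite (lt_le_trans ltr01).
have lc0 : 0 <= ln c by rewrite ln_ge0.
have -> : c `^ (3 / 2) = c * expR (ln c / 2).
  rewrite -[X in X `^ _](expRln c0) -expRM -[X in _ = X * _](expRln c0).
  by rewrite -expRD; congr expR; field.
rewrite mulrCA ler_pM2l// -expRD ler_expR.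
have K0 : 0 < K by rewrite mulr_gt0.
have L0 : 0 < ln c + 1 by lra.
have := young_gap m1 K0 L0 ltr01; rewrite powR1 mulr1 mulr1.
have : ln c `^ (1 - m^-1) <= (ln c + 1) `^ (1 - m^-1).
  apply: ge0_ler_powR; rewrite ?nnegrE ?(ltW L0) ?lerDl//.
  by rewrite subr_ge0 invf_le1.
have W0 : 0 <= K `^ m by rewrite powR_ge0.
move: W0 t0; rewrite /K; set u := ln c `^ _; set v := (ln c + 1) `^ _.
set w := 2 `^ m; set W := _ `^ m => W0 w0 uv.
have : w * u <= w * v by rewrite ler_pM2l.
lra.
Qed.

Lemma Phi_power m : 1 <= m -> exists2 C, 0 < C &
  forall c t, 1 <= c -> 0 <= t -> Phi m (c * t) <= C * c `^ (3 / 2) * Phi m t.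
Proof.
move=> m1; have [C C0 h] := bump_power m1; exists C => // c t c1 t0.
apply: (le_trans (PhiM m1 c1 t0)).
by rewrite ler_wpM2r ?Phi_ge0// h.
Qed.

(** The inverse of [bump] is explicit, [exp (((ln u)^(1/m) - 1)^m)]; the lower bound on [u] keeps
    the inner base nonnegative and the result beyond [Ebump m]. *)
Lemma Phi_surj_Ebump m u : 1 <= m -> Phi m (Ebump m) <= u ->
  exists2 t, Ebump m <= t & Phi m t = u.
Proof.
move=> m1; have m0 : 0 < m by rewrite (lt_le_trans ltr01).
rewrite PhiE lexx bump.unlock => hu.
have u0 : 0 < u by rewrite (lt_le_trans _ hu)// expR_gt0.
have lu : elog m (ln (Ebump m)) <= ln u by rewrite -[leLHS]expRK ler_ln ?posrE ?expR_gt0.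
have e0 : 0 <= ln (Ebump m) by rewrite ln_ge0// Ebump_ge1.
have lu1 : 1 <= ln u by rewrite (le_trans _ lu)// elog_ge1// ltW.
have lu0 : 0 <= ln u by rewrite (le_trans ler01).
pose z := (ln u) `^ m^-1.
have z1 : ln (Ebump m) `^ m^-1 <= z - 1.
  rewrite lerBrDr.
  have -> : ln (Ebump m) `^ m^-1 + 1 = elog m (ln (Ebump m)) `^ m^-1.
    rewrite elog.unlock -powRrM mulfV ?gt_eqF// powRr1//.
    by rewrite addr_ge0// powR_ge0.
  rewrite ge0_ler_powR ?invr_ge0 ?nnegrE ?(ltW m0)//.
  by rewrite (le_trans ler01)// elog_ge1// ltW.
have z0 : 0 <= z - 1 by rewrite (le_trans _ z1)// powR_ge0.
have hE : Ebump m <= expR ((z - 1) `^ m).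
  rewrite -(expRln (Ebump_gt0 m)) ler_expR.
  have -> : ln (Ebump m) = (ln (Ebump m) `^ m^-1) `^ m.
    by rewrite -powRrM mulVf ?gt_eqF// powRr1.
  by rewrite ge0_ler_powR ?nnegrE ?powR_ge0// ltW.
exists (expR ((z - 1) `^ m)) => //.
rewrite PhiE hE bump.unlock elog.unlock expRK -powRrM mulfV ?gt_eqF// powRr1// subrK.
by rewrite -powRrM mulVf ?gt_eqF// powRr1// lnK// posrE.
Qed.

Lemma Phi_surj m u : 1 <= m -> 0 <= u -> exists2 t, 0 <= t & Phi m t = u.
Proof.
move=> m1 u0; have E0 := Ebump_gt0 m.
case: (leP (Phi m (Ebump m)) u) => [/(Phi_surj_Ebump m1)[t Et <-]|hu].
  by exists t => //; rewrite (le_trans _ Et)// ltW.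
have p0 := Phi_gt0 m1 E0.
have h : u / Phi m (Ebump m) * Ebump m < Ebump m.
  by rewrite gtr_pMl// ltr_pdivrMr// mul1r.
exists (u / Phi m (Ebump m) * Ebump m).
  by rewrite mulr_ge0 ?divr_ge0// ltW.
rewrite PhiE leNgt h/= PhiE lexx; field.
by rewrite !gt_eqF// bump_gt0.
Qed.

Lemma Phi_inv_le m u v : 1 <= m -> 0 <= v -> 0 <= u -> u <= Phi m v ->
  Phi_inv m u <= v.
Proof.
move=> m1 v0 u0 uv; rewrite /Phi_inv; have [t t0 tu] := Phi_surj m1 u0.
rewrite -tu pinvKV ?inE//; last exact: Phi_inj.
rewrite leNgt; apply/negP => vt.
by have := ltr_Phi m1 v0 vt; rewrite tu ltNge uv.
Qed.

Lemma Phi_inv_ge m u v : 1 <= m -> 0 <= v -> Phi m v <= u -> v <= Phi_inv m u.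
Proof.
move=> m1 v0 vu.
have [|t t0 tu] := @Phi_surj m u m1; first by rewrite (le_trans _ vu)// Phi_ge0.
rewrite /Phi_inv -tu pinvKV ?inE//; last exact: Phi_inj.
rewrite leNgt; apply/negP => tv.
by have := ltr_Phi m1 t0 tv; rewrite tu ltNge vu.
Qed.

End bump.

(** * Iterated logarithms *)

Section iterated_logarithm.
Variable R : realType.
Implicit Types (k : nat) (x y sigma : R).

Definition iln k x : R := iter k (@ln R) x.

(* [iln_dom k x] makes the first [k] iterated logarithms of [x], and [x], at least [1]. *)
Definition iln_dom k x := iter k expR 1 <= x.

Lemma iter_expR_ge1 k : 1 <= iter k expR 1 :> R.
Proof.
elim: k => //= k ih; rewrite (le_trans ih)//.
by rewrite (le_trans _ (expR_ge1Dx _))// lerDr.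
Qed.

Lemma iln_dom_ge1 k x : iln_dom k x -> 1 <= x.
Proof. exact/le_trans/iter_expR_ge1. Qed.

Lemma iln_dom_ln k x : iln_dom k.+1 x -> iln_dom k (ln x).
Proof.
move=> h; have x1 := iln_dom_ge1 h; have x0 : 0 < x by rewrite (lt_le_trans ltr01).
by rewrite /iln_dom -ler_expR expRln.
Qed.

Lemma iln_domW k x : iln_dom k.+1 x -> iln_dom k x.
Proof.
by apply: le_trans; rewrite /= (le_trans _ (expR_ge1Dx _))// lerDr.
Qed.

Lemma iln_dom_le k x y : x <= y -> iln_dom k x -> iln_dom k y.
Proof. by move=> xy /le_trans; apply. Qed.

Lemma iln_ge1 k x : iln_dom k x -> 1 <= iln k x.
Proof.
elim: k x => [|k ih] x hx; first exact: iln_dom_ge1 hx.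
by rewrite /iln iterSr; exact/ih/iln_dom_ln.
Qed.

Lemma ler_iln k x y : iln_dom k x -> x <= y -> iln k x <= iln k y.
Proof.
elim: k x y => [|k ih] x y hx xy; first by [].
rewrite /iln !iterSr.
have x0 : 0 < x by rewrite (lt_le_trans ltr01)// (iln_dom_ge1 hx).
apply: ih; first exact: iln_dom_ln.
by rewrite ler_ln ?posrE// (lt_le_trans x0).
Qed.

Lemma lnB_le x y : 0 < x -> 0 < y -> ln y - ln x <= (y - x) / x.
Proof.
move=> x0 y0; rewrite -ln_div ?posrE//.
have -> : (y - x) / x = y / x - 1 by rewrite mulrBl divff// gt_eqF.
have h : -1 < y / x - 1 by rewrite ltrBrDl subrr divr_gt0.
by have := le_ln1Dx h; rewrite addrC subrK.
Qed.

(** The logarithm is 1-Lipschitz on [1, oo), and [iln_dom] keeps the iterates there. *)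
Lemma iln_lipschitz k x y : iln_dom k x -> x <= y -> iln k y - iln k x <= y - x.
Proof.
elim: k x y => [|k ih] x y hx xy; first exact: lexx.
rewrite /iln !iterSr.
have x1 := iln_dom_ge1 hx.
have x0 : 0 < x by rewrite (lt_le_trans ltr01).
have y0 : 0 < y by rewrite (lt_le_trans x0).
apply: (@le_trans _ _ (ln y - ln x)).
  by apply: ih; [exact: iln_dom_ln|rewrite ler_ln].
apply: (le_trans (lnB_le x0 y0)).
by rewrite ler_pdivrMr// ler_peMr// subr_ge0.
Qed.

(** For [k = 1] both sides agree. For [k >= 2], [iln k] is a 1-Lipschitz function of [ln (ln x)],
    whose increment is at most [(ln y - ln x) / ln x], and [iln k x >= 1]. So the relative growth of
    an iterated logarithm never exceeds that of [ln]. *)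
Lemma iln_growth k x y : (0 < k)%N -> iln_dom k x -> x <= y ->
  ln x * (iln k y - iln k x) <= (ln y - ln x) * iln k x.
Proof.
case: k => // k _ hx xy.
have x0 : 0 < x by rewrite (lt_le_trans ltr01)// (iln_dom_ge1 hx).
have y0 : 0 < y by rewrite (lt_le_trans x0).
have lxy : ln x <= ln y by rewrite ler_ln.
have := iln_dom_ln hx; rewrite /iln !iterSr.
move: (ln x) (ln y) lxy => {x y hx xy x0 y0} x y xy.
case: k => [_|k hx]; first by rewrite [leLHS]mulrC; exact: lexx.
have x1 := iln_dom_ge1 hx; have x0 : 0 < x by rewrite (lt_le_trans ltr01).
have y0 : 0 < y by rewrite (lt_le_trans x0).
have h1 := iln_ge1 hx; rewrite /iln in h1.
apply: (@le_trans _ _ (y - x)); last by rewrite ler_peMr// subr_ge0.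
rewrite !iterSr -ler_pdivlMl// mulrC (le_trans _ (lnB_le x0 y0))//.
by apply: (@iln_lipschitz k); [exact: iln_dom_ln|rewrite ler_ln].
Qed.

Lemma iln_le k x : (0 < k)%N -> iln_dom k x -> iln k x <= ln x.
Proof.
case: k => // k _; elim: k => [|k ih] hx; first exact: lexx.
have h := iln_ge1 (iln_domW hx).
rewrite (le_trans _ (ih (iln_domW hx)))// /iln iterS ltW// ln_sublinear//.
by rewrite (lt_le_trans ltr01).
Qed.

Lemma iln_le_ln2 k x : (1 < k)%N -> iln_dom k x -> iln k x <= ln (ln x).
Proof.
case: k => // -[//|k] _ hx; rewrite /iln iterSr.
by apply: (@iln_le k.+1) => //; exact: iln_dom_ln.
Qed.

Lemma derivable_iln k x : iln_dom k x -> derivable (iln k) x 1.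
Proof.
elim: k x => [|k ih] x hx; first exact: derivable_id.
have x0 : 0 < x by rewrite (lt_le_trans ltr01)// (iln_dom_ge1 hx).
have -> : iln k.+1 = iln k \o @ln R by apply/funext => y; rewrite /iln iterSr.
have h1 : derivable (@ln R) x 1 by exact/ex_derive/is_derive1_ln.
have h2 : derivable (iln k) (ln x) 1 by apply: ih; exact: iln_dom_ln.
have h1' := derivableP h1. have h2' := derivableP h2.
by have [] := is_derive1_comp h2' h1'.
Qed.

End iterated_logarithm.

(** The two-sided limit exists, so quotients from the left determine it. These are the increments
    that [Fks_lb] controls at [r]. *)
Lemma derive1_le_left (R : realType) (f : R -> R) (x c d : R) : 0 < d ->
  derivable f x 1 -> (forall h, 0 < h < d -> c * h <= f (x - h) - f x) ->
  derive1 f x <= - c.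
Proof.
move=> d0 df fh; rewrite derive1E /derive (cvg_at_leftE _ 0 df).
apply: limr_le.
  by apply/cvg_ex; have /cvg_ex[l dl] := df; exists l; exact: cvg_dnbhs_at_left.
near=> h.
have h0 : h < 0 by near: h; exact: nbhs_left_lt.
have hd : - d < h by near: h; apply: nbhs_left_gt; rewrite oppr_lt0.
have := fh (- h); rewrite opprK oppr_gt0 h0 ltrNl hd => /(_ isT).
rewrite /= [h%:A]mulr1 [h + x]addrC => fh'.
rewrite -[leLHS]opprK lerNl opprK -mulNr -invrN.
by rewrite ler_pdivlMl ?oppr_gt0// mulrC.
Unshelve. all: by end_near. Qed.

(** * Growth of [F] and of its slowly varying factor *)

Section profile.
Variables (R : realType) (k : nat) (sigma : R).
Hypotheses (k0 : (0 < k)%N) (sigma0 : 0 < sigma).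
Implicit Types (r u v x y : R).

Let F := @Fks R k sigma.

Definition grow (j : nat) (s r : R) : R := (iln j r^-1) `^ s.

Let g := grow k sigma.

(* The half makes room for derivatives at the end point. *)
Definition iln_radius (j : nat) : R := (2 * iter j expR 1)^-1.

Lemma iln_radius_gt0 j : 0 < iln_radius j.
Proof. by rewrite invr_gt0 mulr_gt0// (lt_le_trans ltr01)// iter_expR_ge1. Qed.

Lemma iln_radius_dom j r : 0 < r -> r <= 2 * iln_radius j -> iln_dom j r^-1.
Proof.
move=> r0; have e0 : 0 < iter j expR 1 :> R by rewrite (lt_le_trans ltr01)// iter_expR_ge1.
have -> : 2 * iln_radius j = (iter j expR 1)^-1.
  by rewrite /iln_radius; field; rewrite gt_eqF.
by rewrite /iln_dom -{2}(invrK (iter j expR 1)) lef_pV2 ?posrE ?invr_gt0.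
Qed.

Let b := 2 * iln_radius k.

Let dom r : 0 < r -> r <= b -> iln_dom k r^-1.
Proof. exact: iln_radius_dom. Qed.

Lemma lnV_ge1 r : 0 < r -> r <= b -> 1 <= ln r^-1.
Proof.
move=> r0 rb; have h := dom r0 rb; apply: (iln_dom_ge1 (k := k.-1)).
by apply: iln_dom_ln; rewrite prednK.
Qed.

Lemma grow_ge1 r : 0 < r -> r <= b -> 1 <= g r.
Proof.
move=> r0 rb; have h := iln_ge1 (dom r0 rb).
by rewrite /g /grow -(powRr0 (iln k r^-1)) ler_powR// ltW.
Qed.

Lemma grow_ninc u v : 0 < u -> u <= v -> v <= b -> g v <= g u.
Proof.
move=> u0 uv vb; have v0 : 0 < v by rewrite (lt_le_trans u0).
have hv := dom v0 vb; have h1 := iln_ge1 hv.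
have uv' : v^-1 <= u^-1 by rewrite lef_pV2 ?posrE.
have h2 : iln k v^-1 <= iln k u^-1 by exact: ler_iln.
rewrite ge0_ler_powR ?nnegrE ?(ltW sigma0)// (le_trans ler01)//.
exact: le_trans h2.
Qed.

Lemma lnV_ratio u v : 0 < u -> 0 < v -> ln (v / u) = ln u^-1 - ln v^-1.
Proof. by move=> u0 v0; rewrite ln_div ?posrE// !lnV ?posrE// opprK addrC. Qed.

Lemma ln_ratio_ge0 u v : 0 < u -> u <= v -> 0 <= ln (v / u).
Proof. by move=> u0 uv; rewrite ln_ge0// ler_pdivlMr// mul1r. Qed.

Lemma grow_le u v : 0 < u -> u <= v -> v <= b ->
  g u <= g v * (1 + ln (v / u) / ln v^-1) `^ sigma.
Proof.
move=> u0 uv vb; have v0 : 0 < v by rewrite (lt_le_trans u0).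
have hv := dom v0 vb; have h1 := iln_ge1 hv; have L1 := lnV_ge1 v0 vb.
have L0 : 0 < ln v^-1 by rewrite (lt_le_trans ltr01).
have uv' : v^-1 <= u^-1 by rewrite lef_pV2 ?posrE.
have hu := iln_dom_le uv' hv; have h2 := iln_ge1 hu.
have a0 := ln_ratio_ge0 u0 uv.
have c0 : 0 <= 1 + ln (v / u) / ln v^-1 by rewrite addr_ge0// divr_ge0// ltW.
have i0 := le_trans ler01 h1.
rewrite /g /grow -powRM// ge0_ler_powR ?nnegrE ?(ltW sigma0) ?mulr_ge0//.
  exact: le_trans h2.
have := iln_growth k0 hv uv'; rewrite -lnV_ratio// -ler_pdivlMl// => h.
rewrite mulrDr mulr1 -lerBlDl (le_trans h)// le_eqVlt; apply/orP; left; apply/eqP.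
by field; rewrite gt_eqF.
Qed.

(** The last hypothesis says [v^2 <= u]. The quotient of logarithms in [grow_le] is then at most 1,
    so the iterated logarithm at most doubles. *)
Lemma grow_doubling u v : 0 < u -> u <= v -> v <= b ->
  ln (v / u) <= ln v^-1 -> g u <= 2 `^ sigma * g v.
Proof.
move=> u0 uv vb a1; have v0 : 0 < v by rewrite (lt_le_trans u0).
have L1 := lnV_ge1 v0 vb; have L0 : 0 < ln v^-1 by rewrite (lt_le_trans ltr01).
apply: (le_trans (grow_le u0 uv vb)); rewrite mulrC ler_wpM2r ?powR_ge0//.
have a0 := ln_ratio_ge0 u0 uv.
have c0 : 0 <= ln (v / u) / ln v^-1 by rewrite divr_ge0// ltW.
have c1 : ln (v / u) / ln v^-1 <= 1 by rewrite ler_pdivrMr// mul1r.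
rewrite ge0_ler_powR ?nnegrE ?(ltW sigma0)//; first by rewrite addr_ge0.
lra.
Qed.

Lemma FksE r : F r = ln r^-1 * g r.
Proof. by []. Qed.

Lemma Fks_lb u v : 0 < u -> u <= v -> v <= b -> ln (v / u) * g v <= F u - F v.
Proof.
move=> u0 uv vb; have v0 : 0 < v by rewrite (lt_le_trans u0).
have gg := grow_ninc u0 uv vb; have L1 := lnV_ge1 u0 (le_trans uv vb).
rewrite lnV_ratio// !FksE mulrBl lerD2r ler_wpM2l//.
exact: le_trans L1.
Qed.

(* With [z = sigma * ln (l_k u / l_k v)], the increment of [g] is at most
   [z * g u] because [exp z - 1 <= z * exp z]. *)
Lemma Fks_ub u v : 0 < u -> u <= v -> v <= b ->
  F u - F v <= (1 + sigma) * ln (v / u) * g u.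
Proof.
move=> u0 uv vb; have v0 : 0 < v by rewrite (lt_le_trans u0).
have hv := dom v0 vb; have h1 := iln_ge1 hv; have L1 := lnV_ge1 v0 vb.
have L0 : 0 < ln v^-1 by rewrite (lt_le_trans ltr01).
have uv' : v^-1 <= u^-1 by rewrite lef_pV2 ?posrE.
have hu := iln_dom_le uv' hv; have h2 := iln_ge1 hu.
have p1 : 0 < iln k v^-1 by rewrite (lt_le_trans ltr01).
have p2 : 0 < iln k u^-1 by rewrite (lt_le_trans ltr01).
pose z := sigma * (ln (iln k u^-1) - ln (iln k v^-1)).
have guE : g u = g v * expR z.
  have e x : 0 < x -> x `^ sigma = expR (sigma * ln x).
    by move=> x0; rewrite -{1}(expRln x0) -expRM mulrC.
  rewrite /g /grow !e// -expRD; congr expR.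
  by rewrite /z mulrBr addrC subrK.
have gu0 : 0 <= g u by rewrite powR_ge0.
have gv0 : 0 <= g v by rewrite powR_ge0.
have incr : g u - g v <= z * g u.
  have := expR_ge1Dx (- z); rewrite expRN => h.
  have e0 := expR_gt0 z.
  have {h} : (1 - z) * expR z <= 1 by rewrite -ler_pdivlMr// div1r.
  move=> /(ler_wpM2l gv0); rewrite mulr1 guE; lra.
have zle : ln v^-1 * z <= sigma * ln (v / u).
  rewrite /z mulrCA ler_pM2l// lnV_ratio//.
  have := iln_growth k0 hv uv'; rewrite -ler_pdivrMr// => h.
  by apply: le_trans h; rewrite -mulrA ler_pM2l// lnB_le.
have -> : F u - F v = ln (v / u) * g u + ln v^-1 * (g u - g v).
  by rewrite lnV_ratio// !FksE; ring.
have : ln v^-1 * (g u - g v) <= ln v^-1 * (z * g u) by rewrite ler_pM2l.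
have : ln v^-1 * z * g u <= sigma * ln (v / u) * g u by rewrite ler_wpM2r.
lra.
Qed.

Lemma derivable_Fks r : 0 < r -> r <= b -> derivable F r 1.
Proof.
move=> r0 rb; have h := dom r0 rb; have h1 := iln_ge1 h.
have p1 : 0 < iln k r^-1 by rewrite (lt_le_trans ltr01).
have rV0 : 0 < r^-1 by rewrite invr_gt0.
have dV : derivable (fun x : R => x^-1) r 1.
  by apply: derivableV; [rewrite gt_eqF|exact: derivable_id].
have dV' := derivableP dV.
have dln := is_derive1_ln rV0.
have dil := derivableP (derivable_iln h).
have dp : derivable (@powR R ^~ sigma) (iln k r^-1) 1.
  by apply: derivable_powR; rewrite in_itv/= p1.
have dp' := derivableP dp.
have d1 := is_derive1_comp dln dV'.
have d2 := is_derive1_comp dil dV'.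
have d3 := @is_derive1_comp R (@powR R ^~ sigma) (iln k \o GRing.inv) r _ _ dp' d2.
apply: derivableM; first by have [] := d1.
by have [] := d3.
Qed.

(** Dividing [Fks_lb] for [r - h] and [r] by [h] and letting [h] tend to 0 replaces an explicit
    formula for [F']. *)
Lemma derive1_Fks r : 0 < r -> r <= b -> g r / r <= `|derive1 F r|.
Proof.
move=> r0 rb.
have h : derive1 F r <= - (g r / r).
  apply: (derive1_le_left r0); first exact: derivable_Fks.
  move=> h /andP[h0 hr]; have rh0 : 0 < r - h by rewrite subr_gt0.
  have rh : r - h <= r by rewrite lerBlDr lerDl ltW.
  apply: le_trans (Fks_lb rh0 rh rb).
  rewrite mulrAC -mulrA mulrC ler_pM2r//; last first.
    by rewrite (lt_le_trans ltr01)// grow_ge1.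
  rewrite ln_div ?posrE//; have := lnB_le r0 rh0.
  have -> : r - h - r = - h by ring.
  by rewrite mulNr; lra.
have : 0 <= g r / r by rewrite divr_ge0 ?powR_ge0// ltW.
have := ler_norm (- derive1 F r); rewrite normrN; lra.
Qed.

End profile.

(** * Integrals *)

Section integral_comparison.
Context d (T : measurableType d) (R : realType).
Variable mu : {measure set T -> \bar R}.

(* No measurability: the integral of a nonnegative function is a supremum. *)
Lemma le_ge0_integral (D E : set T) (f g : T -> \bar R) :
  (forall x, D x -> (0 <= f x)%E) -> (forall x, E x -> (0 <= g x)%E) ->
  (forall x, D x -> E x /\ (f x <= g x)%E) ->
  (\int[mu]_(x in D) f x <= \int[mu]_(x in E) g x)%E.
Proof.
move=> f0 g0 fg; rewrite !ge0_integralE//.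
apply: ge_ereal_sup => _ [h/= hf <-]; apply: ereal_sup_ubound; exists h => //= x.
apply: (le_trans (hf x)); rewrite /patch; case: ifPn => [|_].
  by rewrite inE => /fg[Ex fgx]; rewrite mem_set.
by case: ifPn => [|_]; [rewrite inE; exact: g0|exact: lexx].
Qed.

End integral_comparison.

Section lebesgue_plane.
Variable R : realType.
Let lam := @lebesgue_measure R.

Lemma lebesgue_measure_homo (A B : set R) : A `<=` B -> (lam A <= lam B)%E.
Proof.
rewrite /lam /lebesgue_measure /lebesgue_stieltjes_measure/=.
by rewrite /measure_extension => AB; exact: le_mu_ext.
Qed.

(** Both sets may be arbitrary: [leb2] integrates the measures of sections, and both the measure of
    a section and the integral are monotone without measurability. *)
Lemma leb2_homo (A B : set (R * R)) : A `<=` B -> (leb2 R A <= leb2 R B)%E.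
Proof.
move=> AB; apply: le_ge0_integral => // x _; split => //.
by apply: lebesgue_measure_homo => y; rewrite /xsection/= !inE; exact: AB.
Qed.

Lemma leb2_rect (a b c d : R) : a <= b -> c <= d ->
  leb2 R (`]a, b[%classic `*` `]c, d[%classic) = ((b - a) * (d - c))%:E.
Proof.
move=> ab ce; rewrite /leb2/= product_measure1E//= !lebesgue_measure_itv/= !lte_fin.
have e (x y : R) : x <= y ->
    (if x < y then (y%:E + (- x)%:E)%E else 0%E) = (y - x)%:E.
  by rewrite le_eqVlt => /predU1P[->|->]; rewrite ?ltxx ?subrr// EFinD.
by rewrite !e.
Qed.

Lemma leb2_rect_cc (a b c d : R) : a <= b -> c <= d ->
  leb2 R (`[a, b]%classic `*` `[c, d]%classic) = ((b - a) * (d - c))%:E.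
Proof.
move=> ab ce; rewrite /leb2/= product_measure1E//= !lebesgue_measure_itv/= !lte_fin.
have e (x y : R) : x <= y ->
    (if x < y then (y%:E + (- x)%:E)%E else 0%E) = (y - x)%:E.
  by rewrite le_eqVlt => /predU1P[->|->]; rewrite ?ltxx ?subrr// EFinD.
by rewrite !e.
Qed.

End lebesgue_plane.

Section improper_integral.
Variable R : realType.
Let lam := @lebesgue_measure R.

(** Exhausting the open interval by compact ones reduces this to the fundamental theorem of
    calculus. Only the oscillation of [G] enters, so the integrand may be singular at both ends. *)
Lemma ge0_integral_derive_le (G g : R -> R) (a b M : R) : a < b ->
  (forall x, a < x < b -> is_derive x 1 G (g x)) ->
  (forall x, a < x < b -> {for x, continuous g}) ->
  (forall x, a < x < b -> 0 <= g x) ->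
  (forall x y, a < x < b -> a < y < b -> G y - G x <= M) ->
  (\int[lam]_(x in `]a, b[) (g x)%:E <= M%:E)%E.
Proof.
move=> ab dG cg g0 GM.
(* Dividing by [n + 3] keeps [2 * e n] below [b - a], so that every [I n] is nondegenerate. *)
pose e (n : nat) : R := (b - a) / n.+3%:R.
pose I n : set (measurableTypeR R) := `[a + e n, b - e n]%classic.
have ba : 0 < b - a by rewrite subr_gt0.
have e0 n : 0 < e n by rewrite divr_gt0.
have e2 n : e n + e n < b - a.
  rewrite /e -mulrDl ltr_pdivrMr// -mulr2n -[X in X < _]mulr_natr ltr_pM2l//.
  by rewrite ltr_nat.
have Iab n x : I n x -> a < x < b.
  rewrite /I/= in_itv/= => /andP[h1 h2]; apply/andP; split.
    by apply: lt_le_trans h1; rewrite ltrDl.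
  by apply: le_lt_trans h2 _; rewrite ltrBlDr ltrDl.
have -> : `]a, b[%classic = \bigcup_n I n.
  apply/seteqP; split => [x|x [n _ /Iab]]; last by rewrite /= in_itv.
  rewrite /= in_itv/= => /andP[ax xb].
  pose dl := Num.min (x - a) (b - x).
  have dl0 : 0 < dl by rewrite lt_min !subr_gt0 ax.
  have [n hn] : exists n : nat, (b - a) / dl < n%:R.
    exists (Num.truncn ((b - a) / dl)).+1; exact: truncnS_gt.
  exists n => //; rewrite /I/= in_itv/=.
  have : e n <= dl.
    rewrite /e ler_pdivrMr// mulrC -ler_pdivrMr// (le_trans (ltW hn))//.
    by rewrite ler_nat -addn3 leq_addr.
  by rewrite le_min => /andP[]; lra.
have mg n : measurable_fun (I n) (fun x => (g x)%:E).
  apply/measurable_EFinP; apply: subspace_continuous_measurable_fun.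
    exact: measurable_itv.
  apply: continuous_in_subspaceT => x; rewrite inE => /Iab; exact: cg.
have nd : nondecreasing_seq I.
  move=> m n mn; rewrite subsetEset => x; rewrite /I/= !in_itv/= => /andP[h1 h2].
  have : e n <= e m by rewrite /e ler_pM2l// lef_pV2 ?posrE// ler_nat !ltnS.
  by move: h1 h2; lra.
have g0' i x : I i x -> (0 <= (g x)%:E)%E by move=> /Iab /g0; rewrite lee_fin.
have cv := @ge0_nondecreasing_set_cvg_integral _ _ R I (fun x => (g x)%:E)
  (@lebesgue_measure R) nd
  (fun=> measurable_itv _) mg g0'.
apply: (closed_cvg _ (@closed_ereal_ge_ereal R M%:E)) cv.
apply: nearW => n /=.
have ab' : a + e n < b - e n by have := e2 n; lra.
have dGI x : x \in `]a + e n, b - e n[ -> a < x < b.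
  by rewrite in_itv/= => /andP[h1 h2]; apply: (@Iab n); rewrite /I/= in_itv/= !ltW.
have cG x : a < x < b -> {for x, continuous G}.
  by move=> /dG[dx _]; apply: differentiable_continuous; exact/derivable1_diffP.
have en := e0 n.
rewrite (@continuous_FTC2 R g G).
- rewrite -EFinB lee_fin; apply: GM; move: ab' en; lra.
- exact: ab'.
- by apply: continuous_in_subspaceT => x; rewrite inE => /Iab; exact: cg.
- split.
  + by move=> x /dGI/dG[].
  + by apply: cvg_at_right_filter; apply: cG; move: ab' en; lra.
  + by apply: cvg_at_left_filter; apply: cG; move: ab' en; lra.
- by move=> x /dGI/dG[_ <-]; rewrite derive1E.
Qed.

End improper_integral.

(* A cover [U] of the exceptional null set by an open set of small measure turns
   [f t - (M + e) t - K |U `&` [0, t]|] into a function that can be continued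
   downwards from every point. *)
Lemma lipschitz_ae_derive_le (R : realType) (f : R -> R) (T K M : R) :
  0 <= T -> 0 <= M ->
  (forall s t, 0 <= s <= T -> 0 <= t <= T -> `|f s - f t| <= K * `|s - t|) ->
  {ae @lebesgue_measure R, forall t, t \in `]0, T[ ->
    derivable f t 1 /\ derive1 f t <= M} ->
  f T - f 0 <= M * T.
Proof.
move=> T0 M0 fK [N [mN N0 badN]].
have [->|Tn0] := eqVneq T 0; first by rewrite subrr mulr0.
have {}T0 : 0 < T by rewrite lt_neqAle eq_sym Tn0.
have K0 : 0 <= K.
  have := fK 0 T; rewrite !lexx (ltW T0) => /(_ isT isT) h.
  have := le_trans (normr_ge0 _) h; rewrite sub0r normrN gtr0_norm//.
  by rewrite pmulr_lge0.
pose lam := @lebesgue_measure R.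
suff H e : 0 < e -> f T - f 0 <= M * T + e * (T + K).
  apply/ler_addgt0Pr => e e0.
  have TK : 0 < T + K by rewrite ltr_wpDr.
  have := H (e / (T + K)); rewrite divr_gt0// => /(_ isT).
  by rewrite divfK ?gt_eqF.
move=> e0.
(* No derivative is available at 0; adjoining 0 to the null set puts it into [U], where the
   Lipschitz bound takes over. *)
pose N' := N `|` [set 0].
have mN' : measurable N' by apply: measurableU.
have lN' : lam N' = 0%E.
  apply/eqP; rewrite eq_le measure_ge0 andbT.
  have h : (lam N' <= lam N + lam [set 0%R])%E.
    exact: (measureU2 (@lebesgue_measure R) mN (measurable_set1 (0 : R))).
  rewrite (le_trans h)// (_ : lam N = 0%E)//.
  by rewrite add0e /lam lebesgue_measure_set1; exact: lexx.
have [|U [oU NU lU]] := @lebesgue_regularity_outer R N' e mN' _ e0.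
  exact: (eq_ind_r (fun z => (z < +oo)%E) (ltry 0) lN').
have mU : measurable U by exact: open_measurable.
have {}lU : (lam U <= e%:E)%E.
  have h : (lam U <= lam N' + lam (U `\` N'))%E.
    rewrite -{1}(setDUK NU); apply: (measureU2 (@lebesgue_measure R) mN').
    exact: measurableD.
  by rewrite (le_trans h)// lN' add0e; exact: ltW.
pose phi t := fine (lam (U `&` `[0, t]%classic)).
have fin t : lam (U `&` `[0, t]%classic) \is a fin_num.
  rewrite ge0_fin_numE//; apply: (@le_lt_trans _ _ e%:E); last exact: ltry.
  by apply: le_trans lU; apply: lebesgue_measure_homo; exact: subIsetl.
have phi0 t : 0 <= phi t by exact: fine_ge0.
have phie t : phi t <= e.
  rewrite -lee_fin fineK//; apply: le_trans lU.
  by apply: lebesgue_measure_homo; exact: subIsetl.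
have phi_homo s t : s <= t -> phi s <= phi t.
  move=> st; apply: fine_le => //; apply: lebesgue_measure_homo; apply: setIS.
  by move=> x; rewrite /= !in_itv/= => /andP[-> xs]; rewrite (le_trans xs).
have phi_incr s t : 0 <= s -> s <= t -> `[s, t]%classic `<=` U ->
    phi s + (t - s) <= phi t.
  move=> s0 st stU; rewrite -lee_fin EFinD !fineK//.
  have -> : (t - s)%:E = lam `]s, t]%classic.
    rewrite /lam lebesgue_measure_itv/= lte_fin; move: st.
    by rewrite le_eqVlt => /predU1P[->|->]; rewrite ?ltxx ?subrr// EFinD.
  have disj : (U `&` `[0, s]%classic) `&` `]s, t]%classic = set0.
    apply/seteqP; split => // x [[_]]; rewrite /= !in_itv/= => /andP[_ xs] /andP[sx _].
    by move: (lt_le_trans sx xs); rewrite ltxx.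
  have mUs : measurable (U `&` `[0, s]%classic : set (measurableTypeR R)).
    by apply: measurableI => //; exact: measurable_itv.
  pose I : set R := `[0, s]%classic.
  have -> : (lam (U `&` I) + lam `]s, t]%classic)%E =
      lam ((U `&` I) `|` `]s, t]%classic).
    apply/esym; apply: (measureU (@lebesgue_measure R) mUs _ disj).
    exact: measurable_itv.
  apply: lebesgue_measure_homo => x [[Ux]|]; rewrite /I/= !in_itv/= => /andP[h1 h2].
    by split => //; rewrite h1 (le_trans h2).
  rewrite (le_trans s0 (ltW h1)) h2; split => //.
  by apply: stU; rewrite /= in_itv/= (ltW h1).
pose h t := f t - (M + e) * t - K * phi t.
(* Inside [U] the function [phi] grows at unit rate, so [K * phi] absorbs the Lipschitz growth of
   [f]. Outside [U] the derivative is below [M + e]. *)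
have step c : 0 <= c < T -> exists2 s, c < s <= T & h s <= h c.
  move=> /andP[c0 cT]; have [Uc|nUc] := pselect (U c).
    have /nbhs_ballP[d /= d0 dU] : nbhs c U by exact: open_nbhs_nbhs.
    pose s := Num.min (c + d / 2) T.
    have cs : c < s by rewrite lt_min cT andbT ltrDl divr_gt0.
    have sT : s <= T by rewrite ge_min lexx orbT.
    have sd : s <= c + d / 2 by rewrite ge_min lexx.
    exists s; first by rewrite cs.
    have csU : `[c, s]%classic `<=` U.
      move=> x; rewrite /= in_itv/= => /andP[cx xs]; apply: dU.
      rewrite /ball/= distrC ger0_norm ?subr_ge0//.
      by move: xs sd d0; lra.
    have hp := phi_incr c s c0 (ltW cs) csU.
    have sc : 0 < s - c by rewrite subr_gt0.
    have := fK s c; rewrite (ltW cT) c0 sT (le_trans c0 (ltW cs)) => /(_ isT isT).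
    rewrite (gtr0_norm sc) => /(le_trans (ler_norm _)) hf.
    rewrite /h; have : K * (phi c + (s - c)) <= K * phi s by rewrite ler_wpM2l.
    have : 0 <= (M + e) * (s - c) by apply: mulr_ge0; [rewrite addr_ge0// ltW|exact: ltW].
    by move: hf; lra.
  have [df dM] : derivable f c 1 /\ derive1 f c <= M.
    apply: contrapT => bad; apply: (nUc); apply: (NU); left; apply: badN => /= good.
    apply: bad; apply: good; rewrite in_itv/= cT andbT lt_neqAle c0 andbT.
    by apply/eqP => c00; apply: (nUc); apply: (NU); right.
  have /cvg_dnbhs_at_right dc : h^-1 *: ((f \o shift c) h%:A - f c) @[h --> 0^'] --> derive1 f c.
    by rewrite derive1E; exact: df.
  have dlt0 : derive1 f c < M + e by rewrite (le_lt_trans dM)// ltrDl.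
  move/cvgr_lt : dc => /(_ _ dlt0) dlt.
  have [u [u0 uT fu]] : exists u, [/\ 0 < u, u <= T - c &
      u^-1 *: ((f \o shift c) u%:A - f c) < M + e].
    have [u hu] : exists u, 0 < u <= T - c /\ u^-1 *: ((f \o shift c) u%:A - f c) < M + e.
      apply: (@filter_ex _ (0^'+)); near=> u; split.
        apply/andP; split; near: u; first exact: nbhs_right_gt.
        by apply: nbhs_right_le; rewrite subr_gt0.
      by near: u; exact: dlt.
    by exists u; case: hu => /andP[].
  exists (c + u); first by rewrite ltrDl u0/=; lra.
  have hp : K * phi c <= K * phi (c + u) by rewrite ler_wpM2l// phi_homo// lerDl ltW.
  move: fu; rewrite /= [u%:A]mulr1 [u + c]addrC /h.
  rewrite -[_ *: _]/(_ * _) ltr_pdivrMl//; move: hp; lra.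
pose S := [set t | 0 <= t <= T /\ h t <= h 0].
have S0 : S 0 by split; rewrite ?lexx ?(ltW T0).
have supS : has_sup S by split; [exists 0|exists T => t [/andP[]]].
pose c := sup S.
have c0 : 0 <= c by apply: sup_upper_bound.
have cT : c <= T by apply: ge_sup; [exists 0|move=> t [/andP[]]].
(* The supremum is attained without continuity of [h]: approaching from the left, [f] is Lipschitz
   and [phi] is monotone in the favourable direction. *)
have Sc : S c.
  split; first by rewrite c0.
  apply/ler_addgt0Pr => d d0.
  have B0 : 0 < K + (M + e) + 1 by lra.
  have dB0 : 0 < d / (K + (M + e) + 1) by rewrite divr_gt0.
  have [s [/andP[s0 sT] hs] sc] := sup_adherent dB0 supS.
  have cs : s <= c by apply: sup_upper_bound => //; split; rewrite ?s0.
  have := fK c s; rewrite c0 cT s0 sT (ger0_norm (x := c - s)) ?subr_ge0// => /(_ isT isT).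
  move=> /(le_trans (ler_norm _)) hf.
  have hp : K * phi s <= K * phi c by rewrite ler_wpM2l// phi_homo.
  have : (c - s) * (K + (M + e) + 1) <= d.
    by rewrite -ler_pdivlMr//; move: sc; rewrite -/c; lra.
  have e1 : 0 <= (M + e) * (c - s) by rewrite mulr_ge0 ?subr_ge0// addr_ge0// ltW.
  have e2 : 0 <= c - s by rewrite subr_ge0.
  by move: hs hf hp; rewrite /h; lra.
have cTE : c = T.
  apply/eqP; rewrite eq_le cT leNgt; apply/negP => ltcT.
  have [|s /andP[cs sT] hs] := step c; first by rewrite c0.
  have : s <= c.
    apply: sup_upper_bound => //; split; first by rewrite sT andbT (le_trans c0)// ltW.
    by case: Sc => _; exact: le_trans hs.
  by rewrite leNgt cs.
case: Sc => _; rewrite cTE /h mulr0 subr0.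
have : K * phi T <= K * e by rewrite ler_wpM2l.
have : 0 <= K * phi 0 by rewrite mulr_ge0.
lra.
Unshelve. all: by end_near. Qed.

(** * The control metric *)

Lemma lipschitz_onP (R : realType) (V : normedModType R) (f : R -> V) (A : set R) :
  [lipschitz f t | t in A] <->
  exists2 K, 0 <= K & forall s t, A s -> A t -> `|f s - f t| <= K * `|s - t|.
Proof.
split => [|[K K0 fK]].
  move=> h; have [K [K0 hK]] : exists K, 0 <= K /\ K.-lipschitz_A f.
    apply: (@filter_ex _ (+oo)); near=> K; split; first by near: K; apply: nbhs_pinfty_ge.
    by near: K.
  by exists K => // s t As At; exact: (hK (s, t)).
rewrite /lipschitz_on; near=> K' => -[s t] [/= As At].
suff : `|f s - f t| <= K' * `|s - t| by [].
rewrite (le_trans (fK _ _ As At))//.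
rewrite ler_wpM2r//; near: K'; apply: nbhs_pinfty_ge; exact: num_real.
Unshelve. all: by end_near. Qed.

Lemma derivable_fst (R : realType) (g : R -> R * R) (t : R) : derivable g t 1 ->
  derivable (fst \o g) t 1 /\ derive1 (fst \o g) t = (derive1 g t).1.
Proof.
move=> dg; have c : h^-1 *: (((fst \o g) \o shift t) h%:A - (fst \o g) t) @[h --> 0^']
    --> (derive1 g t).1.
  rewrite derive1E.
  exact: (@cvg_comp _ _ _ _ fst _ _ _ dg cvg_fst).
by split; [apply: cvgP c | rewrite derive1E; exact: cvg_lim].
Qed.

Lemma derivable_snd (R : realType) (g : R -> R * R) (t : R) : derivable g t 1 ->
  derivable (snd \o g) t 1 /\ derive1 (snd \o g) t = (derive1 g t).2.
Proof.
move=> dg; have c : h^-1 *: (((snd \o g) \o shift t) h%:A - (snd \o g) t) @[h --> 0^']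
    --> (derive1 g t).2.
  rewrite derive1E.
  exact: (@cvg_comp _ _ _ _ snd _ _ _ dg cvg_snd).
by split; [apply: cvgP c | rewrite derive1E; exact: cvg_lim].
Qed.

Lemma is_derive_affine (R : realType) (V : normedModType R) (y v : V) (T t : R) :
  is_derive t 1 (fun u : R => y + (u - T) *: v) v.
Proof.
have c : h^-1 *: (((fun u : R => y + (u - T) *: v) \o shift t) h%:A -
    (y + (t - T) *: v)) @[h --> 0^'] --> v.
  apply: cvg_near_cst; near=> h.
  have h0 : h != 0 by near: h; exact: nbhs_dnbhs_neq.
  rewrite /= [h%:A]mulr1 opprD addrACA subrr add0r -scalerBl.
  have -> : h + t - T - (t - T) = h by ring.
  by rewrite scalerA mulVf// scale1r.
by apply: DeriveDef; [apply: cvgP c|exact: cvg_lim].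
Unshelve. all: by end_near. Qed.

Section curves.
Variables (R : realType) (F : R -> R).
Implicit Types (x y z v : R * R) (T S r : R).
Let f := fF F.

Lemma fF_ge0 a : 0 <= f a.
Proof. by rewrite /f /fF; case: ifP => // _; rewrite expR_ge0. Qed.

Lemma fF_gt0 a : a != 0 -> 0 < f a.
Proof. by rewrite /f /fF => /negPf ->; rewrite expR_gt0. Qed.

Lemma fF_norm a : f `|a| = f a.
Proof. by rewrite /f /fF normr_eq0 normr_id. Qed.

(** Unlike in [cdist], time 0 is allowed, so that the constant path can start every concatenation.
    [cdist_le] and [cdist_lt] translate between the two. *)
Definition reach x y T :=
  0 <= T /\ exists gamma, [/\ subunit_curve F T gamma, gamma 0 = x & gamma T = y].

Lemma reach_refl x : reach x x 0.
Proof.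
split => //; exists (fun=> x); split => //; split.
  by apply/lipschitz_onP; exists 0 => // s t _ _; rewrite subrr normr0 mul0r.
by apply: aeW => t; rewrite in_itv/= => /andP[/lt_trans h/h]; rewrite ltxx.
Qed.

(** Horizontal, vertical and resting segments are the only pieces from which paths are built. The
    gluing time [T], where the derivative may fail to exist, is a null set. *)
Lemma reach_segment x y T S v : reach x y T -> 0 <= S ->
  (forall s, 0 <= s <= S -> subunit_vector F (y + s *: v) v) ->
  reach x (y + S *: v) (T + S).
Proof.
move=> [T0 [g [[gL gN] g0 gT]]] S0 sv; split; first exact: addr_ge0.
pose G t := if t <= T then g t else y + (t - T) *: v.
have GE t : T <= t -> G t = y + (t - T) *: v.
  rewrite /G; case: ifP => // tT Tt; have -> : t = T by apply/eqP; rewrite eq_le tT.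
  by rewrite subrr scale0r addr0.
exists G; split.
- split.
    move/lipschitz_onP : gL => [K K0 gK]; apply/lipschitz_onP.
    exists (K + `|v|); first by rewrite addr_ge0.
    have H s t : 0 <= s -> s <= t -> t <= T + S -> `|G s - G t| <= (K + `|v|) * `|s - t|.
      move=> s0 st tTS; rewrite [in leRHS]distrC (ger0_norm (x := t - s)) ?subr_ge0//.
      have ts : 0 <= t - s by rewrite subr_ge0.
      case: (leP t T) => tT.
        have sT := le_trans st tT; rewrite /G tT sT.
        have := gK s t; rewrite /= !in_itv/= s0 sT tT (le_trans s0 st) => /(_ isT isT).
        rewrite distrC [X in _ * X]distrC (ger0_norm ts) distrC => /le_trans; apply.
        by rewrite ler_wpM2r// lerDl.
      rewrite (GE t (ltW tT)); case: (leP s T) => sT; last first.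
        rewrite (GE s (ltW sT)) opprD addrACA subrr add0r -scalerBl normrZ.
        have -> : s - T - (t - T) = - (t - s) by ring.
        rewrite normrN (ger0_norm ts) mulrC ler_wpM2r// lerDr//.
      have -> : G s = g s by rewrite /G sT.
      rewrite -gT.
      have -> : g s - (g T + (t - T) *: v) = (g s - g T) - (t - T) *: v.
        by rewrite opprD addrA.
      rewrite (le_trans (ler_normB _ _))// normrZ (gtr0_norm (x := t - T)) ?subr_gt0//.
      have := gK s T; rewrite /= !in_itv/= s0 sT T0 lexx => /(_ isT isT).
      rewrite distrC [X in _ * X]distrC (ger0_norm (x := T - s)) ?subr_ge0// distrC => h.
      rewrite (le_trans (lerD h (lexx _)))//.
      have e1 : 0 <= `|v| * (T - s) by rewrite mulr_ge0// subr_ge0.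
      have e2 : 0 <= K * (t - T) by rewrite mulr_ge0// subr_ge0 ltW.
      by move: e1 e2; lra.
    move=> s t; rewrite /= !in_itv/= => /andP[s0 sT] /andP[t0 tT].
    case: (leP s t) => st; first exact: H.
    by rewrite distrC [X in _ * X]distrC H// ltW.
  have gN1 : {ae @lebesgue_measure R, forall t, t != T}.
    exists [set T]; split; [exact: measurable_set1|exact: lebesgue_measure_set1|].
    by move=> t /= /negP; rewrite negbK => /eqP.
  have aeF := @ae_filter_ringOfSetsType _ _ R (@lebesgue_measure R).
  apply: (@filterS2 _ _ aeF _ _ _ _ gN gN1) => t ht tT; rewrite in_itv/= => /andP[t0 tTS].
  case: (ltgtP t T) tT => // [tT|Tt] _.
    have [dg sg] : derivable g t 1 /\ subunit_vector F (g t) (derive1 g t).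
      by apply: ht; rewrite in_itv/= t0 tT.
    have nG : {near t, g =1 G}.
      near=> u; rewrite /G ifT//; apply: ltW; near: u; exact: lt_nbhsl.
    have dG : is_derive t 1 G (derive1 g t).
      rewrite derive1E; by apply: near_eq_is_derive nG _; exact/derivableP.
    have -> : derive1 G t = derive1 g t by rewrite derive1E derive_val.
    split; first by case: dG.
    by rewrite /G (ltW tT); exact: sg.
  have nG : {near t, (fun u => y + (u - T) *: v) =1 G}.
    near=> u; rewrite GE//; apply: ltW; near: u; exact: lt_nbhsr.
  have dG : is_derive t 1 G v.
    by apply: near_eq_is_derive nG _; exact: is_derive_affine.
  have -> : derive1 G t = v by rewrite derive1E derive_val.
  split; first by case: dG.
  rewrite (GE t (ltW Tt)); apply: sv.
  by rewrite subr_ge0 (ltW Tt) lerBlDl ltW.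
- by rewrite /G T0.
- by rewrite GE ?lerDl// [T + S]addrC addrK.
Unshelve. all: by end_near. Qed.

Lemma subunit_vectorP p v : subunit_vector F p v -> `|v.1| <= 1 /\ `|v.2| <= f p.1.
Proof.
move=> h; split.
  have := h (1, 0); rewrite /= !(mulr1, mulr0, addr0) expr1n expr0n/= addr0.
  by rewrite -real_normK ?num_real// expr_le1.
have := h (0, 1); rewrite /= !(mulr1, mulr0, add0r) expr0n/= add0r.
by rewrite -real_normK ?num_real// ler_sqr// nnegrE// fF_ge0.
Qed.

Lemma reach_le x y T S : reach x y T -> T <= S -> reach x y S.
Proof.
move=> h TS; have := @reach_segment x y T (S - T) 0 h.
rewrite scaler0 addr0 [T + _]addrC subrK subr_ge0; apply => // s _ xi.
by rewrite /= !mul0r addr0 expr0n/= addr_ge0// sqr_ge0.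
Qed.

Lemma reach_horizontal x y T a : reach x y T -> reach x (a, y.2) (T + `|a - y.1|).
Proof.
move=> h; have := @reach_segment x y T `|a - y.1| (Num.sg (a - y.1), 0) h.
have -> : y + `|a - y.1| *: (Num.sg (a - y.1), 0) = (a, y.2).
  apply/pair_equal_spec; split; rewrite /=; last by rewrite scaler0 addr0.
  by rewrite -[_ *: _]/(_ * _) mulrC -numEsg addrC subrK.
apply => // s _ xi; rewrite /= mul0r addr0 exprMn.
rewrite -[leLHS]addr0 lerD ?sqr_ge0// ler_piMl ?sqr_ge0//.
by rewrite sqr_sg lern1 leq_b1.
Qed.

Lemma reach_vertical x y T a : reach x y T -> 0 < f y.1 ->
  reach x (y.1, a) (T + `|a - y.2| / f y.1).
Proof.
move=> h f0; have := @reach_segment x y T (`|a - y.2| / f y.1) (0, Num.sg (a - y.2) * f y.1) h.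
have -> : y + (`|a - y.2| / f y.1) *: (0, Num.sg (a - y.2) * f y.1) = (y.1, a).
  apply/pair_equal_spec; split; rewrite /=; first by rewrite scaler0 addr0.
  rewrite -[_ *: _]/(_ * _) mulrCA divfK ?gt_eqF// -numEsg addrC subrK//.
apply; first by rewrite divr_ge0// ltW.
move=> s _ xi; rewrite /= scaler0 addr0 mul0r add0r !exprMn.
rewrite -[leLHS]add0r lerD ?sqr_ge0//.
rewrite -mulrA ler_piMl//; first by rewrite mulr_ge0// sqr_ge0.
by rewrite sqr_sg lern1 leq_b1.
Qed.

(** Vertical motion is impossible on the axis, where [f] vanishes, so the path makes a detour
    through abscissa 1. *)
Lemma reachable x y : exists T, reach x y T.
Proof.
have h1 := reach_horizontal 1 (reach_refl x).
have f1 : 0 < f 1 by rewrite fF_gt0// oner_eq0.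
have h2 := reach_vertical y.2 h1 f1.
by have := reach_horizontal y.1 h2; rewrite -surjective_pairing => h3; eexists; exact: h3.
Qed.

Let times x y := [set T | 0 < T /\
    exists gamma, [/\ subunit_curve F T gamma, gamma 0 = x & gamma T = y]].

Let times_inf x y : has_inf (times x y).
Proof.
split; last by exists 0 => T [/ltW].
have [T h] := reachable x y.
have T1 : T <= T + 1 by rewrite lerDl.
have [_ ex] := reach_le h T1.
by exists (T + 1); split => //; case: h => T0 _; rewrite ltr_wpDl.
Qed.

Lemma cdist_ge0 x y : 0 <= cdist F x y.
Proof. by apply: lb_le_inf; [case: (times_inf x y)|move=> T [/ltW]]. Qed.

Lemma cdist_le x y T : reach x y T -> cdist F x y <= T.
Proof.
move=> h; apply/ler_addgt0Pr => e e0; apply: ge_inf; first by case: (times_inf x y).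
have Te : T <= T + e by rewrite lerDl ltW.
have [T0 _] := h; have [_ ex] := reach_le h Te.
by split => //; rewrite ltr_wpDl.
Qed.

Lemma cdist_lt x y r : cdist F x y < r -> exists2 T, T < r & reach x y T.
Proof.
move=> h; have r0 : 0 < r - cdist F x y by rewrite subr_gt0.
have [T [T0 ex]] := inf_adherent r0 (times_inf x y).
by rewrite addrC subrK => Tr; exists T => //; split => //; exact: ltW.
Qed.

Lemma subunit_curve_lipschitz T gamma : subunit_curve F T gamma ->
  exists2 K, 0 <= K & forall s t, 0 <= s <= T -> 0 <= t <= T ->
    `|(gamma s).1 - (gamma t).1| <= K * `|s - t| /\
    `|(gamma s).2 - (gamma t).2| <= K * `|s - t|.
Proof.
move=> [/lipschitz_onP[K K0 gK] _]; exists K => // s t sT tT.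
have := gK s t; rewrite /= !in_itv/= => /(_ sT tT).
by rewrite prod_normE/= ge_max => /andP[].
Qed.

(** [lipschitz_ae_derive_le] bounds increments from above only, so it is applied to each coordinate
    and to its negative. *)
Lemma subunit_curve_increment T t gamma M : 0 <= T -> subunit_curve F T gamma -> 0 <= t <= T ->
  `|(gamma t).1 - (gamma 0).1| <= t /\
  (0 <= M -> (forall s, 0 <= s <= t -> f (gamma s).1 <= M) ->
    `|(gamma t).2 - (gamma 0).2| <= M * t).
Proof.
move=> T0 cg /andP[t0 tT]; have [K K0 gK] := subunit_curve_lipschitz cg.
have [_ ag] := cg.
have aeF := @ae_filter_ringOfSetsType _ _ R (@lebesgue_measure R).
have wid s : 0 <= s <= t -> 0 <= s <= T by move=> /andP[-> /le_trans]; apply.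
have dneg (h : R -> R) s : derivable h s 1 ->
    derivable (fun u => - h u) s 1 /\ derive1 (fun u => - h u) s = - derive1 h s.
  move=> dh; split; first exact: derivableN.
  by rewrite !derive1E deriveN.
split; [|move=> M0 fM].
  rewrite ler_norml; apply/andP; split.
    rewrite lerNl opprB -[leRHS]mul1r.
    have -> : (gamma 0).1 - (gamma t).1 = - (gamma t).1 - - (gamma 0).1 by ring.
    apply: (@lipschitz_ae_derive_le R (fun s => - (gamma s).1) t K 1) => //.
      move=> s u /wid sT /wid uT; rewrite -opprD normrN.
      by have [] := gK s u sT uT.
    apply: (@filterS _ _ aeF _ _ _ ag) => s hs; rewrite in_itv/= => /andP[s0 st].
    have [|dg /subunit_vectorP[v1 _]] := hs; first by rewrite in_itv/= s0 (lt_le_trans st).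
    have [d1 e1] := derivable_fst dg; have [d2 e2] := dneg _ _ d1.
    by split => //; rewrite e2 e1; move: v1; rewrite ler_norml => /andP[]; lra.
  rewrite -[leRHS]mul1r.
  apply: (@lipschitz_ae_derive_le R (fun s => (gamma s).1) t K 1) => //.
    by move=> s u /wid sT /wid uT; have [] := gK s u sT uT.
  apply: (@filterS _ _ aeF _ _ _ ag) => s hs; rewrite in_itv/= => /andP[s0 st].
  have [|dg /subunit_vectorP[v1 _]] := hs; first by rewrite in_itv/= s0 (lt_le_trans st).
  have [d1 e1] := derivable_fst dg.
  by split => //; rewrite [X in X <= _]e1; move: v1; rewrite ler_norml => /andP[].
have fM' s : 0 < s -> s < t -> f (gamma s).1 <= M by move=> s0 st; rewrite fM// !ltW.
rewrite ler_norml; apply/andP; split.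
  rewrite lerNl opprB.
  have -> : (gamma 0).2 - (gamma t).2 = - (gamma t).2 - - (gamma 0).2 by ring.
  apply: (@lipschitz_ae_derive_le R (fun s => - (gamma s).2) t K M) => //.
    move=> s u /wid sT /wid uT; rewrite -opprD normrN.
    by have [] := gK s u sT uT.
  apply: (@filterS _ _ aeF _ _ _ ag) => s hs; rewrite in_itv/= => /andP[s0 st].
  have [|dg /subunit_vectorP[_ v2]] := hs; first by rewrite in_itv/= s0 (lt_le_trans st).
  have [d1 e1] := derivable_snd dg; have [d2 e2] := dneg _ _ d1.
  split => //; rewrite e2 e1; have := fM' s s0 st.
  by move: v2; rewrite ler_norml => /andP[]; lra.
apply: (@lipschitz_ae_derive_le R (fun s => (gamma s).2) t K M) => //.
  by move=> s u /wid sT /wid uT; have [] := gK s u sT uT.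
apply: (@filterS _ _ aeF _ _ _ ag) => s hs; rewrite in_itv/= => /andP[s0 st].
have [|dg /subunit_vectorP[_ v2]] := hs; first by rewrite in_itv/= s0 (lt_le_trans st).
have [d1 e1] := derivable_snd dg.
split => //; rewrite [X in X <= _]e1; have := fM' s s0 st.
by move: v2; rewrite ler_norml => /andP[]; lra.
Qed.

Lemma reach_fst x y T : reach x y T -> `|y.1 - x.1| <= T.
Proof.
move=> [T0 [g [cg g0 gT]]].
have [|h _] := @subunit_curve_increment T T g 0 T0 cg; first by rewrite T0/=.
by rewrite -g0 -gT.
Qed.

Lemma reach_snd x y T M : reach x y T -> 0 <= M ->
  (forall a, `|a - x.1| <= T -> f a <= M) -> `|y.2 - x.2| <= M * T.
Proof.
move=> [T0 [g [cg g0 gT]]] M0 fM.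
have [|_ /(_ M0) h] := @subunit_curve_increment T T g M T0 cg; first by rewrite T0/=.
rewrite -g0 -gT; apply: h => s sT; apply: fM.
have [h _] := @subunit_curve_increment T s g 0 T0 cg sT.
by rewrite -g0 (le_trans h)//; case/andP: sT.
Qed.

(** Even a point of the axis has a neighbourhood inside the ball: from [y] one moves to an abscissa
    [w] off the axis at distance [d / 8], vertically there, and back, at a total cost below the
    spare time [d]. *)
Lemma cball_open x r : open (cball F x r).
Proof.
rewrite openE => y xy; have [T Tr xyT] := cdist_lt xy.
pose d := r - T; have d0 : 0 < d by rewrite subr_gt0.
pose w := if 0 <= y.1 then y.1 + d / 8 else y.1 - d / 8.
have wy : `|w - y.1| = d / 8.
  have d8 : 0 <= d / 8 by lra.
  by rewrite /w; case: ifP => _; rewrite addrC addKr ?normrN ger0_norm.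
have w0 : w != 0.
  rewrite /w; case: ifPn => h; first by rewrite gt_eqF//; lra.
  by rewrite lt_eqF//; rewrite -ltNge in h; lra.
have fw : 0 < f w by exact: fF_gt0.
have fwd : 0 < f w * (d / 4) by rewrite mulr_gt0//; lra.
have [d8 d4] : 0 < d / 8 /\ d / 4 = d / 8 + d / 8 by split; lra.
pose e := Num.min (d / 8) (f w * (d / 4)).
have e0 : 0 < e by rewrite lt_min d8.
apply/nbhs_ballP; exists e => //= z [/= z1 z2].
rewrite /ball/= in z1 z2; rewrite /cball/=.
have h1 := reach_horizontal w xyT.
have h2 := reach_vertical z.2 h1 fw.
have := reach_horizontal z.1 h2; rewrite -surjective_pairing/= => h3.
apply: (le_lt_trans (cdist_le h3)).
have {}z1 : `|z.1 - y.1| < d / 8 by rewrite distrC (lt_le_trans z1)// ge_min lexx.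
have {}z2 : `|z.2 - y.2| / f w <= d / 4.
  rewrite ler_pdivrMr// mulrC ltW// distrC (lt_le_trans z2)// ge_min lexx orbT//.
have z3 : `|z.1 - w| <= d / 8 + d / 8.
  rewrite -[z.1 - w](subrKA y.1) (le_trans (ler_normD _ _))// lerD ?(ltW z1)//.
  by rewrite distrC wy.
rewrite wy; move: z2 z3; rewrite /d; lra.
Qed.

End curves.

(** * Balls and the kernel *)

(** An open set is the countable union of the rational squares it contains, and these are measurable
    for the product sigma-algebra. *)
Lemma open_measurable_plane (R : realType) (U : set (R * R)) :
  open U -> measurable (U : set (measurableTypeR R * measurableTypeR R)).
Proof.
move=> oU.
pose box (i : rat * rat * nat) : set (R * R) :=
  `](ratr i.1.1 - i.2.+1%:R^-1), (ratr i.1.1 + i.2.+1%:R^-1)[%classic `*`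
  `](ratr i.1.2 - i.2.+1%:R^-1), (ratr i.1.2 + i.2.+1%:R^-1)[%classic.
pose F i := if pselect (box i `<=` U) then box i else set0.
have -> : U = \bigcup_i F i.
  apply/seteqP; split => [y Uy|y [i _]]; last first.
    by rewrite /F; case: pselect => // h; exact: h.
  have /nbhs_ballP[e /= e0 eU] : nbhs y U by exact: open_nbhs_nbhs.
  have [n hn] : exists n : nat, 2 / e < n%:R :> R.
    by exists (Num.truncn (2 / e)).+1; exact: truncnS_gt.
  pose d : R := n.+1%:R^-1.
  have d0 : 0 < d by rewrite invr_gt0.
  have de : d + d < e.
    rewrite -mulr2n -mulr_natl /d ltr_pdivrMr// -ltr_pdivrMl// mulrC.
    by rewrite (lt_trans hn)// ltr_nat.
  have rt (a : R) : exists q : rat, `|ratr q - a| < d.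
    have [q] := @rat_in_itvoo R (a - d) (a + d) ltac:(lra).
    rewrite in_itv/= => /andP[q1 q2]; exists q.
    by rewrite ltr_norml; apply/andP; split; lra.
  have [p hp] := rt y.1; have [q hq] := rt y.2.
  have inb (a c : R) : `|a - c| < d <-> c \in `](a - d), (a + d)[.
    rewrite in_itv/= ltr_norml; split=> /andP[h1 h2]; apply/andP; split; lra.
  exists (p, q, n) => //; rewrite /F; case: pselect => [yes|bad].
    by rewrite /box/=; split; apply/inb.
  exfalso; apply: bad => z [/= /inb z1 /inb z2]; apply: eU.
  split; rewrite /ball/=.
    have -> : y.1 - z.1 = (ratr p - z.1) - (ratr p - y.1) by ring.
    by rewrite (le_lt_trans (ler_normB _ _))//; lra.
  have -> : y.2 - z.2 = (ratr q - z.2) - (ratr q - y.2) by ring.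
  by rewrite (le_lt_trans (ler_normB _ _))//; lra.
apply: countable_bigcupT_measurable; first exact: countableP.
move=> i; rewrite /F; case: pselect => [yes|no]; last exact: measurable0.
by apply: measurableX; exact: measurable_itv.
Qed.

(* What the estimates use of [F_(k,sigma)]; [g r] stands for [(ln^(k) (1/r))^sigma]. *)
Record profile (R : realType) (F g : R -> R) (b D : R) : Prop := Profile {
  profile_b0 : 0 < b;
  profile_b1 : b <= 1 / 2;
  profile_D1 : 1 <= D;
  profile_ge1 : forall x, 0 < x -> x <= b -> 1 <= g x;
  profile_ninc : forall u v, 0 < u -> u <= v -> v <= b -> g v <= g u;
  profile_slow : forall u v, 0 < u -> u <= v -> v <= b -> v * v <= u -> g u <= D * g v;
  profile_lb : forall u v, 0 < u -> u <= v -> v <= b -> ln (v / u) * g v <= F u - F v;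
  profile_ub : forall u v, 0 < u -> u <= v -> v <= b -> F u - F v <= D * ln (v / u) * g u;
  profile_derive : forall x, 0 < x -> x <= b -> g x / x <= `|derive1 F x| }.

(** * Comparison of [f], of the scale and of balls for a general profile *)

Section geometry_bounds.
Variables (R : realType) (F g : R -> R) (b D : R).
Hypothesis P : profile F g b D.
Implicit Types (x y z : R * R) (u v t r : R).

Let f := fF F.
Let b0 := profile_b0 P.
Let D1 := profile_D1 P.
Let D0 : 0 < D. Proof. exact: lt_le_trans D1. Qed.

(* The scale [1 / |F'|] at [u], up to constants. *)
Definition scale (h : R -> R) u := u / h u.
Let S := scale g.

Let g0 u : 0 < u -> u <= b -> 0 < g u.
Proof. by move=> u0 ub; rewrite (lt_le_trans ltr01)// (profile_ge1 P). Qed.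

Lemma scale_gt0 u : 0 < u -> u <= b -> 0 < S u.
Proof. by move=> u0 ub; rewrite divr_gt0// g0. Qed.

Lemma scale_le u : 0 < u -> u <= b -> S u <= u.
Proof.
by move=> u0 ub; rewrite ler_pdivrMr ?g0// ler_peMr ?(ltW u0)// (profile_ge1 P).
Qed.

Lemma ler_scale u v : 0 < u -> u <= v -> v <= b -> S u <= S v.
Proof.
move=> u0 uv vb; have v0 := lt_le_trans u0 uv.
rewrite ler_pM ?invr_ge0 ?(ltW u0) ?(ltW (g0 _ _))//; last 2 first.
  exact: le_trans vb.
by rewrite lef_pV2 ?posrE ?g0 ?(profile_ninc P)// (le_trans uv).
Qed.

Lemma scale_slow u v c : 0 < u -> u <= v -> v <= b -> v * v <= u -> v <= c * u ->
  S v <= c * D * S u.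
Proof.
move=> u0 uv vb vvu vcu; have v0 := lt_le_trans u0 uv.
have gu := g0 u0 (le_trans uv vb); have gv := g0 v0 vb.
have c0 : 0 < c by rewrite -(pmulr_lgt0 _ u0) (lt_le_trans v0).
rewrite /S /scale ler_pdivrMr// (le_trans vcu)//.
have -> : c * D * (u / g u) * g v = c * u * (D * g v / g u) by ring.
rewrite ler_peMr ?mulr_ge0 ?(ltW c0) ?(ltW u0)//.
by rewrite ler_pdivlMr// mul1r (profile_slow P).
Qed.

Lemma fF_pos u : 0 < u -> f u = expR (- F u).
Proof. by move=> u0; rewrite /f /fF gt_eqF// gtr0_norm. Qed.

Lemma f_gt0 u : 0 < u -> 0 < f u.
Proof. by move=> u0; rewrite fF_pos// expR_gt0. Qed.

Lemma ln_ratio_le u v : 0 < u -> 0 < v -> ln (v / u) <= (v - u) / u.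
Proof. by move=> u0 v0; rewrite ln_div ?posrE// lnB_le. Qed.

(** The inequality [1 - u / v <= ln (v / u)] turns [profile_lb] into exponential decay at the scale
    [S v]. *)
Lemma f_decay u v : 0 < u -> u <= v -> v <= b -> f u <= f v * expR (- ((v - u) / S v)).
Proof.
move=> u0 uv vb; have v0 := lt_le_trans u0 uv.
rewrite !fF_pos// -expRD ler_expR.
have h := profile_lb P u0 uv vb; have gv := g0 v0 vb.
suff : (v - u) / S v <= ln (v / u) * g v by lra.
have -> : (v - u) / S v = (v - u) / v * g v.
  by rewrite /S /scale; field; rewrite !gt_eqF.
rewrite ler_pM2r//; have := ln_ratio_le v0 u0.
rewrite !ln_div ?posrE//; have -> : (u - v) / v = - ((v - u) / v) by ring.
lra.
Qed.

Lemma ler_f u v : 0 < u -> u <= v -> v <= b -> f u <= f v.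
Proof.
move=> u0 uv vb; have v0 := lt_le_trans u0 uv.
apply: (le_trans (f_decay u0 uv vb)).
rewrite ler_piMr ?(ltW (f_gt0 v0))// expR_le1 oppr_le0 divr_ge0 ?subr_ge0//.
by rewrite ltW// scale_gt0.
Qed.

Lemma f_sup u v : `|u| <= v -> 0 < v -> v <= b -> f u <= f v.
Proof.
move=> uv v0 vb; rewrite /f -(fF_norm F u) -/f; have [->|un0] := eqVneq u 0.
  by rewrite normr0 /f /fF eqxx fF_ge0.
by rewrite ler_f// normr_gt0.
Qed.

Let A := expR (D * D).

Lemma A_ge1 : 1 <= A.
Proof. by rewrite -expR0 ler_expR mulr_ge0// ltW. Qed.

Let A0 : 0 < A. Proof. exact: expR_gt0. Qed.

Lemma f_comparable u v : 0 < u -> u <= v -> v <= b -> ln (v / u) * g u <= D ->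
  f v <= A * f u.
Proof.
move=> u0 uv vb h; have v0 := lt_le_trans u0 uv.
rewrite !fF_pos// -expRD ler_expR; have := profile_ub P u0 uv vb.
have : D * (ln (v / u) * g u) <= D * D by rewrite ler_pM2l.
rewrite mulrA; lra.
Qed.

Lemma f_forward u v : 0 < u -> u <= v -> v <= b -> v - u <= S u -> f v <= A * f u.
Proof.
move=> u0 uv vb h; have v0 := lt_le_trans u0 uv; have ub := le_trans uv vb.
apply: f_comparable => //; apply: le_trans D1; have gu := g0 u0 ub.
rewrite -ler_pdivlMr// mul1r (le_trans (ln_ratio_le u0 v0))//.
by rewrite ler_pdivrMr// mulrC.
Qed.

(** The step is measured by [S v], whereas [f_comparable] asks for [g u]. Since [S v <= v <= 1/2],
    half a scale keeps [u >= v / 2 >= v^2], and there [g u <= D * g v]. *)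
Lemma f_backward u v : 0 < v -> v <= b -> u <= v -> v - u <= S v / 2 ->
  v / 2 <= u /\ f v <= A * f u.
Proof.
move=> v0 vb uv h; have Sv := scale_le v0 vb.
have vu : v / 2 <= u by lra.
have u0 : 0 < u by lra.
have ub := le_trans uv vb; have gu := g0 u0 ub; have gv := g0 v0 vb.
split => //; apply: f_comparable => //.
have b1 := profile_b1 P.
have vvu : v * v <= u.
  apply: le_trans vu; rewrite ler_pM2l//; lra.
have gs := profile_slow P u0 uv vb vvu.
have lr : ln (v / u) <= (g v)^-1.
  apply: (le_trans (ln_ratio_le u0 v0)); rewrite ler_pdivrMr//.
  apply: (le_trans h); rewrite /S /scale mulrAC mulrC ler_pM2l ?invr_gt0//.
apply: (@le_trans _ _ ((g v)^-1 * g u)); first by rewrite ler_pM2r.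
by rewrite ler_pdivrMl// mulrC.
Qed.

(** The integrand increases with [f a], and [f_decay] bounds [f a] by [f v * exp (- w)] with
    [w = (v - a) / S v]. The resulting majorant [h] has the primitive [G], whose oscillation is at
    most [f v * S v]. *)
Lemma hstar_le u t : 0 < u -> 0 <= t -> u + t <= b -> hstar F u t <= f (u + t) * S (u + t).
Proof.
move=> u0 t0 utb; set v := u + t.
have v0 : 0 < v by rewrite ltr_wpDr.
have fv := f_gt0 v0; have Sv := scale_gt0 v0 utb.
rewrite /hstar -/f -/v /Rintegral.
set I := (\int[_]_(_ in _) _)%E.
have I0 : (0 <= I)%E.
  apply: integral_ge0 => a _; rewrite lee_fin divr_ge0 ?sqr_ge0 ?sqrtr_ge0//.
suff Ile : (I <= (f v * S v)%:E)%E.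
  by rewrite -lee_fin fineK// ge0_fin_numE// (le_lt_trans Ile)// ltry.
move: t0; rewrite le_eqVlt => /predU1P[t0|t0].
  rewrite /I (_ : v = u) /v -?t0 ?addr0//.
  rewrite set_itv1 integral_set1 lee_fin mulr_ge0 ?ltW// /S.
    by rewrite f_gt0.
  by rewrite scale_gt0//; move: utb; rewrite -t0 addr0.
have uv : u < v by rewrite ltrDl.
pose w (a : R) := (v - a) / S v.
pose q (a : R) : R := expR (- (2 * w a)).
pose G (a : R) : R := - (f v * S v * Num.sqrt (1 - q a)).
pose h (a : R) : R := f v * (q a / Num.sqrt (1 - q a)).
have q1 a : a < v -> q a < 1.
  by move=> av; rewrite expR_lt1 oppr_lt0 mulr_gt0// divr_gt0// subr_gt0.
have dq (a : R) : is_derive a (1 : R) q (q a * (2 / S v)).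
  have -> : q = expR \o (fun a => 0 + (a - v) *: (2 / S v)).
    by apply/funext => z; rewrite /q/= /w -[_ *: _]/(_ * _); congr expR; ring.
  have e := is_derive_affine (0 : R) (2 / S v) v a.
  exact: (is_derive1_comp (is_derive_expR _) e).
have cq (a : R) : {for a, continuous q}.
  by apply: differentiable_continuous; apply/derivable1_diffP; case: (dq a).
have cs (a : R) : a < v -> {for a, continuous (fun z : R => Num.sqrt (1 - q z))}.
  move=> av; apply: continuous_comp; last exact: sqrt_continuous.
  by apply: continuousB; [exact: cst_continuous|exact: cq].
have dG (a : R) : u < a < v -> is_derive a (1 : R) G (h a).
  move=> /andP[ua av]; have d1 : 0 < 1 - q a by rewrite subr_gt0 q1.
  have e1 : is_derive a (1 : R) (fun z : R => 1 - q z) (0 - q a * (2 / S v)) by exact: is_deriveB.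
  have e2 := @is_derive1_comp R Num.sqrt (fun z : R => 1 - q z) a _ _ (is_derive1_sqrt d1) e1.
  have e3 : is_derive a (1 : R) G
      (- ((f v * S v) *: ((2 * Num.sqrt (1 - q a))^-1 * (0 - q a * (2 / S v))))).
    exact: is_deriveN.
  apply: is_derive_eq; rewrite -[_ *: _]/(_ * _) /h; field.
  by rewrite (gt_eqF Sv) gt_eqF// sqrtr_gt0.
apply: (@le_trans _ _ (\int[lebesgue_measure]_(a in `[u, v]) (h a)%:E)%E).
  apply: le_ge0_integral => a; rewrite /= in_itv/= => /andP[ua av].
  - by rewrite lee_fin divr_ge0 ?sqr_ge0 ?sqrtr_ge0.
  - by rewrite lee_fin mulr_ge0 ?(ltW fv)// divr_ge0 ?expR_ge0 ?sqrtr_ge0.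
  split; first by rewrite ua.
  have a0 := lt_le_trans u0 ua; rewrite lee_fin.
  (* At [a = v] the integrand is 0, because the inverse of 0 is 0. *)
  move: av; rewrite le_eqVlt => /predU1P[->|av].
    rewrite subrr sqrtr0 invr0 mulr0 mulr_ge0 ?(ltW fv)//.
    by rewrite divr_ge0 ?expR_ge0 ?sqrtr_ge0.
  have fa := f_decay a0 (ltW av) utb.
  have fa0 := f_gt0 a0.
  have fa2 : f a ^+ 2 <= f v ^+ 2 * q a.
    have -> : f v ^+ 2 * q a = (f v * expR (- w a)) ^+ 2.
      by rewrite exprMn -expRM_natl /q; congr (_ * expR _); ring.
    by rewrite ler_sqr// nnegrE ?mulr_ge0 ?expR_ge0// ltW.
  have qa := q1 a av.
  have d1 : 0 < 1 - q a by rewrite subr_gt0.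
  have fv2 : 0 < f v ^+ 2 by rewrite exprn_gt0.
  have d2 : f v ^+ 2 * (1 - q a) <= f v ^+ 2 - f a ^+ 2 by lra.
  have s1 : 0 < Num.sqrt (1 - q a) by rewrite sqrtr_gt0.
  have s2 : f v * Num.sqrt (1 - q a) <= Num.sqrt (f v ^+ 2 - f a ^+ 2).
    have efv : Num.sqrt (f v ^+ 2) = f v by rewrite sqrtr_sqr gtr0_norm.
    rewrite -[X in X * _]efv -sqrtrM ?sqr_ge0// ler_sqrt//.
    by rewrite (le_trans _ d2)// mulr_ge0 ?ltW.
  have s3 : 0 < Num.sqrt (f v ^+ 2 - f a ^+ 2).
    by rewrite (lt_le_trans _ s2)// mulr_gt0.
  rewrite ler_pdivrMr// /h.
  apply: (@le_trans _ _ (f v * (q a / Num.sqrt (1 - q a)) * (f v * Num.sqrt (1 - q a)))).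
    apply: (le_trans fa2); rewrite le_eqVlt; apply/orP; left; apply/eqP.
    by field; rewrite gt_eqF.
  by rewrite ler_pM2l// mulr_gt0// divr_gt0// expR_gt0.
have ch (a : R) : a < v -> {for a, continuous h}.
  move=> av; apply: continuousM; first exact: cst_continuous.
  apply: continuousM; first exact: cq.
  apply: continuousV; last exact: cs.
  by rewrite gt_eqF// sqrtr_gt0 subr_gt0 q1.
rewrite integral_itv_bndoo; last first.
  apply/measurable_EFinP; apply: open_continuous_measurable_fun => // a.
  by rewrite inE/= in_itv/= => /andP[_ av]; exact: ch.
apply: (@ge0_integral_derive_le _ G) => //.
- by move=> a /andP[_]; exact: ch.
- move=> a _; rewrite mulr_ge0 ?(ltW fv)//.
  by rewrite divr_ge0 ?expR_ge0 ?sqrtr_ge0.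
- move=> a c _ _; rewrite /G opprK addrC.
  apply: (@le_trans _ _ (f v * S v * Num.sqrt (1 - q a))).
    by rewrite lerBlDr lerDl mulr_ge0 ?sqrtr_ge0// mulr_ge0 ?ltW.
  rewrite ler_piMr//; first by apply: mulr_ge0; exact: ltW.
  by rewrite -[leRHS]sqrtr1 ler_sqrt// lerBlDr lerDl expR_ge0.
Qed.

(** Between [x1] and [x1 + s] with [s <= S x1], the scale grows at most by [2 * D] and [f] at most
    by [A]. *)
Let C0 := 2 * D * A.

Lemma C0_ge1 : 1 <= C0.
Proof.
have := A_ge1; rewrite /C0 => h; have : D <= D * A by rewrite ler_peMr// ltW.
by move: D1; lra.
Qed.

Lemma rstar_bounds (x1 r : R) : 0 <= r -> 0 <= rstar F x1 r <= r.
Proof.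
move=> r0; rewrite /rstar; case: xgetP => [s _ [/andP[s0 sr] _]|_]; last by rewrite lexx.
by rewrite !ltW.
Qed.

Lemma next_rho_ge0 (x1 r : R) : 0 <= r -> 0 <= next_rho F x1 r.
Proof.
move=> r0; rewrite /next_rho; case: ifP => _; last by rewrite divr_ge0.
by case/andP: (rstar_bounds x1 r0).
Qed.

Lemma rho_seq_ge0 (x1 r : R) k : 0 <= r -> 0 <= rho_seq F x1 r k.
Proof. by move=> r0; elim: k => //= k ih; exact: next_rho_ge0. Qed.

(* Whether or not [rstar] is defined, the slices of [Gamma] have height
   [O(f(y1) S(y1))]; nothing else about [Gamma] matters. *)
Lemma Gamma_sub x y r : 0 < x.1 -> 0 <= r -> 2 * y.1 <= b -> Gamma F x r y ->
  x.1 <= y.1 /\ `|y.2 - x.2| <= C0 * (f y.1 * S y.1).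
Proof.
move=> x0 r0 yb [k _]; move: (rho_seq_ge0 x.1 k r0).
move: (rho_seq _ _ _ _) => rho rho0 [/andP[h1 _] h2].
have xy : x.1 <= y.1 by rewrite (le_trans _ h1)// lerDl next_rho_ge0.
have y0 : 0 < y.1 := lt_le_trans x0 xy.
have yb' : y.1 <= b by lra.
have xb : x.1 <= b := le_trans xy yb'.
have fS : 0 <= f y.1 * S y.1 by rewrite mulr_ge0// ltW ?f_gt0 ?scale_gt0.
split => //; apply: (le_trans (ltW h2)); case: ifPn => hr.
  have -> : C0 * (f y.1 * S y.1) = f y.1 * S y.1 * C0 by rewrite mulrC.
  apply: (@le_trans _ _ (f y.1 * S y.1)); last by rewrite ler_peMr// C0_ge1.
  have := @hstar_le x.1 (y.1 - x.1) x0; rewrite [x.1 + _]addrC subrK subr_ge0.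
  exact.
have /andP[s0 sr] := rstar_bounds x.1 rho0; set s := rstar F x.1 rho in s0 sr *.
have Sx : s <= S x.1.
  rewrite (le_trans sr)//; rewrite -ltNge in hr; rewrite (le_trans (ltW hr))//.
  have gx := profile_ge1 P x0 xb; have gx0 : 0 < g x.1 := lt_le_trans ltr01 gx.
  have gF := profile_derive P x0 xb.
  rewrite /S /scale -[leRHS]invrK invf_div lef_pV2 ?posrE ?divr_gt0//.
  by rewrite (lt_le_trans _ gF)// divr_gt0.
have Sxx := scale_le x0 xb.
have xsb : x.1 + s <= b by lra.
have xs : x.1 <= x.1 + s by rewrite lerDl.
have b1 := profile_b1 P.
have e1 : f (x.1 + s) <= A * f x.1.
  by apply: f_forward => //; rewrite addrC addKr.
have e2 : S (x.1 + s) <= 2 * D * S x.1.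
  apply: scale_slow => //; last by lra.
  have : (x.1 + s) * (x.1 + s) <= (x.1 + s) * (1 / 2) by rewrite ler_wpM2l//; lra.
  lra.
apply: (le_trans (hstar_le x0 s0 xsb)).
have xs0 : 0 < x.1 + s by rewrite ltr_wpDr.
have -> : C0 * (f y.1 * S y.1) = (A * f y.1) * (2 * D * S y.1) by rewrite /C0; ring.
apply: ler_pM; rewrite ?(ltW (f_gt0 _)) ?(ltW (scale_gt0 _ _))//.
  by rewrite (le_trans e1)// ler_pM2l// ler_f.
by rewrite (le_trans e2)// ler_pM2l ?mulr_gt0// ler_scale.
Qed.

Lemma cdist_ub x y : 0 < y.1 ->
  cdist F x y <= `|y.1 - x.1| + `|y.2 - x.2| / f y.1.
Proof.
move=> y0; have f0 := f_gt0 y0.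
have := reach_vertical (y := (y.1, x.2)) y.2 (reach_horizontal y.1 (reach_refl F x)) f0.
by rewrite /= -surjective_pairing add0r; exact: cdist_le.
Qed.

Lemma cdist_fst x y : `|y.1 - x.1| <= cdist F x y.
Proof.
rewrite leNgt; apply/negP => /cdist_lt[T Tl /reach_fst].
by rewrite leNgt Tl.
Qed.

Lemma cdist_snd x y t : 0 < x.1 -> x.1 + t <= b -> cdist F x y < t ->
  `|y.2 - x.2| <= f (x.1 + t) * cdist F x y.
Proof.
move=> x0 xtb dt; have t0 : 0 < t := le_lt_trans (cdist_ge0 F x y) dt.
have xt0 : 0 < x.1 + t by rewrite addr_gt0.
have ft := f_gt0 xt0.
apply/ler_addgt0Pr => e e0.
(* A path of time below [t] sees only values of [f] up to [f (x1 + t)]; a time within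
   [e / f (x1 + t)] of the infimum costs only the error [e]. *)
have de : cdist F x y < Num.min t (cdist F x y + e / f (x.1 + t)).
  by rewrite lt_min dt ltrDl divr_gt0.
have [T TI h] := cdist_lt de; move: TI; rewrite lt_min => /andP[Tt Te].
apply: (@le_trans _ _ (f (x.1 + t) * T)).
  apply: (reach_snd h (ltW ft)) => a aT; apply: f_sup => //.
  rewrite -[a](subrK x.1) (le_trans (ler_normD _ _))// addrC (gtr0_norm x0).
  by rewrite lerD2l (le_trans aT)// ltW.
apply: (@le_trans _ _ (f (x.1 + t) * (cdist F x y + e / f (x.1 + t)))).
  by rewrite ler_pM2l// ltW.
by rewrite le_eqVlt; apply/orP; left; apply/eqP; field; rewrite gt_eqF.
Qed.

Lemma cball_sub_rect x r : 0 < r -> `|x.1| + r <= b ->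
  cball F x r `<=` [set y | `|y.1 - x.1| < r /\ `|y.2 - x.2| <= f (`|x.1| + r) * r].
Proof.
move=> r0 xrb y /cdist_lt[T Tr h].
have xr0 : 0 < `|x.1| + r by rewrite ltr_wpDl.
have fr := f_gt0 xr0; split; first by rewrite (le_lt_trans (reach_fst h)).
apply: (@le_trans _ _ (f (`|x.1| + r) * T)); last by rewrite ler_pM2l// ltW.
apply: (reach_snd h (ltW fr)) => a aT; apply: f_sup => //.
rewrite -[a](subrK x.1) (le_trans (ler_normD _ _))// addrC.
by rewrite lerD2l (le_trans aT)// ltW.
Qed.

Lemma leb2_cball_le x r : 0 < r -> `|x.1| + r <= b ->
  (leb2 R (cball F x r) <= (4 * r ^+ 2 * f (`|x.1| + r))%:E)%E.
Proof.
move=> r0 xrb; set M := f (`|x.1| + r) * r.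
have xr0 : 0 < `|x.1| + r by rewrite ltr_wpDl.
have M0 : 0 <= M by rewrite mulr_ge0 ?ltW// f_gt0.
apply: (@le_trans _ _ (leb2 R (`[x.1 - r, x.1 + r]%classic `*`
    `[x.2 - M, x.2 + M]%classic))).
  apply: leb2_homo => y /(cball_sub_rect r0 xrb)[h1 h2]; split; rewrite /= in_itv/=.
    by move: h1; rewrite ltr_norml => /andP[]; lra.
  by move: h2; rewrite -/M ler_norml => /andP[]; lra.
rewrite leb2_rect_cc; [rewrite lee_fin /M|lra|lra].
by rewrite le_eqVlt; apply/orP; left; apply/eqP; ring.
Qed.

Lemma vol_fin x r : 0 < r -> `|x.1| + r <= b -> leb2 R (cball F x r) \is a fin_num.
Proof.
move=> r0 xrb; rewrite ge0_fin_numE ?measure_ge0//.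
exact: le_lt_trans (leb2_cball_le r0 xrb) (ltry _).
Qed.

Lemma vol_cball_le x r : 0 < r -> `|x.1| + r <= b ->
  vol (cball F x r) <= 4 * r ^+ 2 * f (`|x.1| + r).
Proof.
move=> r0 xrb; rewrite /vol -lee_fin fineK ?vol_fin//.
exact: leb2_cball_le.
Qed.

(* Travel horizontally to abscissa [x1 + s] with [a < s < a + e], then vertically. *)
Lemma vol_cball_ge x r a e : 0 < r -> `|x.1| + r <= b -> 0 <= x.1 -> 0 <= a -> 0 < e ->
  0 < x.1 + a -> a + e + e <= r ->
  2 * e ^+ 2 * f (x.1 + a) <= vol (cball F x r).
Proof.
move=> r0 xrb x0 a0 e0 xa0 aer; rewrite (ger0_norm x0) in xrb.
have fa := f_gt0 xa0; set h := e * f (x.1 + a).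
have h0 : 0 < h by rewrite mulr_gt0.
rewrite -lee_fin /vol fineK; last by rewrite vol_fin// ger0_norm.
apply: (@le_trans _ _ (leb2 R (`](x.1 + a), (x.1 + a + e)[%classic `*`
    `](x.2 - h), (x.2 + h)[%classic))).
  rewrite leb2_rect; [|lra|lra].
  by rewrite lee_fin le_eqVlt /h; apply/orP; left; apply/eqP; ring.
apply: leb2_homo => y [/=]; rewrite !in_itv/= => /andP[y1 y2] /andP[y3 y4].
have y0 : 0 < y.1 := lt_trans xa0 y1.
rewrite /cball/= (le_lt_trans (cdist_ub _ y0))//.
rewrite gtr0_norm; last by lra.
have : `|y.2 - x.2| / f y.1 <= e.
  rewrite ler_pdivrMr ?f_gt0// (@le_trans _ _ h)//.
    by rewrite ler_norml; apply/andP; split; lra.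
  by rewrite /h ler_pM2l// ler_f// ?ltW//; lra.
lra.
Qed.

(* Radius below which the distances occurring in the kernel stay in range. *)
Definition good_radius := b / (4 * (1 + C0) ^+ 2).

(** With [dl] the smaller of the distance and [S y1]: [C1] compares [dhat] with [dl], [8 * A] comes
    from the lower bound of the ball's volume by [dl^2 f(y1)], and [A * C0] from the comparison of
    [dl] with the smaller of [S y1] and [mu]. *)
Let C1 := (1 + C0) * D.
Let C2 := C1 * (8 * A) * (A * C0).

Definition kernel_height := C0.
Definition kernel_const := C2.

Definition kernel_ratio x y := S y.1 / Num.max (y.1 - x.1) (`|y.2 - x.2| / f y.1).

(** Numerator and volume together leave a constant times [1 / (f(y1) * dl)]. It remains to bound
    [1 / dl] by a multiple of [1 / S + 1 / mu], where [mu] is the denominator of [kernel_ratio]. *)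
Lemma kernel_right_le x y r : 0 < x.1 -> 0 <= r -> y.1 <= good_radius ->
  Gamma F x r y ->
  kernel_right F r x y <= kernel_const / (f y.1 * S y.1) * (1 + kernel_ratio x y).
Proof.
move=> x0 r0 yr Gxy.
have C01 := C0_ge1; have A1 := A_ge1; have b1 := profile_b1 P; have b00 : 0 < b := b0.
have C00 : 0 < C0 by lra.
have rho : good_radius * (4 * (1 + C0) ^+ 2) = b.
  by rewrite /good_radius divfK// gt_eqF// mulr_gt0// exprn_gt0//; lra.
have ry : (1 + C0) * y.1 * (4 * (1 + C0)) <= b.
  have -> : (1 + C0) * y.1 * (4 * (1 + C0)) = y.1 * (4 * (1 + C0) ^+ 2) by ring.
  by rewrite -rho ler_wpM2r// mulr_ge0// exprn_ge0//; lra.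
have C4 : 8 <= 4 * (1 + C0) by lra.
have [y0|y0] := leP y.1 0.
  have := Gamma_sub x0 r0 _ Gxy; rewrite (_ : 2 * y.1 <= b); last by lra.
  by move=> /(_ isT)[xy _]; move: (lt_le_trans x0 xy); rewrite ltNge y0.
have Cy0 : 0 < (1 + C0) * y.1 by rewrite mulr_gt0//; lra.
have Cy8 : (1 + C0) * y.1 * 8 <= b.
  by apply: le_trans ry; rewrite ler_pM2l.
have yCy : 2 * y.1 <= (1 + C0) * y.1 by rewrite ler_pM2r//; lra.
have [xy hh] : x.1 <= y.1 /\ `|y.2 - x.2| <= C0 * (f y.1 * S y.1).
  by apply: Gamma_sub Gxy => //; lra.
have yb : y.1 <= b by lra.
have fy := f_gt0 y0; have Sy := scale_gt0 y0 yb; have Sy1 := scale_le y0 yb.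
set t := y.1 - x.1; have t0 : 0 <= t by rewrite subr_ge0.
set eta := `|y.2 - x.2| / f y.1.
have eta0 : 0 <= eta by rewrite divr_ge0// ltW.
have etaS : eta <= C0 * S y.1.
  by rewrite ler_pdivrMr// -mulrA [S _ * _]mulrC.
set d := cdist F x y; have d0 : 0 <= d by exact: cdist_ge0.
have dte : d <= t + eta.
  by have := cdist_ub x y0; rewrite -/t -/eta -/d (ger0_norm t0).
have td : t <= d by rewrite -(ger0_norm t0); exact: cdist_fst.
have C0S : C0 * S y.1 <= C0 * y.1 by rewrite ler_pM2l.
have xdC : x.1 + d <= (1 + C0) * y.1 by rewrite mulrDl mul1r; move: dte; rewrite /t; lra.
have xdb : x.1 + d <= b by lra.
have ratio0 : 0 <= kernel_ratio x y.
  by rewrite /kernel_ratio divr_ge0 ?(ltW Sy)// le_max -/t t0.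
have rhs0 : 0 <= kernel_const / (f y.1 * S y.1) * (1 + kernel_ratio x y).
  have C1p : 0 < C1 by rewrite mulr_gt0//; lra.
  have C2p : 0 <= kernel_const.
    have h1 : 0 < A * C0 by rewrite mulr_gt0.
    have h2 : 0 < C1 * (8 * A) by rewrite mulr_gt0// mulr_gt0.
    by rewrite ltW// mulr_gt0.
  apply: mulr_ge0; last exact: addr_ge0.
  by apply: divr_ge0 => //; apply: mulr_ge0; exact: ltW.
rewrite /kernel_right indicE mem_set// mulr1 -/d.
(* At distance 0 the factor [dhat] is at most 0, so the kernel is nonpositive. *)
have [d00|dn0] := eqVneq d 0.
  apply: (le_trans _ rhs0); apply: mulr_le0_ge0; last by rewrite invr_ge0 vol_ge0.
  by rewrite /dhat -/d d00 ge_min lexx.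
have {dn0}d0 : 0 < d by rewrite lt0r dn0.
pose dl := Num.min d (S y.1).
have dl0 : 0 < dl by rewrite lt_min d0.
have dld : dl <= d by rewrite ge_min lexx.
have dlS : dl <= S y.1 by rewrite ge_min lexx orbT.
have C11 : 1 <= C1 by rewrite /C1; have := D1; nra.
have dhat_le : dhat F x y <= C1 * dl.
  rewrite /dhat -/d /dl; case: (leP d (S y.1)) => dS.
    by rewrite ge_min ler_peMl// ltW.
  rewrite ge_min; apply/orP; right.
  have xd0 : 0 < x.1 + d by rewrite addr_gt0.
  have gF := profile_derive P xd0 xdb; have gx := g0 xd0 xdb.
  apply: (@le_trans _ _ (S (x.1 + d))).
    rewrite /S /scale -[leRHS]invrK invf_div lef_pV2 ?posrE ?divr_gt0//.
    by rewrite (lt_le_trans _ gF)// divr_gt0.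
  have Cyb : (1 + C0) * y.1 <= b by lra.
  rewrite (le_trans (ler_scale xd0 xdC Cyb))// /C1.
  apply: scale_slow => //; first by lra.
  have : (1 + C0) * y.1 * (4 * (1 + C0)) * y.1 <= b * y.1 by rewrite ler_wpM2r// ltW.
  have : b * y.1 <= (1 / 2) * y.1 by rewrite ler_wpM2r// ltW.
  nra.
have vol_lb : dl ^+ 2 * (f y.1 / A) / 8 <= vol (cball F x d).
  (* The box starts at abscissa [x1 + a], at most [dl / 2] before [y1], so [f_backward] compares [f]
     there with [f y1], while two widths [dl / 4] still fit into the radius [d]. *)
  pose a := Num.max 0 (t - dl / 2).
  have a0 : 0 <= a by rewrite le_max lexx.
  have ta : t - dl / 2 <= a by rewrite le_max lexx orbT.
  have at' : a <= t by rewrite ge_max t0/=; lra.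
  have ad : a + dl / 4 + dl / 4 <= d.
    by rewrite /a; case: (leP 0 (t - dl / 2)) => _; lra.
  have xa0 : 0 < x.1 + a by rewrite ltr_wpDr.
  have dl4 : 0 < dl / 4 by rewrite divr_gt0.
  have xdb' : `|x.1| + d <= b by rewrite gtr0_norm.
  have h := vol_cball_ge d0 xdb' (ltW x0) a0 dl4 xa0 ad.
  have xay : x.1 + a <= y.1 by move: at'; rewrite /t; lra.
  have yxa : y.1 - (x.1 + a) <= S y.1 / 2 by move: ta dlS; rewrite /t; lra.
  have [_ fb] := f_backward y0 yb xay yxa.
  apply: le_trans h.
  have -> : 2 * (dl / 4) ^+ 2 * f (x.1 + a) = dl ^+ 2 * f (x.1 + a) / 8 by field.
  by rewrite ler_pM2r// ler_pM2l ?exprn_gt0// ler_pdivrMr// mulrC.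
pose mu := Num.max t eta.
have mu0 : 0 < mu.
  rewrite lt_max; apply/negPn/negP; rewrite negb_or -!leNgt => /andP[t1 e1].
  by move: (lt_le_trans d0 dte); lra.
have AC0 : 1 <= A * C0 by nra.
(* If the distance is below the scale, [cdist_snd] bounds [eta] by [A * d], since [f] exceeds [f y1]
   at most by the factor [A] up to [x1 + S y1]. *)
have min_le : Num.min (S y.1) mu <= A * C0 * dl.
  case: (leP (S y.1) d) => dS.
    have -> : dl = S y.1 by apply/eqP; rewrite eq_le dlS /dl le_min dS lexx.
    by rewrite ge_min ler_peMl// ltW.
  have -> : dl = d by apply/eqP; rewrite eq_le dld /dl le_min lexx ltW.
  have xSb : x.1 + S y.1 <= b by lra.
  have xS0 : 0 < x.1 + S y.1 by rewrite addr_gt0.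
  have ySb : y.1 + S y.1 <= b by lra.
  have h := cdist_snd x0 xSb dS.
  have f1 : f (x.1 + S y.1) <= A * f y.1.
    apply: (@le_trans _ _ (f (y.1 + S y.1))); first by rewrite ler_f// lerD2r.
    by apply: f_forward => //; rewrite ?lerDl ?(ltW Sy)// addrC addKr.
  have eA : eta <= A * d.
    rewrite ler_pdivrMr// (le_trans h)// -/d mulrAC ler_pM2r//.
  rewrite ge_min; apply/orP; right; rewrite ge_max; apply/andP; split.
    by rewrite (le_trans td)// ler_peMl// ltW.
  rewrite (le_trans eA)// ler_pM2r// ler_peMr// ltW//.
have inv_dl : dl^-1 <= A * C0 * ((S y.1)^-1 * (1 + S y.1 / mu)).
  have m0 : 0 < Num.min (S y.1) mu by rewrite lt_min Sy.
  apply: (@le_trans _ _ (A * C0 * (Num.min (S y.1) mu)^-1)).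
    rewrite -ler_pdivrMl ?mulr_gt0// -invfM lef_pV2 ?posrE ?mulr_gt0//.
  rewrite ler_pM2l ?mulr_gt0// mulrDr mulr1 mulrA mulVf ?gt_eqF// mul1r.
  by case: (leP (S y.1) mu) => _; rewrite ?lerDl ?lerDr invr_ge0 ltW.
have q0 : 0 < dl ^+ 2 * (f y.1 / A) / 8.
  by apply: divr_gt0 => //; apply: mulr_gt0; [exact: exprn_gt0|exact: divr_gt0].
have vol0 : 0 < vol (cball F x d) := lt_le_trans q0 vol_lb.
apply: (@le_trans _ _ (C1 * dl / (dl ^+ 2 * (f y.1 / A) / 8))).
  apply: ler_pM; rewrite ?invr_ge0 ?(ltW vol0)//.
    by rewrite /dhat -/d le_min (ltW d0) invr_ge0 normr_ge0.
  by rewrite lef_pV2 ?posrE.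
have -> : C1 * dl / (dl ^+ 2 * (f y.1 / A) / 8) = C1 * (8 * A) / f y.1 * dl^-1.
  by field; rewrite !gt_eqF.
have -> : kernel_const / (f y.1 * S y.1) * (1 + kernel_ratio x y) =
    C1 * (8 * A) / f y.1 * (A * C0 * ((S y.1)^-1 * (1 + S y.1 / mu))).
  by rewrite /kernel_const /C2 /kernel_ratio -/t -/eta -/mu; field; rewrite !gt_eqF.
by rewrite ler_pM2l// divr_gt0// mulr_gt0 ?mulr_gt0//; lra.
Qed.

Lemma kernel_right_ge0 x y r : 0 <= kernel_right F r x y.
Proof.
rewrite /kernel_right mulr_ge0 ?indicE// divr_ge0 ?vol_ge0//.
by rewrite /dhat le_min cdist_ge0 invr_ge0 normr_ge0.
Qed.

End geometry_bounds.

(** * From fixed points to the operator *)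

Lemma measurable_Phi (R : realType) (m : R) : 0 < m ->
  measurable_fun [set: R] (fun t => Phi m t).
Proof.
move=> m0; under eq_fun do rewrite PhiE; apply: measurable_fun_ifT.
- exact: measurable_fun_ler.
- have -> : bump m = (fun t : R => expR ((ln t `^ m^-1 + 1) `^ m)).
    by apply/funext => t; rewrite bump.unlock elog.unlock.
  apply: (measurableT_comp (@measurable_expR R)).
  apply: (measurableT_comp (measurable_powR m)).
  apply: measurable_funD => //.
  exact: (measurableT_comp (measurable_powR m^-1) (@measurable_ln R)).
- exact: measurable_funM.
Qed.

Section schur.
Context d (T : measurableType d) (R : realType).
Variable mu : {sigma_finite_measure set T -> \bar R}.
Variables (B : set T) (m V c : R) (K : T -> T -> R) (Kb : T * T -> R) (g : T -> R).
Hypotheses (mB : measurable B) (m1 : 1 <= m) (V0 : 0 < V) (c0 : 0 <= c).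
Hypothesis mKb : measurable_fun setT Kb.
Hypothesis Kb0 : forall z, 0 <= Kb z.
Hypothesis K_le : forall x y, B x -> B y -> 0 <= K x y <= Kb (x, y).
Hypothesis g0 : forall y, B y -> 0 <= g y.
Hypothesis ig : mu.-integrable B (EFin \o g).
Hypothesis Phi_Kb : forall y a, B y -> 0 < a ->
  (\int[mu]_(x in B) (Phi m (2 * (a * V) * Kb (x, y)))%:E <= (V * Phi m (c * a))%:E)%E.

Let G := fine (\int[mu]_(y in B) (g y)%:E).

Let fin_g : (\int[mu]_(y in B) (g y)%:E)%E \is a fin_num.
Proof. exact: integrable_fin_num. Qed.

Let mg : measurable_fun B g.
Proof. by have /integrableP[/measurable_EFinP] := ig. Qed.

Let G0 : 0 <= G.
Proof. by apply: fine_ge0; apply: integral_ge0 => y /g0; rewrite lee_fin. Qed.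

Let U x := (\int[mu]_(y in B) (Kb (x, y) * g y)%:E)%E.

Let mKbx x : measurable_fun B (fun y => Kb (x, y)).
Proof.
apply: (@measurable_funS _ _ _ _ setT) => //.
exact: measurableT_comp.
Qed.

Let opU x : B x -> (\int[mu]_(y in B) (K x y * g y)%:E <= U x)%E.
Proof.
move=> Bx; apply: le_ge0_integral => y By; have /andP[k0 kb] := K_le Bx By;
  have gy := g0 By.
- by rewrite lee_fin mulr_ge0.
- by rewrite lee_fin mulr_ge0.
- by split => //; rewrite lee_fin ler_wpM2r.
Qed.

Let J x := (\int[mu]_(y in B) (G^-1 * (Phi m (2 * G * Kb (x, y)) * g y))%:E)%E.

Let mPhi x : measurable_fun B (fun y => Phi m (2 * G * Kb (x, y))).
Proof.
apply: (measurableT_comp (measurable_Phi (lt_le_trans ltr01 m1))).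
exact: measurable_funM.
Qed.

Let X0 x y : 0 <= 2 * G * Kb (x, y).
Proof. by rewrite !mulr_ge0. Qed.

Let J0 x : (0 <= J x)%E.
Proof.
apply: integral_ge0 => y By; rewrite lee_fin mulr_ge0 ?invr_ge0//.
by rewrite mulr_ge0 ?g0// Phi_ge0.
Qed.

(* Since [Phi t / t] is nondecreasing, [Phi t >= Phi a / a * (t - a)]; averaging
   this against [g / G] replaces Jensen's inequality, at the price of a factor 2. *)
Let jensen x a : 0 < G -> 0 < a ->
  ((2 * (Phi m a / a))%:E * U x <= J x + (Phi m a)%:E)%E.
Proof.
move=> Gp a0; have p0 : 0 <= Phi m a / a by rewrite divr_ge0 ?Phi_ge0 ?ltW.
have line t : 0 <= t -> Phi m a / a * t <= Phi m t + Phi m a.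
  move=> t0; case: (leP a t) => at'.
    have t00 := lt_le_trans a0 at'.
    have : Phi m a / a * t <= Phi m t by rewrite -ler_pdivlMr// Phi_ratio.
    by move=> h; rewrite (le_trans h)// lerDl Phi_ge0// ltW.
  rewrite (@le_trans _ _ (Phi m a))//; last by rewrite lerDr Phi_ge0.
  by rewrite -mulrA ler_piMr ?Phi_ge0 ?(ltW a0)// mulrC ler_pdivrMr// mul1r ltW.
have mU : measurable_fun B (fun y => Kb (x, y) * g y) by exact: measurable_funM.
have U0 y : B y -> 0 <= Kb (x, y) * g y by move=> By; rewrite mulr_ge0// g0.
have E1 : ((2 * (Phi m a / a))%:E * U x =
    \int[mu]_(y in B) (2 * (Phi m a / a) * (Kb (x, y) * g y))%:E)%E.
  rewrite /U -ge0_integralZl_EFin//.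
  - exact/measurable_EFinP.
  - by rewrite mulr_ge0.
have E2 : (\int[mu]_(y in B) (G^-1 * Phi m a * g y)%:E = (Phi m a)%:E)%E.
  transitivity ((G^-1 * Phi m a)%:E * \int[mu]_(y in B) (g y)%:E)%E.
    rewrite -ge0_integralZl_EFin//; last by rewrite mulr_ge0 ?invr_ge0 ?Phi_ge0 ?ltW.
    - exact/measurable_EFinP.
  by rewrite -(fineK fin_g) -/G -EFinM mulrAC mulVf ?mul1r// gt_eqF.
rewrite E1 -E2 /J -ge0_integralD//; last 4 first.
- by move=> y By; rewrite lee_fin !mulr_ge0 ?invr_ge0 ?g0// Phi_ge0.
- apply/measurable_EFinP; apply: measurable_funM => //; exact: measurable_funM.
- by move=> y By; rewrite lee_fin !mulr_ge0 ?invr_ge0 ?g0// Phi_ge0// ltW.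
- by apply/measurable_EFinP; apply: measurable_funM.
apply: le_ge0_integral => y By.
- by rewrite lee_fin mulr_ge0 ?U0// mulr_ge0.
- rewrite -EFinD lee_fin addr_ge0//.
    by rewrite !mulr_ge0 ?invr_ge0 ?g0// Phi_ge0.
  by rewrite !mulr_ge0 ?invr_ge0 ?g0// Phi_ge0// ltW.
split => //; rewrite -EFinD lee_fin.
have := line _ (X0 x y) => h.
have gG : 0 <= g y / G by rewrite divr_ge0// g0.
have := ler_wpM2r gG h.
have -> : Phi m a / a * (2 * G * Kb (x, y)) * (g y / G) =
    2 * (Phi m a / a) * (Kb (x, y) * g y).
  by field; rewrite !gt_eqF.
move=> h2; apply: (le_trans h2); rewrite le_eqVlt; apply/orP; left; apply/eqP; ring.
Qed.

Let U_ge0 x : (0 <= U x)%E.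
Proof. by apply: integral_ge0 => y By; rewrite lee_fin mulr_ge0// g0. Qed.

(** For finite [U x] the choice [a = U x] in [jensen] gives [2 Phi (U x) <= J x + Phi (U x)]. For
    infinite [U x] already [a = 1] forces [J x] to be infinite. *)
Let Phi_U x : 0 < G -> (er_map (Phi m) (U x) <= J x)%E.
Proof.
move=> Gp; have := U_ge0 x; case Ux: (U x) => [u||]//= u0.
  rewrite lee_fin in u0; move: u0; rewrite le_eqVlt => /predU1P[<-|u0].
    by rewrite Phi0.
  have := jensen x Gp u0; rewrite Ux -EFinM.
  have -> : 2 * (Phi m u / u) * u = Phi m u + Phi m u by field; rewrite gt_eqF.
  by rewrite EFinD leeD2rE.
have := jensen x Gp ltr01; rewrite Ux divr1 gt0_muley; last first.
  by rewrite lte_fin mulr_gt0// Phi_gt0.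
by case: (J x).
Qed.

Let h (z : T * T) : \bar R :=
  ((G^-1 * (Phi m (2 * G * Kb z) * (g \_ B) z.2)) * \1_B z.1)%:E.

Let h0 z : (0 <= h z)%E.
Proof.
have gB0 y : 0 <= (g \_ B) y.
  by rewrite /patch; case: ifP => [yB|_]; [exact: g0 (set_mem yB)|exact: lexx].
rewrite lee_fin; apply: mulr_ge0; last by rewrite indicE.
apply: mulr_ge0; first by rewrite invr_ge0.
by apply: mulr_ge0 => //; apply: Phi_ge0; rewrite !mulr_ge0.
Qed.

Let mh : measurable_fun setT h.
Proof.
have mgB : measurable_fun setT (g \_ B) by exact/(measurable_restrictT _ mB).
apply/measurable_EFinP; apply: measurable_funM; last first.
  exact: (measurableT_comp (measurable_indic mB) measurable_fst).
apply: measurable_funM => //; apply: measurable_funM.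
  apply: (measurableT_comp (measurable_Phi (lt_le_trans ltr01 m1))).
  exact: measurable_funM.
exact: (measurableT_comp mgB measurable_snd).
Qed.

Let JE x : B x -> J x = (\int[mu]_y h (x, y))%E.
Proof.
move=> /mem_set xB; rewrite /J integral_mkcond; apply: eq_integral => y _.
rewrite /h/= indicE xB mulr1 /patch; case: ifPn => // _.
by rewrite !mulr0.
Qed.

(** After Tonelli, [Phi_Kb] is used at [a = G / V], for which [2 * (a * V)] is the factor [2 * G]
    inside [J]; the weight [g / G] then has total mass 1. *)
Let J_total : 0 < G ->
  (\int[mu]_(x in B) (\int[mu]_y h (x, y)) <= (V * Phi m (c * (G / V)))%:E)%E.
Proof.
move=> Gp.
have JE' : (\int[mu]_(x in B) (\int[mu]_y h (x, y)) =
    \int[mu]_x \int[mu]_y h (x, y))%E.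
  rewrite integral_mkcond; apply: eq_integral => x _; rewrite /patch.
  case: ifPn => // xB.
  by rewrite integral0_eq// => y _; rewrite /h/= indicE (negbTE xB) mulr0.
rewrite JE' (fubini_tonelli h)//.
apply: (@le_trans _ _ (\int[mu]_(y in B) ((G^-1 * (V * Phi m (c * (G / V))))%:E * (g y)%:E))%E).
  rewrite [leRHS]integral_mkcond; apply: le_ge0_integral => y _.
  - by apply: integral_ge0 => x _; exact: h0.
  - rewrite /patch; case: ifP => [yB|_]; last exact: lexx.
    have gy := g0 (set_mem yB).
    rewrite mule_ge0 ?lee_fin// mulr_ge0 ?invr_ge0// mulr_ge0 ?(ltW V0)//.
    by rewrite Phi_ge0// mulr_ge0// divr_ge0// ltW.
  split => //; rewrite /patch; case: ifPn => yB; last first.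
    rewrite integral0_eq; first exact: lexx.
    by move=> x _; rewrite /h/= /patch (negbTE yB) !mulr0 mul0r.
  have By := set_mem yB; have gy := g0 By.
  have -> : (\int[mu]_x h (x, y) =
      \int[mu]_(x in B) ((G^-1 * g y)%:E * (Phi m (2 * (G / V * V) * Kb (x, y)))%:E))%E.
    rewrite [RHS]integral_mkcond; apply: eq_integral => x _; rewrite /h/= /patch yB indicE.
    rewrite divfK ?gt_eqF//; case: ifPn => _; last by rewrite mulr0.
    by rewrite mulr1 -EFinM; congr EFin; ring.
  rewrite ge0_integralZl_EFin//; last 3 first.
  - by move=> x _; rewrite lee_fin Phi_ge0// mulr_ge0// mulr_ge0// divfK ?gt_eqF.
  - apply/measurable_EFinP; apply: (measurable_funS measurableT) => //.
    apply: (measurableT_comp (measurable_Phi (lt_le_trans ltr01 m1))).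
    by apply: measurable_funM => //; exact: (measurableT_comp mKb).
  - by rewrite mulr_ge0 ?invr_ge0.
  have gv : 0 < G / V by rewrite divr_gt0.
  have := Phi_Kb By gv => hh.
  apply: (@le_trans _ _ ((G^-1 * g y)%:E * (V * Phi m (c * (G / V)))%:E)%E).
    by rewrite lee_wpmul2l// lee_fin mulr_ge0 ?invr_ge0.
  by rewrite -!EFinM lee_fin le_eqVlt; apply/orP; left; apply/eqP; ring.
rewrite ge0_integralZl_EFin//; last 2 first.
- exact/measurable_EFinP.
- by rewrite mulr_ge0 ?invr_ge0// mulr_ge0 ?(ltW V0)// Phi_ge0// mulr_ge0// divr_ge0// ltW.
rewrite -(fineK fin_g) -/G -EFinM lee_fin le_eqVlt; apply/orP; left; apply/eqP.
by field; rewrite !gt_eqF.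
Qed.

(** The composed operator need not be measurable in [x], so a measurable majorant [J'] is handed out
    with the bound on its integral. If [G = 0], then [g] vanishes almost everywhere on [B], hence
    the operator is 0 there and [J' = 0] serves. *)
Lemma schur_Phi : exists J' : T -> \bar R,
  [/\ measurable_fun B J', forall x, (0 <= J' x)%E,
     forall x, B x ->
       (er_map (Phi m) (\int[mu]_(y in B) (K x y * g y)%:E) <= J' x)%E &
     (\int[mu]_(x in B) J' x <= (V * Phi m (c * (G / V)))%:E)%E].
Proof.
have op0 x : B x -> (0 <= \int[mu]_(y in B) (K x y * g y)%:E)%E.
  move=> Bx; apply: integral_ge0 => y By; rewrite lee_fin mulr_ge0 ?g0//.
  by case/andP: (K_le Bx By).
have Phi_homo (u v : \bar R) : (0 <= u)%E -> (u <= v)%E ->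
    (er_map (Phi m) u <= er_map (Phi m) v)%E.
  case: u => [u||]//; case: v => [v||]//=; rewrite ?lee_fin ?leey// => u0 uv.
  exact: ler_Phi.
move: G0; rewrite le_eqVlt => /predU1P[G00|Gp].
  exists (fun=> 0%E); split => //; first by move=> _; exact: lexx.
    move=> x Bx; suff -> : (\int[mu]_(y in B) (K x y * g y)%:E = 0)%E by rewrite /= Phi0.
    apply/eqP; rewrite eq_le op0// andbT (le_trans (opU Bx))// /U.
    have g_ae : ae_eq mu B (EFin \o g) (cst 0%E).
      apply/ae_eq_integral_abs => //; first exact/measurable_EFinP.
      rewrite (eq_integral (fun y => (g y)%:E)).
        by rewrite -(fineK fin_g) -/G -G00.
      by move=> y /set_mem By; rewrite /= ger0_norm ?g0.
    rewrite (ae_eq_integral (cst 0%E))//; last 2 first.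
    - by apply/measurable_EFinP; exact: measurable_funM.
    - apply: filterS g_ae => y /= gy By; have := gy By => -[->]; by rewrite mulr0.
    by rewrite integral0; exact: lexx.
  rewrite integral0_eq// lee_fin; apply: mulr_ge0; first exact: ltW.
  by apply: Phi_ge0 => //; rewrite -G00 mul0r mulr0; exact: lexx.
exists (fun x => \int[mu]_y h (x, y))%E; split.
- apply: (measurable_funS measurableT) => //.
  exact: (@measurable_fun_fubini_tonelli_F _ _ _ _ _ mu h).
- by move=> x; apply: integral_ge0 => y _; exact: h0.
- move=> x Bx; rewrite -JE//.
  by apply: le_trans (Phi_U x Gp); apply: Phi_homo; [exact: op0|exact: opU].
- exact: J_total.
Qed.

End schur.

(** * The kernel at a fixed point *)

Section singular_integrals.
Variable R : realType.
Implicit Types (u v s p Y H : R).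
Local Notation lam := (@lebesgue_measure R).

Lemma is_derive_powR_affine (a c p s : R) : 0 < a * s + c ->
  is_derive s 1 (fun t : R => (a * t + c) `^ p) (a * (p * (a * s + c) `^ (p - 1))).
Proof.
move=> h; have d1 : is_derive s 1 (fun t : R => a * t + c) a.
  have -> : a = a *: (1 : R) + 0 by rewrite /GRing.scale/= mulr1 addr0.
  by rewrite addr0; apply: is_derive_eq; rewrite /GRing.scale/=; ring.
have := @is_derive1_comp R (@powR R ^~ p) (fun t => a * t + c) s _ _
  (is_derive1_powR p h) d1.
by rewrite mulrC.
Qed.

Lemma continuous_powR_affine (a c p s : R) : 0 < a * s + c ->
  {for s, continuous (fun t : R => (a * t + c) `^ p)}.
Proof.
move=> h; have [d _] := is_derive_powR_affine p h.
by apply: differentiable_continuous; exact/derivable1_diffP.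
Qed.

Lemma integral_endpoint_singularities u v : u < v ->
  (\int[lam]_(s in `]u, v[) ((s - u) `^ (- (3 / 4)) + (v - s) `^ (- (3 / 4)))%:E
   <= (8 * (v - u) `^ (1 / 4))%:E)%E.
Proof.
move=> uv; have e1 : 1 / 4 - 1 = - (3 / 4) :> R by lra.
have Eu : (fun s => (s - u) `^ (- (3 / 4))) = (fun s => (1 * s + - u) `^ (- (3 / 4))).
  by apply/funext => s; rewrite mul1r.
have Ev : (fun s => (v - s) `^ (- (3 / 4))) = (fun s => (- 1 * s + v) `^ (- (3 / 4))).
  by apply/funext => s; rewrite mulN1r addrC.
apply: (@ge0_integral_derive_le R
  (fun s => 4 * (1 * s + - u) `^ (1 / 4) - 4 * (- 1 * s + v) `^ (1 / 4))
  (fun s => (s - u) `^ (- (3 / 4)) + (v - s) `^ (- (3 / 4))) u v _ uv).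
- move=> s /andP[us sv].
  have su : 0 < 1 * s + - u by lra.
  have vs : 0 < - 1 * s + v by lra.
  have d1 := is_derive_powR_affine (1 / 4) su.
  have d2 := is_derive_powR_affine (1 / 4) vs.
  apply: is_derive_eq; rewrite !e1 /GRing.scale/=.
  have -> : 1 * s + - u = s - u by ring.
  have -> : - 1 * s + v = v - s by ring.
  by field.
- move=> s /andP[us sv].
  have su : 0 < 1 * s + - u by lra.
  have vs : 0 < - 1 * s + v by lra.
  have -> : (fun s => (s - u) `^ (- (3 / 4)) + (v - s) `^ (- (3 / 4))) =
    (fun s => (1 * s + - u) `^ (- (3 / 4))) \+ (fun s => (- 1 * s + v) `^ (- (3 / 4))).
    by rewrite -Eu -Ev.
  by apply: continuousD; exact: continuous_powR_affine.
- by move=> s _; rewrite addr_ge0// powR_ge0.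
- move=> x y /andP[ux xv] /andP[uy yv].
  have h1 : (1 * y + - u) `^ (1 / 4) <= (v - u) `^ (1 / 4).
    by apply: ge0_ler_powR; rewrite ?nnegrE; lra.
  have h2 : (- 1 * x + v) `^ (1 / 4) <= (v - u) `^ (1 / 4).
    by apply: ge0_ler_powR; rewrite ?nnegrE; lra.
  have h3 := powR_ge0 (- 1 * y + v) (1 / 4); have h4 := powR_ge0 (1 * x + - u) (1 / 4).
  lra.
Qed.

Lemma integral_outer_singularity Y : 0 < Y ->
  (\int[lam]_(s in `](- Y)%R, Y[) ((Y - `|s|) `^ (- (3 / 4)))%:E
   <= (16 * Y `^ (1 / 4))%:E)%E.
Proof.
move=> Y0; have uv : - Y < Y by lra.
apply: (le_trans _ (le_trans (integral_endpoint_singularities uv) _)).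
  apply: le_ge0_integral => s.
  - by move=> _; rewrite lee_fin powR_ge0.
  - by move=> _; rewrite lee_fin addr_ge0// powR_ge0.
  move=> sY; split=> //; move: sY; rewrite /= in_itv/= => /andP[s1 s2]; rewrite lee_fin.
  have [s0|s0] := leP 0 s.
    by rewrite ger0_norm// lerDr powR_ge0.
  by rewrite ltr0_norm// opprK (addrC Y) opprK lerDl powR_ge0.
have -> : Y - - Y = 2 * Y by ring.
rewrite lee_fin powRM; [|lra|exact: ltW].
have : 2 `^ (1 / 4) <= (2 : R).
  by rewrite -[leRHS]powRr1; [apply: ler_powR|]; lra.
have := powR_ge0 Y (1 / 4); nra.
Qed.

(** Leaving out the centre makes both halves open intervals with the singularity at an end point. *)
Lemma integral_inner_singularity (c : R) H : 0 < H ->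
  (\int[lam]_(s in `](c - H)%R, c[%classic `|` `]c, (c + H)%R[%classic)
     (`|s - c| `^ (- (3 / 4)))%:E <= (16 * H `^ (1 / 4))%:E)%E.
Proof.
move=> H0; have mL : measurable (`](c - H)%R, c[%classic : set (measurableTypeR R)).
  exact: measurable_itv.
have mR : measurable (`]c, (c + H)%R[%classic : set (measurableTypeR R)).
  exact: measurable_itv.
rewrite (ge0_integral_setU lam mL mR); first last.
- apply/disj_setPS => s [/=]; rewrite !in_itv/= => /andP[_ h1] /andP[h2 _]; lra.
- by move=> s _; rewrite lee_fin powR_ge0.
- apply/measurable_EFinP/(measurable_funS measurableT) => //.
  apply: (measurableT_comp (measurable_powR _)); apply: measurableT_comp => //.
  exact: measurable_funB.
have -> : (16 * H `^ (1 / 4))%:E = ((8 * H `^ (1 / 4))%:E + (8 * H `^ (1 / 4))%:E)%E.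
  by rewrite -EFinD; congr EFin; ring.
have half u v : u < v -> v - u = H -> (forall s, u < s < v ->
    `|s - c| = s - u \/ `|s - c| = v - s) ->
    (\int[lam]_(s in `]u, v[) (`|s - c| `^ (- (3 / 4)))%:E <= (8 * H `^ (1 / 4))%:E)%E.
  move=> uv uvH hc; rewrite -uvH; apply: le_trans (integral_endpoint_singularities uv).
  apply: le_ge0_integral => s.
  - by move=> _; rewrite lee_fin powR_ge0.
  - by move=> _; rewrite lee_fin addr_ge0// powR_ge0.
  move=> sY; split=> //; move: sY; rewrite /= in_itv/= => /hc; rewrite lee_fin.
  by case=> ->; [rewrite lerDl|rewrite lerDr]; rewrite powR_ge0.
apply: leeD; apply: half; try lra.
- by move=> s /andP[s1 s2]; right; rewrite ltr0_norm ?opprB//; lra.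
- by move=> s /andP[s1 s2]; left; rewrite gtr0_norm//; lra.
Qed.

Lemma leb2_integral_prod (A B : set (measurableTypeR R)) (a b : R -> R) :
  measurable A -> measurable B ->
  measurable_fun [set: R] a -> measurable_fun [set: R] b ->
  (forall s, 0 <= a s) -> (forall s, 0 <= b s) ->
  (\int[leb2 R]_(z in A `*` B) (a z.1 * b z.2)%:E =
   \int[lam]_(s in A) (a s)%:E * \int[lam]_(s in B) (b s)%:E)%E.
Proof.
move=> mA mB ma mb a0 b0.
have a'0 s : 0 <= (a \_ A) s by rewrite /patch; case: ifP => // _; exact: lexx.
have b'0 s : 0 <= (b \_ B) s by rewrite /patch; case: ifP => // _; exact: lexx.
have ma' : measurable_fun setT (a \_ A).
  by apply/(measurable_restrictT _ mA); exact: measurable_funS ma.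
have mb' : measurable_fun setT (b \_ B).
  by apply/(measurable_restrictT _ mB); exact: measurable_funS mb.
pose h (z : measurableTypeR R * measurableTypeR R) : \bar R :=
  ((a \_ A) z.1 * (b \_ B) z.2)%:E.
have -> : (\int[leb2 R]_(z in A `*` B) (a z.1 * b z.2)%:E = \int[leb2 R]_z h z)%E.
  rewrite integral_mkcond; apply: eq_integral => z _; rewrite /h /patch.
  rewrite in_setX; case: (z.1 \in A); case: (z.2 \in B) => //=.
  - by rewrite mulr0.
  - by rewrite mul0r.
  - by rewrite mul0r.
rewrite (@fubini_tonelli1 _ _ _ _ _ lam lam h); last 2 first.
- apply/measurable_EFinP; apply: measurable_funM.
    exact: (measurableT_comp ma' measurable_fst).
  exact: (measurableT_comp mb' measurable_snd).
- by move=> z; rewrite lee_fin mulr_ge0.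
have EA : (\int[lam]_(s in A) (a s)%:E = \int[lam]_s ((a \_ A) s)%:E)%E.
  by rewrite integral_mkcond; apply: eq_integral => s _; rewrite /patch; case: ifP.
have EB : (\int[lam]_(s in B) (b s)%:E = \int[lam]_s ((b \_ B) s)%:E)%E.
  by rewrite integral_mkcond; apply: eq_integral => s _; rewrite /patch; case: ifP.
rewrite EA EB -ge0_integralZr//; last 3 first.
- exact/measurable_EFinP.
- by move=> s _; rewrite lee_fin.
- by apply: integral_ge0 => s _; rewrite lee_fin.
apply: eq_integral => s _; rewrite /fubini_F /h/=.
under eq_integral do rewrite EFinM.
rewrite ge0_integralZl//; last by rewrite lee_fin.
  exact/measurable_EFinP.
by move=> t _; rewrite lee_fin.
Qed.

Lemma integral_crossing_singularities (c : R) Y H : 0 < Y -> 0 < H ->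
  (\int[leb2 R]_(z in `](- Y)%R, Y[%classic `*`
       (`](c - H)%R, c[%classic `|` `]c, (c + H)%R[%classic))
     ((Y - `|z.1|) `^ (- (3 / 4)) * `|z.2 - c| `^ (- (3 / 4)))%:E
   <= (256 * (Y `^ (1 / 4) * H `^ (1 / 4)))%:E)%E.
Proof.
move=> Y0 H0.
rewrite (@leb2_integral_prod _ _ (fun s => (Y - `|s|) `^ (- (3 / 4)))
  (fun s => `|s - c| `^ (- (3 / 4)))); last 6 first.
- exact: measurable_itv.
- by apply: measurableU; exact: measurable_itv.
- apply: (measurableT_comp (measurable_powR _)).
  by apply: measurable_funB => //; exact: measurableT_comp.
- apply: (measurableT_comp (measurable_powR _)); apply: measurableT_comp => //.
  exact: measurable_funB.
- by move=> s; exact: powR_ge0.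
- by move=> s; exact: powR_ge0.
have -> : (256 * (Y `^ (1 / 4) * H `^ (1 / 4)))%:E =
    ((16 * Y `^ (1 / 4))%:E * (16 * H `^ (1 / 4))%:E)%E.
  by rewrite -EFinM; congr EFin; ring.
apply: lee_pmul; last 2 first.
- exact: integral_outer_singularity.
- exact: integral_inner_singularity.
- by apply: integral_ge0 => s _; rewrite lee_fin powR_ge0.
- by apply: integral_ge0 => s _; rewrite lee_fin powR_ge0.
Qed.

End singular_integrals.

Lemma measurable_inv_ge0 d (T : measurableType d) (R : realType) (h : T -> R) :
  (forall x, 0 <= h x) -> measurable_fun [set: T] h ->
  measurable_fun [set: T] (fun x => (h x)^-1).
Proof.
move=> h0 mh; under eq_fun do rewrite -powR_inv1//.
exact: (measurableT_comp (measurable_powR _)).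
Qed.

(** * A measurable majorant of the kernel and its [Phi]-integral *)

Section kernel_majorant.
Variables (R : realType) (F g : R -> R) (b D : R).
Hypothesis P : profile F g b D.
Hypotheses (g_ge0 : forall u, 0 <= g u).
Hypotheses (mF : measurable_fun [set: R] (fun s => F `|s|)).
Hypotheses (mg : measurable_fun [set: R] (fun s => g `|s|)).
Local Notation T := (measurableTypeR R * measurableTypeR R)%type.

Let f := fF F.
Let S := scale g.
Let C0 := kernel_height D.
Let C2 := kernel_const D.

(** The bound of [kernel_right_le], cut off to the region found in [Gamma_sub]. The absolute values
    make it invariant under reflection, so that it serves for both half planes. *)
Definition kernel_major (z : T * T) : R :=
  let Y := `|z.2.1| in let t := Y - `|z.1.1| in let eta := `|z.2.2 - z.1.2| in
  if (0 <= t) && (eta <= C0 * (f Y * S Y))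
  then C2 / (f Y * S Y) * (1 + S Y / Num.max t (eta / f Y)) else 0.

Let C0_gt0 : 0 < C0.
Proof. exact: lt_le_trans (C0_ge1 P). Qed.

Lemma kernel_const_gt0 : 0 < kernel_const D.
Proof.
have A1 := A_ge1 P; have D1 := profile_D1 P; have := C0_gt0.
rewrite /C0 /kernel_height /kernel_const => C00.
have A0 : 0 < expR (D * D) := expR_gt0 _; have D0 : 0 < D by lra.
by rewrite !mulr_gt0//; lra.
Qed.

Let C2_gt0 : 0 < C2 := kernel_const_gt0.

Lemma good_radius_le : good_radius b D <= b / 4.
Proof.
have b0 := profile_b0 P; have c1 : 1 <= 1 + C0 by rewrite lerDl ltW.
have c0 : 0 < 1 + C0 := lt_le_trans ltr01 c1.
rewrite /good_radius -/(kernel_height D) -/C0 invfM mulrA ler_piMr//; first by lra.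
by rewrite invf_le1 ?exprn_gt0// exprn_ege1.
Qed.

Lemma good_radius_gt0 : 0 < good_radius b D.
Proof.
have b0 := profile_b0 P; rewrite /good_radius divr_gt0// mulr_gt0// exprn_gt0//.
by apply: addr_gt0 => //; exact: C0_gt0.
Qed.

Let S_ge0 (u : R) : 0 <= S `|u|.
Proof. by rewrite /S /scale divr_ge0. Qed.

Lemma kernel_major_ge0 z : 0 <= kernel_major z.
Proof.
rewrite /kernel_major; case: ifP => [/andP[t0 _]|_]; last exact: lexx.
have f0 := fF_ge0 F `|z.2.1|; have S0 := S_ge0 z.2.1.
apply: mulr_ge0; first by rewrite divr_ge0 ?(ltW C2_gt0)// mulr_ge0.
by rewrite addr_ge0// divr_ge0// le_max t0.
Qed.

Let majorant_right x y r : 0 < x.1 -> 0 <= r -> `|y.1| <= good_radius b D ->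
  kernel_right F r x y <= kernel_major (x, y).
Proof.
move=> x0 r0 yr; have := kernel_major_ge0 (x, y).
have [Gy|nG] := pselect (Gamma F x r y); last first.
  by rewrite /kernel_right indicE memNset// mulr0.
move=> _; have yr' : y.1 <= good_radius b D by rewrite (le_trans (ler_norm _)).
have b0 := profile_b0 P.
have y2b : 2 * y.1 <= b.
  by have := good_radius_le; lra.
have [xy hy] := Gamma_sub P x0 r0 y2b Gy.
have y0 : 0 < y.1 := lt_le_trans x0 xy.
apply: (le_trans (kernel_right_le P x0 r0 yr' Gy)).
rewrite /kernel_major/= (gtr0_norm x0) (gtr0_norm y0) subr_ge0 xy hy /=.
exact: lexx.
Qed.

Lemma kernelT_le x y r : 0 <= r -> `|y.1| <= good_radius b D ->
  0 <= kernelT F r x y <= kernel_major (x, y).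
Proof.
move=> r0 yr; have K0 := kernel_major_ge0 (x, y); rewrite /kernelT; case: ifP => x1.
  by rewrite kernel_right_ge0 majorant_right.
case: ifP => x2; last by rewrite K0 lexx.
rewrite kernel_right_ge0 /=; have -> : kernel_major (x, y) =
    kernel_major (Defs.reflect x, Defs.reflect y).
  by rewrite /kernel_major/= !normrN.
by apply: majorant_right; rewrite //= ?normrN// oppr_gt0.
Qed.

Lemma measurable_kernel_major : measurable_fun [set: T * T] kernel_major.
Proof.
have m11 : measurable_fun [set: T * T] (fun z => z.1.1 : R).
  exact: (measurableT_comp measurable_fst measurable_fst).
have m12 : measurable_fun [set: T * T] (fun z => z.1.2 : R).
  exact: (measurableT_comp measurable_snd measurable_fst).
have m21 : measurable_fun [set: T * T] (fun z => z.2.1 : R).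
  exact: (measurableT_comp measurable_fst measurable_snd).
have m22 : measurable_fun [set: T * T] (fun z => z.2.2 : R).
  exact: (measurableT_comp measurable_snd measurable_snd).
have mf1 : measurable_fun [set: R] (fun s => f `|s|).
  rewrite /f /fF; apply: measurable_fun_ifT => //.
  - by apply: measurable_fun_eqr => //; exact: measurableT_comp.
  - under eq_fun do rewrite normr_id.
    by apply: (measurableT_comp (@measurable_expR R)); exact: measurableT_comp.
have mS1 : measurable_fun [set: R] (fun s => S `|s|).
  apply: measurable_funM; first exact: normr_measurable.
  exact: (@measurable_inv_ge0 _ _ R (fun s : measurableTypeR R => g `|s|)).
have mf : measurable_fun [set: T * T] (fun z => f `|z.2.1|) := measurableT_comp mf1 m21.
have mS : measurable_fun [set: T * T] (fun z => S `|z.2.1|) := measurableT_comp mS1 m21.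
have mt : measurable_fun [set: T * T] (fun z => `|z.2.1| - `|z.1.1|).
  by apply: measurable_funB; exact: measurableT_comp.
have meta : measurable_fun [set: T * T] (fun z => `|z.2.2 - z.1.2|).
  by apply: measurableT_comp => //; exact: measurable_funB.
have f0 z : 0 <= f `|z| := fF_ge0 F _.
have mfS : measurable_fun [set: T * T] (fun z => f `|z.2.1| * S `|z.2.1|).
  exact: measurable_funM.
rewrite /kernel_major.
(* On the branch in question the denominator is nonnegative, so the maximum with 0 changes nothing
   there. It makes the denominator nonnegative everywhere, as [measurable_inv_ge0] requires. *)
have -> : (fun z : T * T => let Y := `|z.2.1| in let t := Y - `|z.1.1| in
    let eta := `|z.2.2 - z.1.2| in
    if (0 <= t) && (eta <= C0 * (f Y * S Y))
    then C2 / (f Y * S Y) * (1 + S Y / Num.max t (eta / f Y)) else 0) =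
  (fun z : T * T =>
    if (0 <= `|z.2.1| - `|z.1.1|) && (`|z.2.2 - z.1.2| <= C0 * (f `|z.2.1| * S `|z.2.1|))
    then C2 / (f `|z.2.1| * S `|z.2.1|) * (1 + S `|z.2.1| *
      (Num.max 0 (Num.max (`|z.2.1| - `|z.1.1|) (`|z.2.2 - z.1.2| / f `|z.2.1|)))^-1)
    else 0).
  apply/funext => z /=; case: ifP => // /andP[t0 _].
  by rewrite [Num.max 0 _]max_r// le_max t0.
apply: measurable_fun_ifT => //.
- apply: measurable_and; apply: measurable_fun_ler => //.
  exact: measurable_funM.
- apply: measurable_funM.
    by apply: measurable_funM => //; apply: measurable_inv_ge0 => // z; rewrite mulr_ge0.
  apply: measurable_funD => //; apply: measurable_funM => //.
  apply: measurable_inv_ge0; first by move=> z; rewrite le_max lexx.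
  apply: measurable_maxr => //; apply: measurable_maxr => //.
  apply: measurable_funM => //; exact: measurable_inv_ge0.
Qed.

(* The weights [(Y - |x1|)^(-3/4)] and [|x2 - y2|^(-3/4)] come from bounding the
   ratio of the scale to the distance by a geometric mean and using that
   [Phi (c t) / Phi t] grows at most like [c^(3/2)]. *)
Lemma integral_Phi_kernel_major m : 1 <= m -> exists2 C, 0 < C &
  forall (B : set T) (y : T) (a : R), measurable B -> `|y.1| <= b -> 0 <= a ->
  (\int[leb2 R]_(x in B) (Phi m (a * kernel_major (x, y)))%:E <=
   (C * (`|y.1| * (f `|y.1| * S `|y.1|)) *
     Phi m (a * (C2 / (f `|y.1| * S `|y.1|))))%:E)%E.
Proof.
move=> m1; have [Cp Cp0 hCp] := @Phi_power R m m1.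
exists (Cp * 2 `^ (3 / 2) * 256 * (2 * C0)).
  have p2 : 0 < 2 `^ (3 / 2) :> R by exact: powR_gt0.
  by rewrite (mulr_gt0 (mulr_gt0 (mulr_gt0 Cp0 p2) _) (mulr_gt0 _ C0_gt0)).
move=> B y a mB yb a0; set Y : R := `|y.1|; set N := f Y * S Y.
have Y0 : 0 <= Y := normr_ge0 y.1.
(* On the axis [f] is 0 and the inverse of 0 is 0, so both sides vanish. *)
have := Y0; rewrite le_eqVlt => /predU1P[Y00|Yp].
  have N0 : N = 0 by rewrite /N /f /fF -Y00 eqxx mul0r.
  rewrite integral0_eq; first by rewrite -Y00 mul0r mulr0 mul0r lexx.
  move=> x _; rewrite /kernel_major/= -/Y -/N N0 invr0.
  by case: ifP => _; rewrite ?mulr0 ?mul0r ?mulr0 Phi0.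
have fY : 0 < f Y by exact: (f_gt0 F).
have SY : 0 < S Y by exact: (scale_gt0 P).
have N0 : 0 < N by rewrite mulr_gt0.
(* Twice the height of the support, so that [x2] lies strictly within distance [H] of [y2]. *)
set H := 2 * (C0 * N); have H0 : 0 < H by apply: mulr_gt0 => //; exact: (mulr_gt0 C0_gt0 N0).
set A := a * (C2 / N); have A0 : 0 <= A by rewrite mulr_ge0// divr_ge0// ltW.
(* The weights are singular where [|x1| = Y] or [x2 = y2]; this null set is removed. *)
pose Z1 : set T := [set Y; - Y]%classic `*` setT.
pose Z2 : set T := setT `*` [set y.2]%classic.
pose Z : set T := Z1 `|` Z2.
have mYY : measurable ([set Y; - Y]%classic : set (measurableTypeR R)).
  by apply: measurableU; exact: measurable_set1.
have my2 : measurable ([set y.2]%classic : set (measurableTypeR R)).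
  exact: measurable_set1.
have mZ : measurable Z.
  by apply: measurableU; exact: measurableX.
have Z0 : leb2 R Z = 0%E.
  apply/eqP; rewrite eq_le measure_ge0 andbT.
  have h : (leb2 R Z <= leb2 R Z1 + leb2 R Z2)%E.
    by apply: (measureU2 (leb2 R)); exact: measurableX.
  have hZ1 : leb2 R Z1 = 0%E.
    rewrite /leb2/= product_measure1E//= countable_lebesgue_measure0 ?mul0e//.
    by apply: finite_set_countable; exact: finite_set2.
  have hZ2 : leb2 R Z2 = 0%E.
    by rewrite /leb2/= product_measure1E//= lebesgue_measure_set1 mule0.
  by apply: (le_trans h); rewrite hZ1 hZ2 adde0; exact: lexx.
rewrite (@ge0_negligible_integral _ _ _ (leb2 R) B Z)//; last 2 first.
- apply/measurable_EFinP; apply: (measurable_funS measurableT) => //.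
  apply: (measurableT_comp (measurable_Phi (lt_le_trans ltr01 m1))).
  apply: measurable_funM => //.
  exact: (measurableT_comp measurable_kernel_major).
- by move=> x _; rewrite lee_fin Phi_ge0// mulr_ge0// kernel_major_ge0.
pose E : set T := `](- Y)%R, Y[%classic `*`
       (`](y.2 - H)%R, y.2[%classic `|` `]y.2, (y.2 + H)%R[%classic).
pose M := Cp * 2 `^ (3 / 2) * (Y * H) `^ (3 / 4) * Phi m A.
have M0 : 0 <= M by rewrite !mulr_ge0 ?powR_ge0 ?(ltW Cp0)// Phi_ge0.
pose w (x : T) := (Y - `|x.1|) `^ (- (3 / 4)) * `|x.2 - y.2| `^ (- (3 / 4)).
have w0 x : 0 <= w x by rewrite mulr_ge0 ?powR_ge0.
apply: (@le_trans _ _ (\int[leb2 R]_(x in E) (M * w x)%:E)%E).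
  rewrite [leRHS]integral_mkcond; apply: le_ge0_integral => x.
  - by move=> _; rewrite lee_fin Phi_ge0// mulr_ge0// kernel_major_ge0.
  - by move=> _; rewrite /patch; case: ifP => // _; [rewrite lee_fin mulr_ge0|exact: lexx].
  move=> [_ nZ]; split => //; rewrite /kernel_major/= -/Y -/N.
  case: ifP => [/andP[t0 hH]|_]; last first.
    rewrite mulr0 Phi0 /patch; case: ifP => // _; last exact: lexx.
    by rewrite lee_fin mulr_ge0.
  set t : R := Y - `|x.1|; set eta : R := `|y.2 - x.2|.
  have tp : 0 < t.
    rewrite lt_def t0 andbT; apply/eqP => tx; apply: nZ; left; split => //=.
    have : `|x.1| = Y by rewrite /t in tx; lra.
    by case: (leP 0 x.1) => x0; [rewrite ger0_norm// => ->; left|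
      rewrite ltr0_norm// => <-; right; rewrite opprK].
  have ep : 0 < eta.
    rewrite normr_gt0 subr_eq0; apply/eqP => e; apply: nZ; right; split => //=.
  have eH : eta < H by rewrite (le_lt_trans hH)// /H; have := mulr_gt0 C0_gt0 N0; lra.
  have xE : E x.
    split => /=.
      by rewrite in_itv/= -ltr_norml; rewrite /t in tp; lra.
    move: ep eH; rewrite /eta !in_itv/=; have [xy|xy] := leP 0 (y.2 - x.2).
      by rewrite ger0_norm// => e1 e2; left; apply/andP; split; lra.
    by rewrite ltr0_norm// => e1 e2; right; apply/andP; split; lra.
  rewrite /patch mem_set//= lee_fin.
  have mx0 : 0 < Num.max t (eta / f Y) by rewrite lt_max tp.
  set k := S Y / _; have k0 : 0 <= k by rewrite divr_ge0// ltW.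
  set W := Y * H / (t * eta); have te : 0 < t * eta by rewrite mulr_gt0.
  have SYY : S Y <= Y by exact: (scale_le P).
  have tY : t <= Y by rewrite /t; have := normr_ge0 x.1; lra.
  have NH : N <= H.
    have C01 : 1 <= C0 := C0_ge1 P.
    by rewrite /H mulrA ler_peMl ?(ltW N0)//; lra.
  have W1 : 1 <= W by rewrite ler_pdivlMr// mul1r; apply: ler_pM; rewrite // ltW.
  have kt : k <= Y / t.
    apply: ler_pM => //; [exact: ltW|by rewrite invr_ge0 ltW|].
    by rewrite lef_pV2 ?posrE// le_max lexx.
  have ke : k <= H / eta.
    apply: (@le_trans _ _ (N / eta)); last by rewrite ler_pM2r ?invr_gt0.
    have -> : N / eta = S Y / (eta / f Y) by rewrite /N; field; rewrite !gt_eqF.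
    by rewrite ler_pM2l// lef_pV2 ?posrE// ?divr_gt0// le_max lexx orbT.
  have kW : 1 + k <= 2 * Num.sqrt W.
    have h1 : 1 <= Num.sqrt W by rewrite -[leLHS]sqrtr1 ler_wsqrtr.
    have h2 : k <= Num.sqrt W.
      rewrite -[k](ger0_norm k0) -sqrtr_sqr; apply: ler_wsqrtr.
      have -> : W = (Y / t) * (H / eta) by rewrite /W; field; rewrite !gt_eqF.
      by rewrite expr2 ler_pM.
    lra.
  have c1 : 1 <= 2 * Num.sqrt W by lra.
  have -> : a * (C2 / N * (1 + k)) = (1 + k) * A by rewrite /A; ring.
  apply: (@le_trans _ _ (Phi m (2 * Num.sqrt W * A))).
    by apply: ler_Phi => //; [rewrite mulr_ge0//; lra|rewrite ler_wpM2r].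
  apply: (le_trans (hCp _ _ c1 A0)); rewrite le_eqVlt; apply/orP; left; apply/eqP.
  rewrite powRM ?sqrtr_ge0// -powR12_sqrt; last by lra.
  rewrite -powRrM; have -> : 2^-1 * (3 / 2) = 3 / 4 :> R by field.
  have -> : W `^ (3 / 4) = (Y * H) `^ (3 / 4) * w x.
    have -> : w x = (t * eta) `^ (- (3 / 4)).
      by rewrite /w -/t distrC -/eta [RHS]powRM// ltW.
    have -> : (t * eta) `^ (- (3 / 4)) = (t * eta)^-1 `^ (3 / 4).
      by rewrite -[(t * eta)^-1]powR_inv1 ?(ltW te)// -powRrM mulN1r.
    rewrite [LHS]powRM//; first exact: (mulr_ge0 Y0 (ltW H0)).
    by rewrite invr_ge0 ltW.
  by rewrite /M; ring.
under eq_integral do rewrite EFinM.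
rewrite ge0_integralZl_EFin//; last 3 first.
- by apply: measurableX; [|apply: measurableU]; exact: measurable_itv.
- by move=> x _; rewrite lee_fin.
- apply/measurable_EFinP; apply: (measurable_funS measurableT) => //.
  rewrite /w; apply: measurable_funM; apply: (measurableT_comp (measurable_powR _)).
    apply: measurable_funB => //; apply: measurableT_comp => //; exact: measurable_fst.
  apply: measurableT_comp => //; apply: measurable_funB => //; exact: measurable_snd.
apply: (@le_trans _ _ (M%:E * (256 * (Y `^ (1 / 4) * H `^ (1 / 4)))%:E)%E).
  by rewrite lee_wpmul2l//; exact: integral_crossing_singularities.
rewrite -EFinM lee_fin le_eqVlt; apply/orP; left; apply/eqP.
have YH : (Y * H) `^ (3 / 4) * (Y `^ (1 / 4) * H `^ (1 / 4)) = Y * H.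
  have YH0 : 0 < Y * H by rewrite mulr_gt0.
  rewrite -powRM ?(ltW H0)// -powRD ?(gt_eqF YH0) ?implybT//.
  by rewrite -[RHS]powRr1 ?(ltW YH0)//; congr (_ `^ _); field.
rewrite /M.
transitivity (Cp * 2 `^ (3 / 2) * 256 * Phi m A *
  ((Y * H) `^ (3 / 4) * (Y `^ (1 / 4) * H `^ (1 / 4)))); first by ring.
by rewrite YH /H; ring.
Qed.

End kernel_majorant.

(** * The strong inequality *)

(** [1 + sigma] comes from [Fks_ub] and [2^sigma] from [grow_doubling]; their product serves for
    both bounds. *)
Lemma profile_Fks (R : realType) k (sigma : R) : (0 < k)%N -> 0 < sigma ->
  profile (Fks k sigma) (grow k sigma) (iln_radius R k) ((1 + sigma) * 2 `^ sigma).
Proof.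
move=> k0 s0; have r0 := iln_radius_gt0 R k.
have r2 : iln_radius R k <= 2 * iln_radius R k by lra.
have p2 : 1 <= 2 `^ sigma :> R by rewrite -[leLHS](powRr0 2); apply: ler_powR; lra.
have D1 : 1 <= (1 + sigma) * 2 `^ sigma by nra.
split => //.
- have e1 := iter_expR_ge1 R k.
  by rewrite /iln_radius mul1r lef_pV2 ?posrE//; lra.
- by move=> x x0 xb; apply: grow_ge1 => //; lra.
- by move=> u v u0 uv vb; apply: grow_ninc => //; lra.
- move=> u v u0 uv vb vvu; have v0 := lt_le_trans u0 uv.
  have g0 : 0 <= grow k sigma v by exact: powR_ge0.
  have vb2 : v <= 2 * iln_radius R k by lra.
  have l1 := lnV_ge1 k0 v0 vb2.
  apply: (le_trans (grow_doubling k0 s0 u0 uv vb2 _)).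
    rewrite lnV_ratio// lerBlDr -lnM ?posrE ?invr_gt0//.
    by rewrite ler_ln ?posrE ?mulr_gt0 ?invr_gt0// -invfM lef_pV2 ?posrE ?mulr_gt0.
  by rewrite ler_wpM2r//; nra.
- by move=> u v u0 uv vb; apply: Fks_lb => //; lra.
- move=> u v u0 uv vb; have v0 := lt_le_trans u0 uv.
  apply: (le_trans (Fks_ub k0 s0 u0 uv _)); first by lra.
  have g0 : 0 <= grow k sigma u by exact: powR_ge0.
  have l0 := ln_ratio_ge0 u0 uv.
  by apply: ler_wpM2r => //; apply: ler_wpM2r => //; nra.
- by move=> x x0 xb; apply: derive1_Fks => //; lra.
Qed.

Lemma ln_le_sub1 (R : realType) (x : R) : 0 < x -> ln x <= x - 1.
Proof.
move=> x0; have -> : x = 1 + (x - 1) by ring.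
by rewrite [leRHS]addrAC subrr add0r le_ln1Dx//; lra.
Qed.

Lemma ln4_le3 (R : realType) : ln 4 <= 3 :> R.
Proof. by rewrite (le_trans (ln_le_sub1 _))//; lra. Qed.

(** The terms on the left will be [ln 4], [ln (r / Y)], [ln (g Y)] and [F Y - F r], the logarithms
    of the factors bounding [c] in [level_bound]. *)
Lemma log_level (R : realType) (s L g a b c : R) : 0 < s -> 0 <= L -> 1 <= g ->
  a <= 3 -> b <= g - 1 -> c <= (1 + s) * L * g ->
  a + (L + (b + c)) <= (3 + s) * (1 + L) * g.
Proof.
move=> s0 L0 g1 a3 bg cg; have Lg : 0 <= L * (g - 1) by apply: mulr_ge0; lra.
have sg : 0 <= s * g by apply: mulr_ge0; lra.
have Lg' : 0 <= L * g by apply: mulr_ge0; lra.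
lra.
Qed.

(** * Comparison of the bound at a fixed point with the volume of the ball *)

Section level_bound.
Variables (R : realType) (k : nat) (m sigma eps Ce : R).
Hypotheses (k0 : (0 < k)%N) (s0 : 0 < sigma) (m1 : 1 < m).
Hypotheses (eps0 : 0 <= eps) (Ce0 : 0 < Ce) (eps1 : (1 + eps) * (1 - m^-1) < 1).
Let b := iln_radius R k.
Let g := grow k sigma.
Let F := @Fks R k sigma.
Let f := fF F.
(** For [k = 1] the exponent [eps] is [sigma], and the condition on [eps] becomes
    [sigma < 1 / (m - 1)]. For [k >= 2] every positive [eps] is admissible here, see
    [grow_le_pow]. *)
Hypothesis g_le : forall r, 0 < r -> r <= b -> g r <= Ce * ln r^-1 `^ eps.

Let q0 : 0 < 1 - m^-1.
Proof. by rewrite subr_gt0 invf_lt1// (lt_trans ltr01). Qed.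

Let s3 : 0 < 3 + sigma.
Proof. by rewrite addr_gt0. Qed.

Let b2 r : r <= b -> r <= 2 * iln_radius R k.
Proof. by have := iln_radius_gt0 R k; rewrite -/b => h1 h2; lra. Qed.

(** The term [K^m G^(m - 1)] of [young_gap] for [K = 2^m] and [G = (3 + s) * 2^s * g r], with the
    power of [g r] split off. It is free of [k], so one [Cm] serves for all [k]. *)
Definition loss_const (p s : R) : R := (2 `^ p) `^ p * ((3 + s) * 2 `^ s) `^ (p - 1).

Let Cm := loss_const m sigma.

Let Cm0 : 0 <= Cm.
Proof. by rewrite mulr_ge0 ?powR_ge0. Qed.

(** [M = K^(1/(1 - p))] is the point where [K X^p = X]: below it the left side is at most [K M^p],
    above it at most [X]. *)
Lemma powR_sublinear (K p : R) : 0 < K -> 0 <= p -> p < 1 ->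
  exists M, forall X, 0 < X -> K * X `^ p <= X + M.
Proof.
move=> K0 p0 p1; set M := K `^ (1 - p)^-1; have M0 : 0 < M by exact: powR_gt0.
exists (K * M `^ p) => X X0; have [XM|MX] := leP X M.
  rewrite ler_wpDl ?(ltW X0)// ler_pM2l//.
  by apply: ge0_ler_powR; rewrite ?nnegrE ?(ltW X0) ?(ltW M0).
rewrite ler_wpDr ?mulr_ge0 ?powR_ge0 ?(ltW K0)//.
have KE : K = M `^ (1 - p).
  by rewrite /M -powRrM mulVf ?powRr1 ?(ltW K0)// subr_eq0 gt_eqF.
have XE : X = X `^ (1 - p) * X `^ p.
  by rewrite -powRD ?(gt_eqF X0) ?implybT// subrK powRr1// ltW.
rewrite [leRHS]XE; apply: ler_wpM2r; first exact: powR_ge0.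
rewrite KE; apply: ge0_ler_powR; rewrite ?nnegrE ?(ltW X0) ?(ltW M0) ?(ltW MX)//.
by rewrite subr_ge0 ltW.
Qed.

(* For [Y >= r0^2] doubling and Young's inequality give the loss [g r0 ^ (m-1)];
   further down the left side is sublinear in [ln (r0 / Y)]. *)
Lemma loss_le : exists C, forall Y r, 0 < Y -> Y <= r -> r <= b ->
  2 `^ m * ((3 + sigma) * (1 + ln (r / Y)) * g Y) `^ (1 - m^-1) <=
  ln (r / Y) + Cm * g r `^ (m - 1) + C.
Proof.
set q := 1 - m^-1; set K := 2 `^ m * ((3 + sigma) * (Ce * 2 `^ eps)) `^ q.
have c2 : 0 < Ce * 2 `^ eps by rewrite mulr_gt0 ?powR_gt0.
have K0 : 0 < K.
  by apply: mulr_gt0; apply: powR_gt0 => //; exact: mulr_gt0.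
have [|M hM] := @powR_sublinear K ((1 + eps) * q) K0 _ eps1.
  by rewrite mulr_ge0 ?(ltW q0) ?addr_ge0.
exists (1 + Num.max 0 (1 + M)) => Y r Y0 Yr rb; have r0 := lt_le_trans Y0 Yr.
have M0 : 0 <= Num.max 0 (1 + M) by rewrite le_max lexx.
have M1 : 1 + M <= Num.max 0 (1 + M) by rewrite le_max lexx orbT.
have gr : 0 < g r := lt_le_trans ltr01 (grow_ge1 s0 r0 (b2 rb)).
have gY : 0 <= g Y by exact: powR_ge0.
have L0 := ln_ratio_ge0 Y0 Yr; set L := ln (r / Y) in L0 *.
have L1 : 0 < 1 + L by lra.
have [Ll|lL] := leP L (ln r^-1).
  have gd := grow_doubling k0 s0 Y0 Yr (b2 rb) Ll; rewrite -/g in gd.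
  have G0 : 0 < (3 + sigma) * 2 `^ sigma * g r.
    by apply: mulr_gt0 => //; rewrite mulr_gt0 ?powR_gt0.
  have p20 : 0 < 2 :> R by [].
  have h := young_gap (ltW m1) (powR_gt0 m p20) L1 G0.
  have GE : (2 `^ m) `^ m * ((3 + sigma) * 2 `^ sigma * g r) `^ (m - 1) =
      Cm * g r `^ (m - 1).
    rewrite /Cm /loss_const -[RHS]mulrA; congr (_ * _); apply: powRM; last exact: ltW.
    exact: mulr_ge0 (ltW s3) (powR_ge0 _ _).
  rewrite GE in h.
  apply: (@le_trans _ _ (1 + L + Cm * g r `^ (m - 1))); last first.
    by rewrite -[leLHS]addrA (addrC 1) lerD2l lerDl.
  apply: le_trans h; rewrite ler_pM2l ?powR_gt0//.
  apply: ge0_ler_powR; rewrite ?nnegrE ?(ltW q0)//.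
  - by rewrite !mulr_ge0 ?(ltW s3) ?(ltW L1).
  - by rewrite mulr_ge0 ?(ltW L1) ?(ltW G0).
  - have -> : (1 + L) * ((3 + sigma) * 2 `^ sigma * g r) =
      (3 + sigma) * (1 + L) * (2 `^ sigma * g r) by ring.
    by rewrite ler_pM2l ?mulr_gt0.
have Yb : Y <= b := le_trans Yr rb.
(* Here [ln (1/r) < L], so [ln (1/Y)] is at most [2 (1 + L)] and [g_le] bounds [g Y] by a power of
   [1 + L]. The total exponent [(1 + eps) (1 - 1/m)] is below 1. *)
have lY : ln Y^-1 <= 2 * (1 + L) by have := lnV_ratio Y0 r0; rewrite -/L; lra.
have l1 := lnV_ge1 k0 Y0 (b2 Yb).
have gYe : g Y <= Ce * 2 `^ eps * (1 + L) `^ eps.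
  apply: (le_trans (g_le Y0 Yb)); rewrite -mulrA -powRM ?(ltW L1)// ler_pM2l//.
  by apply: ge0_ler_powR; rewrite ?nnegrE//; lra.
apply: (@le_trans _ _ (1 + L + M)); last first.
  have Q0 : 0 <= Cm * g r `^ (m - 1) by rewrite mulr_ge0 ?powR_ge0.
  rewrite (addrC 1 L) -[leLHS]addrA; apply: lerD; first by rewrite lerDl.
  by apply: (le_trans M1); rewrite lerDr.
apply: le_trans (hM _ L1).
have -> : K * (1 + L) `^ ((1 + eps) * q) =
    2 `^ m * ((3 + sigma) * (1 + L) * (Ce * 2 `^ eps * (1 + L) `^ eps)) `^ q.
  have -> : (3 + sigma) * (1 + L) * (Ce * 2 `^ eps * (1 + L) `^ eps) =
      (3 + sigma) * (Ce * 2 `^ eps) * (1 + L) `^ (1 + eps).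
    by rewrite powRD ?(gt_eqF L1) ?implybT// powRr1 ?(ltW L1)//; ring.
  rewrite [in RHS]powRM ?powR_ge0//; last by rewrite mulr_ge0 ?(ltW s3) ?(ltW c2).
  by rewrite powRrM /K -[LHS]mulrA.
rewrite ler_pM2l ?powR_gt0//.
apply: ge0_ler_powR; rewrite ?nnegrE ?(ltW q0)//.
- by rewrite !mulr_ge0 ?(ltW s3) ?(ltW L1).
- by rewrite !mulr_ge0 ?(ltW s3) ?(ltW L1) ?(ltW Ce0) ?powR_ge0.
- by rewrite ler_pM2l ?mulr_gt0.
Qed.

Lemma Phi_contract t c : 0 <= c -> c <= 1 -> 0 <= t -> Phi m (c * t) <= c * Phi m t.
Proof.
move=> c0 c1; rewrite le_eqVlt => /predU1P[<-|t0]; first by rewrite mulr0 Phi0 mulr0 lexx.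
move: c0; rewrite le_eqVlt => /predU1P[<-|c0]; first by rewrite !mul0r Phi0 lexx.
have ct : c * t <= t by rewrite ler_piMl// ltW.
have := @Phi_ratio R m (c * t) t (ltW m1) (mulr_gt0 c0 t0) ct.
rewrite ler_pdivrMr ?mulr_gt0// => h; apply: (le_trans h).
by rewrite le_eqVlt; apply/orP; left; apply/eqP; field; rewrite gt_eqF.
Qed.

(** The argument on the left is [c * t], with [t] the argument on the right. Splitting at [c = 1]
    gives [Phi (c t) <= c Z Phi t], and what then remains is [C Y Z <= (1 + C4) phi], which is
    [loss_le] exponentiated; [C3] contains [1 + C4] for this purpose. *)
Lemma level_bound C C2 : 0 < C -> 0 < C2 -> exists2 C3, 0 < C3 &
  forall Y r V a, 0 < Y -> Y <= r -> r <= b ->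
  0 < V -> V <= 4 * r ^+ 2 * f r -> 0 <= a ->
  C * (Y * (f Y * scale g Y)) * Phi m (2 * (a * V) * (C2 / (f Y * scale g Y))) <=
  V * Phi m (C3 * (r * expR (Cm * g r `^ (m - 1))) * a).
Proof.
move=> C00 C20; have [CL hL] := loss_le.
have e2 := expR_gt0 (2 `^ m + CL).
set C4 := C * expR (2 `^ m + CL); have C40 : 0 < C4 by exact: mulr_gt0.
exists (2 * C2 * (1 + C4)).
  by apply: mulr_gt0; [exact: mulr_gt0|exact: addr_gt0].
move=> Y r V a Y0 Yr rb V0 Vle a0.
set N := f Y * scale g Y; set G := g r `^ (m - 1).
have r0 := lt_le_trans Y0 Yr.
have Yb : Y <= b := le_trans Yr rb.
have gY : 1 <= g Y by apply: grow_ge1 => //; exact: b2.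
have SY : 0 < scale g Y by rewrite divr_gt0// (lt_le_trans ltr01).
have fY : 0 < f Y := f_gt0 F Y0.
have N0 : 0 < N by exact: mulr_gt0.
set phi := r * expR (Cm * G).
have G0 : 0 <= Cm * G by rewrite mulr_ge0 ?powR_ge0.
have phir : r <= phi by rewrite ler_peMr ?(ltW r0)// -expR0 ler_expR.
have phi0 := lt_le_trans r0 phir.
have C41 : 0 < 1 + C4 by exact: addr_gt0.
set t := 2 * C2 * (1 + C4) * phi * a.
have t0 : 0 <= t.
  apply: mulr_ge0 => //; apply: mulr_ge0; last exact: ltW.
  by apply: mulr_ge0; [apply: mulr_ge0 => //|]; exact: ltW.
set c := V / (N * ((1 + C4) * phi)).
have c0 : 0 < c by rewrite divr_gt0// mulr_gt0// mulr_gt0.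
have -> : 2 * (a * V) * (C2 / N) = c * t.
  by rewrite /c /t; field; rewrite !gt_eqF.
set L := ln (r / Y); have L0 : 0 <= L by exact: ln_ratio_ge0.
set X := (3 + sigma) * (1 + L) * g Y.
have X0 : 0 <= X.
  apply: mulr_ge0; last by exact: le_trans gY.
  by apply: mulr_ge0; [exact: ltW|exact: addr_ge0].
set Z := expR (2 `^ m * (1 + X `^ (1 - m^-1))).
have Z1 : 1 <= Z.
  rewrite /Z -[leLHS]expR0 ler_expR; apply: mulr_ge0; first exact: powR_ge0.
  by rewrite addr_ge0 ?powR_ge0.
have PhiZ : Phi m (c * t) <= c * Z * Phi m t.
  have Pt := @Phi_ge0 R m t t0.
  case: (leP c 1) => c1.
    apply: (le_trans (Phi_contract (ltW c0) c1 t0)); apply: ler_wpM2r => //.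
    by rewrite ler_peMr// ltW.
  apply: (le_trans (PhiM (ltW m1) (ltW c1) t0)); apply: ler_wpM2r => //.
  apply: (le_trans (bump_ub (ltW m1) (ltW c1))).
  apply: ler_wpM2l; first exact: ltW.
  rewrite /Z ler_expR; apply: ler_wpM2l; first exact: powR_ge0.
  apply: lerD; first exact: lexx.
  apply: ge0_ler_powR; rewrite ?nnegrE ?(ltW q0) ?ln_ge0 ?(ltW c1)//.
  have fr : f r = f Y * expR (F Y - F r).
    rewrite /f (fF_pos F Y0) (fF_pos F r0) -expRD; congr expR; ring.
  (* From [V <= 4 r^2 f r] and [phi >= r]. *)
  have cle : c <= 4 * ((r / Y) * (g Y * expR (F Y - F r))).
    have -> : 4 * ((r / Y) * (g Y * expR (F Y - F r))) = 4 * r ^+ 2 * f r / (N * r).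
      by rewrite fr /N /scale; field; rewrite !gt_eqF// (lt_le_trans ltr01).
    have Np : 0 < N * ((1 + C4) * phi) := mulr_gt0 N0 (mulr_gt0 C41 phi0).
    rewrite /c; apply: ler_pM => //; [exact: ltW|by rewrite invr_ge0; exact: ltW|].
    rewrite lef_pV2 ?posrE//; last exact: mulr_gt0.
    rewrite ler_pM2l//.
    by apply: (le_trans phir); rewrite ler_peMl ?(ltW phi0)// lerDl ltW.
  have gY0 : 0 < g Y by exact: lt_le_trans gY.
  have FYr := Fks_ub k0 s0 Y0 Yr (b2 rb); rewrite -/L -/g -/F in FYr.
  apply: (@le_trans _ _ (ln (4 * ((r / Y) * (g Y * expR (F Y - F r)))))).
    by rewrite ler_ln// posrE !mulr_gt0 ?invr_gt0// expR_gt0.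
  rewrite lnM ?posrE ?mulr_gt0 ?invr_gt0 ?expR_gt0//.
  rewrite lnM ?posrE ?mulr_gt0 ?invr_gt0 ?expR_gt0// -/L.
  rewrite lnM ?posrE ?expR_gt0// expRK.
  exact: (log_level s0 L0 gY (ln4_le3 R) (ln_le_sub1 gY0) FYr).
have PhiV : C * (Y * N) * (c * Z * Phi m t) <= V * Phi m t.
  rewrite [leLHS]mulrA; apply: ler_wpM2r; first exact: Phi_ge0.
  have -> : C * (Y * N) * (c * Z) = V * (C * Y * Z / ((1 + C4) * phi)).
    by rewrite /c; field; rewrite !gt_eqF.
  apply: ler_piMr; first exact: ltW.
  rewrite ler_pdivrMr; last exact: mulr_gt0.
  rewrite mul1r.
  have ZE : Y * Z <= expR (2 `^ m + CL) * phi.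
    have := hL Y r Y0 Yr rb; rewrite -/L -/X -/G => h.
    have -> : Y = r * expR (- L) by rewrite /L expRN lnK ?posrE ?divr_gt0//; field; rewrite !gt_eqF.
    rewrite /phi /Z -mulrA -expRD (mulrC (expR _)) -mulrA -expRD ler_pM2l// ler_expR.
    by rewrite mulrDr mulr1; lra.
  rewrite -mulrA; apply: (@le_trans _ _ (C4 * phi)).
    by rewrite /C4 -mulrA ler_pM2l.
  by rewrite ler_pM2r// lerDr.
apply: le_trans PhiV; apply: ler_wpM2l PhiZ.
exact: ltW (mulr_gt0 C00 (mulr_gt0 Y0 N0)).
Qed.

End level_bound.

Lemma leb2_sigma_finite (R : realType) : sigma_finite setT (leb2 R).
Proof.
exists (fun n : nat => `](- n%:R)%R, (n%:R : R)[%classic `*` `](- n%:R)%R, (n%:R : R)[%classic).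
  apply/esym; rewrite -subTset => x _.
  have [n hn] : exists n : nat, Num.max `|x.1| `|x.2| < n%:R.
    by exists (Num.bound (Num.max `|x.1| `|x.2|)); rewrite archi_boundP// le_max normr_ge0.
  by exists n => //; move: hn; rewrite gt_max /= !in_itv/= !ltr_norml => /andP[-> ->].
move=> n; split; first by apply: measurableX; exact: measurable_itv.
have n0 : 0 <= n%:R :> R by [].
by rewrite leb2_rect ?ltry//; lra.
Qed.

Section profile_ball.
Variables (R : realType) (F g : R -> R) (b D : R).
Hypothesis P : profile F g b D.
Local Notation T := (measurableTypeR R * measurableTypeR R)%type.

Lemma measurable_cball x r : measurable (cball F x r : set T).
Proof. exact: open_measurable_plane (@cball_open R F x r). Qed.

Lemma vol_cball0_gt0 r : 0 < r -> r <= b -> 0 < vol (cball F (0%R, 0%R) r).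
Proof.
move=> r0 rb; have r3 : 0 < r / 3 by rewrite divr_gt0.
have f3 := f_gt0 F r3.
have := @vol_cball_ge _ _ _ _ _ P (0, 0) r (r / 3) (r / 3) r0.
rewrite /= normr0 !add0r => /(_ rb (lexx _) (ltW r3) r3 r3) h.
apply: lt_le_trans (h _); last by lra.
by rewrite mulr_gt0// mulr_gt0// exprn_gt0.
Qed.

Lemma ge0_integral_mu0 r (h : T -> \bar R) :
  measurable_fun (cball F (0%R, 0%R) r) h -> (forall x, (0 <= h x)%E) ->
  (\int[mu0 F r]_(x in cball F (0%R, 0%R) r) h x =
   (vol (cball F (0%R, 0%R) r))^-1%:E * \int[leb2 R]_(x in cball F (0%R, 0%R) r) h x)%E.
Proof.
move=> mh h0; rewrite /mu0 ge0_integral_mscale//; exact: measurable_cball.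
Qed.

End profile_ball.

Lemma measurable_iln (R : realType) k :
  measurable_fun [set: R] (fun s => iln k `|s|^-1).
Proof.
rewrite /iln; elim: k => [|k IH] /=.
  by apply: measurable_inv_ge0 => //; exact: normr_measurable.
exact: (measurableT_comp (@measurable_ln R) IH).
Qed.

Lemma measurable_grow (R : realType) k (sigma : R) :
  measurable_fun [set: R] (fun s => grow k sigma `|s|).
Proof. exact: (measurableT_comp (measurable_powR _) (@measurable_iln R k)). Qed.

Lemma measurable_Fks (R : realType) k (sigma : R) :
  measurable_fun [set: R] (fun s => Fks k sigma `|s|).
Proof.
apply: measurable_funM; last exact: measurable_grow.
exact: (@measurable_iln R 1).
Qed.

Section strong.
Variables (R : realType) (k : nat) (m sigma eps Ce : R).
Hypotheses (k0 : (0 < k)%N) (s0 : 0 < sigma) (m1 : 1 < m).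
Hypotheses (eps0 : 0 <= eps) (Ce0 : 0 < Ce) (eps1 : (1 + eps) * (1 - m^-1) < 1).
Hypothesis g_le : forall r, 0 < r -> r <= iln_radius R k ->
  grow k sigma r <= Ce * ln r^-1 `^ eps.
Local Notation T := (measurableTypeR R * measurableTypeR R)%type.

(** The factor [r0 * exp (Cm * g^(m - 1))] is [phi(r0)] in the form in which Young's inequality
    produces it; [powR_log_exponent] rewrites it as a power of [r0]. *)
Lemma strong_sobolev_grow : exists beta, 0 < beta /\ exists C, 0 < C /\
  forall r0, 0 < r0 <= beta -> strong_sobolev_orlicz (Fks k sigma) m r0
    (C * (r0 * expR (loss_const m sigma * grow k sigma r0 `^ (m - 1)))).
Proof.
set D := (1 + sigma) * 2 `^ sigma; set b := iln_radius R k.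
set F := Fks k sigma; set g := grow k sigma.
have P : profile F g b D by exact: profile_Fks.
have b0 : 0 < b := profile_b0 P.
have rb4 := good_radius_gt0 P.
have rb5 : good_radius b D <= b by have := good_radius_le P; lra.
have gge0 u : 0 <= g u by exact: powR_ge0.
have [C Cp hC] := integral_Phi_kernel_major P gge0 (@measurable_Fks R k sigma)
  (@measurable_grow R k sigma) (ltW m1).
have C2p := kernel_const_gt0 P.
have [C3 C3p hC3] := level_bound k0 s0 m1 eps0 Ce0 eps1 g_le Cp C2p.
exists (good_radius b D); split => //.
exists C3; split => // r0 /andP[r0p r0b] h h0 ih.
have r0b' : r0 <= b := le_trans r0b rb5.
set B := cball F (0, 0) r0 in h0 ih *; set V := vol B.
have V0 : 0 < V by exact: (vol_cball0_gt0 P).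
set c := C3 * (r0 * expR (loss_const m sigma * g r0 `^ (m - 1))).
have c0 : 0 < c by rewrite mulr_gt0// mulr_gt0// expR_gt0.
have mB : measurable (B : set T) by exact: measurable_cball.
have By y : B y -> `|y.1| < r0.
  move=> yB; apply: le_lt_trans yB.
  by have := cdist_fst F (0, 0) y; rewrite /= subr0.
have mh : measurable_fun (B : set T) h.
  by have /integrableP[/measurable_EFinP] := ih.
have mabs : measurable_fun (B : set T) (fun x => `|h x|%:E).
  by apply/measurable_EFinP; exact: measurableT_comp.
have absE : (\int[mu0 F r0]_(x in B) `|h x|%:E =
    V^-1%:E * \int[leb2 R]_(x in B) `|h x|%:E)%E.
  by rewrite (ge0_integral_mu0 mabs)// => x; rewrite lee_fin.
have habs : (\int[leb2 R]_(x in B) `|h x|%:E < +oo)%E.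
  have /integrableP[_] := ih; rewrite -/B.
  under eq_integral do rewrite abse_EFin.
  rewrite absE.
  have : (0 <= \int[leb2 R]_(x in B) `|h x|%:E)%E.
    by apply: integral_ge0 => x _; rewrite lee_fin.
  case: (\int[leb2 R]_(x in B) `|h x|%:E)%E => [u _ _||]//; first exact: ltry.
  by rewrite gt0_muley// lte_fin invr_gt0.
have ih' : (leb2 R).-integrable (B : set T) (EFin \o h).
  apply/integrableP; split; first exact/measurable_EFinP.
  by under eq_integral do rewrite abse_EFin.
(* The measure [leb2] itself, packed with its sigma-finiteness for Tonelli's theorem. *)
pose mu : {sigma_finite_measure set T -> \bar R} :=
  HB.pack (@product_measure1 _ _ _ _ R (@lebesgue_measure R) (@lebesgue_measure R))
    (Measure_isSigmaFinite.Build _ _ _ (leb2 R) (@leb2_sigma_finite R)).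
have K0 x y : B y -> 0 <= kernelT F r0 x y <= kernel_major F g D (x, y).
  move=> yB; apply: (kernelT_le P gge0 x (ltW r0p)).
  exact: le_trans (ltW (By y yB)) r0b.
have mK : measurable_fun [set: T * T] (kernel_major F g D).
  apply: measurable_kernel_major => //; [exact: measurable_Fks|exact: measurable_grow].
have Km0 z : 0 <= kernel_major F g D z by exact: (kernel_major_ge0 P).
have [|J [mJ J0 J1 J2]] := @schur_Phi _ T R mu B m V c (kernelT F r0)
  (kernel_major F g D) h mB (ltW m1) V0 (ltW c0)
  mK Km0 (fun x y _ yB => K0 x y yB) h0 ih'.
  move=> y a yB a0; have aV : 0 <= 2 * (a * V) by rewrite mulr_ge0// mulr_ge0// ltW.
  have yb : `|y.1| <= b by exact: le_trans (ltW (By y yB)) r0b'.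
  apply: (le_trans (hC B y _ mB yb aV)); rewrite lee_fin.
  have [y0|yp] := leP `|y.1| 0.
    have -> : `|y.1| = 0 by apply/eqP; rewrite eq_le y0 normr_ge0.
    rewrite mul0r mulr0 mul0r; apply: mulr_ge0; first exact: ltW.
    by apply: Phi_ge0; rewrite mulr_ge0// ltW.
  have Vle : V <= 4 * r0 ^+ 2 * fF F r0.
    by have := vol_cball_le P (x := (0, 0)) r0p; rewrite /= normr0 add0r; apply.
  exact: (hC3 _ _ _ _ yp (ltW (By y yB)) r0b' V0 Vle (ltW a0)).
set G := fine _ in J2.
have GE : (\int[leb2 R]_(x in B) `|h x|%:E = G%:E)%E.
  rewrite /G fineK; last exact: integrable_fin_num.
  by apply: eq_integral => x /set_mem xB; rewrite ger0_norm ?h0.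
have G0 : 0 <= G by rewrite -lee_fin -GE; apply: integral_ge0 => x _; rewrite lee_fin.
set I := (\int[mu0 F r0]_(x in B) _)%E.
have op0 x : B x -> (0 <= er_map (Phi m) (opT F r0 h x))%E.
  move=> xB; have : (0 <= opT F r0 h x)%E.
    apply: integral_ge0 => y yB; rewrite lee_fin mulr_ge0 ?h0//.
    by case/andP: (K0 x y yB).
  by case: (opT F r0 h x) => [u||]//; rewrite /= !lee_fin; exact: Phi_ge0.
have I0 : (0 <= I)%E by exact: integral_ge0.
have cG : 0 <= c * (G / V) by rewrite mulr_ge0 ?(ltW c0)// divr_ge0// ltW.
have IJ : (I <= (Phi m (c * (G / V)))%:E)%E.
  apply: (@le_trans _ _ (\int[mu0 F r0]_(x in B) J x)%E).
    by apply: le_ge0_integral => // x xB; split => //; exact: J1.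
  rewrite (ge0_integral_mu0 mJ)//.
  apply: (@le_trans _ _ (V^-1%:E * (V * Phi m (c * (G / V)))%:E)%E).
    by rewrite lee_wpmul2l// lee_fin invr_ge0 ltW.
  by rewrite -EFinM lee_fin mulKf ?gt_eqF//; exact: lexx.
rewrite absE GE -!EFinM; move: I0 IJ; case: I => [u||]//=; rewrite !lee_fin => u0 uP.
rewrite (_ : c * (V^-1 * G) = c * (G / V)); last by rewrite (mulrC V^-1).
exact: Phi_inv_le (ltW m1) cG u0 uP.
Qed.

End strong.

Lemma powR_log_exponent (R : realType) (r c G : R) : 0 < r -> 0 < ln r^-1 ->
  r `^ (1 - c * (G / ln r^-1)) = r * expR (c * G).
Proof.
move=> r0 L0; set L := ln r^-1 in L0 *.
have rE : r = expR (- L) by rewrite /L lnV ?posrE// opprK lnK// posrE.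
rewrite {1}rE -expRM [in RHS]rE -expRD; congr expR.
by field; rewrite gt_eqF.
Qed.

(** With [L = ln (1/r)] and [d = eps / sigma], the iterated logarithm is at most
    [ln L = ln (L^d) / d <= L^d / d]; its power [sigma] is then of order [L^eps]. *)
Lemma grow_le_pow (R : realType) k (sigma eps : R) : (1 < k)%N -> 0 < sigma -> 0 < eps ->
  exists2 Ce, 0 < Ce & forall r, 0 < r -> r <= iln_radius R k ->
    grow k sigma r <= Ce * ln r^-1 `^ eps.
Proof.
move=> k1 s0 e0; set d := eps / sigma; have d0 : 0 < d by rewrite divr_gt0.
exists (d^-1 `^ sigma); first by rewrite powR_gt0 ?invr_gt0.
move=> r r0 rb; have rb2 : r <= 2 * iln_radius R k by have := iln_radius_gt0 R k; lra.
have dom := iln_radius_dom r0 rb2.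
have L1 := lnV_ge1 (ltnW k1) r0 rb2; set L := ln r^-1 in L1 *.
have L0 : 0 < L by exact: lt_le_trans L1.
have -> : L `^ eps = (L `^ d) `^ sigma by rewrite -powRrM divfK ?gt_eqF.
rewrite -powRM ?invr_ge0 ?powR_ge0 ?(ltW d0)//.
apply: ge0_ler_powR; rewrite ?nnegrE ?(ltW s0)//.
- by rewrite (le_trans ler01)// iln_ge1.
- by rewrite mulr_ge0 ?powR_ge0 ?invr_ge0 ?(ltW d0).
apply: (le_trans (iln_le_ln2 k1 dom)); rewrite -/L mulrC ler_pdivlMr// mulrC -ln_powR.
have p0 : 0 < L `^ d by rewrite powR_gt0.
by have := ln_le_sub1 p0; lra.
Qed.

Section strong_inequality.
Variables (R : realType) (m sigma : R).
Hypotheses (m1 : 1 < m) (s0 : 0 < sigma).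

Lemma strong_sobolev_iterated k : (1 < k)%N -> exists beta, 0 < beta /\
  exists C, 0 < C /\ forall r0, 0 < r0 <= beta ->
  strong_sobolev_orlicz (Fks k sigma) m r0
    (C * r0 `^ (1 - loss_const m sigma *
       (iter k (@ln R) r0^-1 `^ (sigma * (m - 1)) / ln r0^-1))).
Proof.
move=> k1; have k0 := ltnW k1; have m0 : 0 < m - 1 by rewrite subr_gt0.
(* Half of the critical exponent [1 / (m - 1)]; it makes [(1 + eps) (1 - 1/m)] equal to
   [1 - 1 / (2 m)]. *)
set eps := (2 * (m - 1))^-1; have e0 : 0 < eps by rewrite invr_gt0 mulr_gt0.
have [Ce Ce0 hCe] := grow_le_pow k1 s0 e0.
have [|beta [b0 [C [C0 hC]]]] := strong_sobolev_grow k0 s0 m1 (ltW e0) Ce0 _ hCe.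
  have mp : 0 < m by exact: lt_trans m1.
  have -> : (1 + eps) * (1 - m^-1) = 1 - (2 * m)^-1.
    by rewrite /eps; field; rewrite !gt_eqF.
  by rewrite gtrBl invr_gt0 mulr_gt0.
have i0 := iln_radius_gt0 R k.
exists (Num.min beta (iln_radius R k)); split; first by rewrite lt_min b0.
exists C; split => // r0 /andP[r0p]; rewrite le_min => /andP[r0b r0i].
have L1 : 1 <= ln r0^-1 by apply: (lnV_ge1 k0) => //; lra.
rewrite powR_log_exponent//; last by exact: lt_le_trans L1.
by rewrite powRrM; apply: hC; rewrite r0p.
Qed.

Lemma strong_sobolev_log : sigma < (m - 1)^-1 -> exists beta, 0 < beta /\
  exists C, 0 < C /\ forall r0, 0 < r0 <= beta ->
  strong_sobolev_orlicz (Fks 1 sigma) m r0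
    (C * r0 `^ (1 - loss_const m sigma * (1 / ln r0^-1 `^ (1 - sigma * (m - 1))))).
Proof.
move=> sm; have m0 : 0 < m - 1 by rewrite subr_gt0.
have mp : 0 < m by exact: lt_trans m1.
have g1 r : 0 < r -> r <= iln_radius R 1 -> grow 1 sigma r <= 1 * ln r^-1 `^ sigma.
  by move=> _ _; rewrite mul1r; exact: lexx.
have [|beta [b0 [C [C0 hC]]]] := strong_sobolev_grow (ltnSn 0) s0 m1 (ltW s0) ltr01 _ g1.
  have sm' : sigma * (m - 1) < 1 by rewrite -ltr_pdivlMr// div1r.
  rewrite (_ : 1 - m^-1 = (m - 1) / m); last by field; rewrite gt_eqF.
  by rewrite mulrA ltr_pdivrMr// mul1r; lra.
have i0 := iln_radius_gt0 R 1.
exists (Num.min beta (iln_radius R 1)); split; first by rewrite lt_min b0.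
exists C; split => // r0 /andP[r0p]; rewrite le_min => /andP[r0b r0i].
have L1 : 1 <= ln r0^-1 by apply: (@lnV_ge1 R 1) => //; lra.
have L0 : 0 < ln r0^-1 by exact: lt_le_trans L1.
have -> : 1 / ln r0^-1 `^ (1 - sigma * (m - 1)) = ln r0^-1 `^ (sigma * (m - 1)) / ln r0^-1.
  have p0 : 0 < ln r0^-1 `^ (1 - sigma * (m - 1)) by rewrite powR_gt0.
  have LE : ln r0^-1 `^ (sigma * (m - 1)) * ln r0^-1 `^ (1 - sigma * (m - 1)) = ln r0^-1.
    by rewrite -powRD ?(gt_eqF L0) ?implybT// addrC subrK powRr1// ltW.
  by apply/eqP; rewrite eqr_div ?(lt0r_neq0 L0) ?(lt0r_neq0 p0)// LE mul1r.
by rewrite powR_log_exponent// powRrM; apply: hC; rewrite r0p.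
Qed.

End strong_inequality.

(** * Failure of the standard inequality *)

(** Where the difference quotient diverges, the derivative has the default value 0. The bound
    therefore holds at the creases of a tent function as well. *)
Lemma derive_norm_le (R : realType) (w : R * R -> R) (x v : R * R) (M : R) : 0 <= M ->
  (\forall t \near 0^', `|w (t *: v + x) - w x| <= M * `|t|) -> `|'D_v w x| <= M.
Proof.
move=> M0 near_w; rewrite /derive; set q := (fun h : R => _).
have nq : \forall t \near 0^', `|q t| <= M.
  near=> t; have t0 : t != 0 by near: t; exact: nbhs_dnbhs_neq.
  rewrite /q /= normrM normfV mulrC ler_pdivrMr ?normr_gt0//.
  by near: t.
have [c|nc] := pselect (cvg (q @ 0^')); last first.
  by rewrite dvgP// normr0.
rewrite ler_norml; apply/andP; split.
  by apply: limr_ge => //; apply: filterS nq => t; rewrite ler_norml => /andP[].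
by apply: limr_le => //; apply: filterS nq => t; rewrite ler_norml => /andP[].
Unshelve. all: by end_near. Qed.

Section tent.
Variable R : realType.
Implicit Types s t e : R.

Definition tent s := Num.max 0 (1 - `|s|).

Lemma tent_ge0 s : 0 <= tent s.
Proof. by rewrite /tent le_max lexx. Qed.

Lemma tent_le1 s : tent s <= 1.
Proof. by rewrite /tent ge_max ler01/=; have := normr_ge0 s; lra. Qed.

Lemma tent_lipschitz s t : `|tent s - tent t| <= `|s - t|.
Proof.
have h (a c : R) : tent a - tent c <= `|a - c|.
  have h1 : 1 - `|a| <= tent c + `|a - c|.
    rewrite (@le_trans _ _ (1 - `|c| + `|a - c|))//.
      by have := ler_normD (c - a) a; rewrite subrK distrC; lra.
    by rewrite lerD2r /tent le_max lexx orbT.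
  rewrite lerBlDl {1}/tent ge_max h1 andbT addr_ge0 ?tent_ge0//.
by rewrite ler_norml h andbT lerNl opprB distrC h.
Qed.

Lemma tent_out s e : 0 < e -> e <= `|s| -> tent (s / e) = 0.
Proof.
move=> e0 es; rewrite /tent normrM normfV (gtr0_norm e0); apply: max_l.
by rewrite subr_le0 ler_pdivlMr// mul1r.
Qed.

Lemma tent_half s e : 0 < e -> `|s| <= e / 2 -> 1 / 2 <= tent (s / e).
Proof.
move=> e0 es; rewrite /tent normrM normfV (gtr0_norm e0) le_max; apply/orP; right.
have : `|s| / e <= 1 / 2 by rewrite ler_pdivrMr//; lra.
lra.
Qed.

Lemma tent_scaled_lipschitz s t e : 0 < e -> `|tent (s / e) - tent (t / e)| <= `|s - t| / e.
Proof.
move=> e0; apply: (le_trans (tent_lipschitz _ _)).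
by rewrite -mulrBl normrM normfV (gtr0_norm e0); exact: lexx.
Qed.

End tent.

Section spike.
Variables (R : realType) (A e h : R).
Hypotheses (A0 : 0 < A) (e0 : 0 < e) (h0 : 0 < h).

Definition spike (x : R * R) := A * (tent (x.1 / e) * tent (x.2 / h)).

Lemma spike_ge0 x : 0 <= spike x.
Proof. by apply: mulr_ge0; rewrite ?(ltW A0)// mulr_ge0 ?tent_ge0. Qed.

Lemma spike_fst x t : `|spike (t, x.2) - spike x| <= A / e * `|t - x.1|.
Proof.
rewrite /spike -mulrBr -mulrBl normrM (gtr0_norm A0) -mulrA ler_pM2l// normrM.
rewrite mulrC (ger0_norm (tent_ge0 _)) (mulrC e^-1).
apply: (le_trans _ (tent_scaled_lipschitz t x.1 e0)).
by rewrite ler_piMl// tent_le1.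
Qed.

Lemma spike_snd x t : `|spike (x.1, t) - spike x| <= A / h * `|t - x.2|.
Proof.
rewrite /spike -mulrBr -mulrBr normrM (gtr0_norm A0) -mulrA ler_pM2l// normrM.
rewrite (ger0_norm (tent_ge0 _)) (mulrC h^-1).
apply: (le_trans _ (tent_scaled_lipschitz t x.2 h0)).
by rewrite ler_piMl// tent_le1.
Qed.

Lemma lipschitz_spike : lipschitz spike.
Proof.
rewrite /lipschitz_on; near=> K; move=> [x y] _.
suff : `|spike x - spike y| <= K * `|x - y| by [].
have x1 : `|x.1 - y.1| <= `|x - y| by rewrite [leRHS]prod_normE le_max lexx.
have x2 : `|x.2 - y.2| <= `|x - y| by rewrite [leRHS]prod_normE le_max lexx orbT.
have xy : spike x - spike y = (spike (x.1, x.2) - spike (x.1, y.2)) +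
    (spike (x.1, y.2) - spike y) by case: x {x1 x2} => a c; ring.
rewrite xy (le_trans (ler_normD _ _))//.
have s1 := spike_snd (x.1, y.2) x.2; have s2 := spike_fst y x.1.
apply: (@le_trans _ _ ((A / h + A / e) * `|x - y|)).
  rewrite mulrDl; apply: lerD.
    by apply: (le_trans s1); rewrite ler_pM2l ?divr_gt0.
  by apply: (le_trans s2); rewrite ler_pM2l ?divr_gt0.
rewrite ler_wpM2r//; near: K; apply: nbhs_pinfty_ge; exact: num_real.
Unshelve. all: by end_near. Qed.

Let box : set (R * R) := `[- e, e]%classic `*` `[- h, h]%classic.

Lemma spike_out x : ~ box x -> spike x = 0.
Proof.
move=> nb; rewrite /spike; have [xe|ex] := leP e `|x.1|.
  by rewrite (tent_out e0 xe) mul0r mulr0.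
have [xh|hx] := leP h `|x.2|; first by rewrite (tent_out h0 xh) !mulr0.
exfalso; apply: nb; split; rewrite /= in_itv/= -ler_norml; exact: ltW.
Qed.

Lemma compact_box : compact box.
Proof. by apply: compact_setX; exact: segment_compact. Qed.

Lemma closed_box : closed box.
Proof. by apply: compact_closed; [exact: norm_hausdorff|exact: compact_box]. Qed.

Lemma spike_support : closure [set x | spike x != 0] `<=` box.
Proof.
rewrite [X in _ `<=` X](closure_id box).1; last exact: closed_box.
apply: closureS => x /= nz; apply: contrapT => /spike_out z.
by rewrite z eqxx in nz.
Qed.

Lemma spike_support_compact : compact (closure [set x | spike x != 0]).
Proof.
exact: subclosed_compact (@closed_closure _ _) compact_box spike_support.
Qed.

Lemma spike_derive_out x v : ~ box x -> 'D_v spike x = 0.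
Proof.
move=> nb; apply/eqP; rewrite -normr_le0; apply: derive_norm_le => //.
have ob : open (~` box) by exact: closed_openC closed_box.
have c : (fun t : R => t *: v + x) @ 0 --> x.
  rewrite -[X in _ --> X]add0r -[X in X + x](scale0r v).
  by apply: cvgD; [apply: cvgZr_tmp; exact: cvg_id|exact: cvg_cst].
have H := c _ (open_nbhs_nbhs (conj ob nb)).
near=> t; have nbt : ~ box (t *: v + x) by near: t; exact: nbhs_dnbhs H.
by rewrite (spike_out nbt) (spike_out nb) subrr normr0 mul0r.
Unshelve. all: by end_near. Qed.

Lemma spike_derive_fst x : `|'D_(1, 0) spike x| <= A / e.
Proof.
apply: derive_norm_le; first by rewrite divr_ge0// ltW.
near=> t; have := spike_fst x (t + x.1); rewrite addrK.
have -> // : t *: (1, 0) + x = (t + x.1, x.2).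
by apply/pair_equal_spec; split; rewrite /= /GRing.scale/= ?mulr1 ?mulr0 ?add0r.
Unshelve. all: by end_near. Qed.

Lemma spike_derive_snd x : `|'D_(0, 1) spike x| <= A / h.
Proof.
apply: derive_norm_le; first by rewrite divr_ge0// ltW.
near=> t; have := spike_snd x (t + x.2); rewrite addrK.
have -> // : t *: (0, 1) + x = (x.1, t + x.2).
by apply/pair_equal_spec; split; rewrite /= /GRing.scale/= ?mulr1 ?mulr0 ?add0r.
Unshelve. all: by end_near. Qed.

Lemma spike_half x : `|x.1| <= e / 2 -> `|x.2| <= h / 2 -> A / 4 <= spike x.
Proof.
move=> x1 x2; have t1 := tent_half e0 x1; have t2 := tent_half h0 x2.
by rewrite /spike ler_pM2l//; nra.
Qed.

End spike.

Section spike_test.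
Variables (R : realType) (F g : R -> R) (b D m : R).
Hypothesis P : profile F g b D.
Hypothesis m1 : 1 < m.
Let f := fF F.
Local Notation T := (measurableTypeR R * measurableTypeR R)%type.

(** The path runs to abscissa [e], vertically there, and back to [x1], with times at most [e], [e]
    and [2 e]. *)
Lemma box_sub_cball e r x : 0 < e -> 4 * e < r -> `|x.1| <= e -> `|x.2| <= e * f e ->
  cball F (0, 0) r x.
Proof.
move=> e0 er x1 x2; have fe := f_gt0 F e0.
have h1 := @reach_horizontal _ F _ _ _ e (@reach_refl _ F (0, 0)).
have h2 := @reach_vertical _ F _ _ _ x.2 h1 fe.
have := @reach_horizontal _ F _ _ _ x.1 h2; rewrite /= -surjective_pairing => h3.
apply: le_lt_trans (cdist_le h3) _; rewrite !subr0 add0r (gtr0_norm e0).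
have c2 : `|x.2| / fF F e <= e by rewrite ler_pdivrMr.
have c1 : `|x.1 - e| <= 2 * e.
  by rewrite (le_trans (ler_normB _ _))// (gtr0_norm e0); lra.
lra.
Qed.

Section fixed_scale.
Variable e : R.
Hypotheses (e0 : 0 < e) (eb : e <= b).
Let h := e * f e.
Let fe : 0 < f e. Proof. exact: f_gt0. Qed.
Let h0 : 0 < h. Proof. exact: mulr_gt0. Qed.
(** The gradient is at most [2 A / e] on a box of area [4 e h]; the height [1 / h] makes the product
    equal to 8, whatever [e] is. *)
Let A := h^-1.
Let A0 : 0 < A. Proof. by rewrite invr_gt0. Qed.
Let w := spike A e h.
Let box : set T := `[- e, e]%classic `*` `[- h, h]%classic.
Let half_box : set T := `[- (e / 2), e / 2]%classic `*` `[- (h / 2), h / 2]%classic.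

(** As [h = e * f e] and [f x1 <= f e] on the box, the weighted vertical derivative obeys the same
    bound [A / e] as the horizontal one. *)
Let norm_gradA_spike x : box x -> norm_gradA F w x <= 2 * (A / e).
Proof.
move=> [/=]; rewrite !in_itv/= -!ler_norml => x1 x2.
have d1 := spike_derive_fst h A0 e0 x; have d2 := spike_derive_snd e A0 h0 x.
have fx : f x.1 <= f e by exact: (f_sup P).
have f0 := fF_ge0 F x.1.
have d3 : `|f x.1 * 'D_(0, 1) w x| <= A / e.
  rewrite normrM (ger0_norm f0); apply: (@le_trans _ _ (f e * (A / h))).
    by apply: ler_pM.
  rewrite (_ : f e * (A / h) = A / e); first exact: lexx.
  by rewrite /h; field; rewrite !gt_eqF.
have Ae : 0 < A / e by rewrite divr_gt0.
rewrite /norm_gradA -(ger0_norm (ltW (mulr_gt0 (ltr0n R 2) Ae))) -sqrtr_sqr.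
apply: ler_wsqrtr.
have sq (u : R) : `|u| <= A / e -> u ^+ 2 <= (A / e) ^+ 2.
  by move=> uA; rewrite -[leLHS]real_normK ?num_real// lerXn2r ?nnegrE ?(ltW Ae).
have := sq _ d1; have := sq _ d3; rewrite -/f -/w => s1 s2.
rewrite [leRHS]exprMn; apply: le_trans (lerD s2 s1) _.
have -> : 2 ^+ 2 * (A / e) ^+ 2 = (A / e) ^+ 2 + (A / e) ^+ 2 + 2 * (A / e) ^+ 2 by ring.
by rewrite lerDl mulr_ge0// sqr_ge0.
Qed.

Let norm_gradA_spike_out x : ~ box x -> norm_gradA F w x = 0.
Proof.
move=> nb; rewrite /norm_gradA /w !spike_derive_out//.
by rewrite mulr0 expr0n addr0 sqrtr0.
Qed.

(** On the half box, of area [e * h], the spike is at least [A / 4], which bounds the [Phi]-integral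
    from below. Testing against a number [v] avoids evaluating the inverse of [Phi], and [|c|]
    covers negative [c]. *)
Lemma standard_sobolev_spike r0 c v : 4 * e < r0 -> r0 <= b ->
  standard_sobolev_orlicz F m r0 c -> 0 <= v ->
  Phi m v <= (vol (cball F (0, 0) r0))^-1 * (e * h * Phi m (A / 4)) ->
  v <= `|c| * (8 / vol (cball F (0, 0) r0)).
Proof.
move=> er rb std v0; have r00 : 0 < r0 by apply: lt_trans er; rewrite mulr_gt0.
have V0 := vol_cball0_gt0 P r00 rb.
set V := vol _ in V0 *; set B := cball F (0, 0) r0.
have boxB : box `<=` B.
  by move=> x [/=]; rewrite !in_itv/= -!ler_norml => x1 x2; exact: (box_sub_cball e0 er).
have halfB : half_box `<=` B.
  move=> x [/=]; rewrite !in_itv/= -!ler_norml => x1 x2.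
  have half (u : R) : 0 < u -> u / 2 <= u by move=> u0; rewrite ler_pdivrMr// ler_peMr ?ltW// ltr1n.
  by apply: (box_sub_cball e0 er); [exact: le_trans x1 (half _ e0)|exact: le_trans x2 (half _ h0)].
have mbox : measurable box by apply: measurableX; exact: measurable_itv.
have mhalf : measurable half_box by apply: measurableX; exact: measurable_itv.
have sym (u : R) : 0 < u -> - u <= u.
  by move=> u0; rewrite -subr_ge0 opprK addr_ge0 ?ltW.
have e20 : 0 < e / 2 by rewrite divr_gt0.
have h20 : 0 < h / 2 by rewrite divr_gt0.
have mu0E (X : set T) : mu0 F r0 X = (V^-1%:E * leb2 R X)%E by [].
have wc : compact (closure [set x | w x != 0]) by exact: spike_support_compact.
have wB : closure [set x | w x != 0] `<=` B.
  by move=> x wx; apply: boxB; exact: (spike_support e0 h0 wx).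
move=> vle; have := std w (lipschitz_spike A0 e0 h0) wc wB.
set I := (\int[mu0 F r0]_(x in B) (Phi m `|w x|)%:E)%E.
set J := (\int[mu0 F r0]_(x in B) (norm_gradA F w x)%:E)%E.
have I1 : ((V^-1 * (e * h * Phi m (A / 4)))%:E <= I)%E.
  have -> : (V^-1 * (e * h * Phi m (A / 4)))%:E =
      (\int[mu0 F r0]_(x in half_box) (Phi m (A / 4))%:E)%E.
    rewrite integral_cst// mu0E leb2_rect_cc; [|exact: sym|exact: sym].
    by rewrite -!EFinM; congr EFin; field; rewrite gt_eqF.
  apply: le_ge0_integral => x.
  - by move=> _; rewrite lee_fin Phi_ge0// divr_ge0// ltW.
  - by move=> _; rewrite lee_fin Phi_ge0.
  move=> xh; split; first exact: halfB.
  move: xh => [/=]; rewrite !in_itv/= -!ler_norml => x1 x2.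
  rewrite lee_fin ger0_norm ?(spike_ge0 _ _ A0)//.
  apply: ler_Phi; rewrite ?(ltW m1) ?divr_ge0 ?(ltW A0)//.
  exact: (spike_half A0 e0 h0).
have J0 : (0 <= J)%E by apply: integral_ge0 => x _; rewrite lee_fin sqrtr_ge0.
have J1 : (J <= (8 / V)%:E)%E.
  have -> : (8 / V)%:E = (\int[mu0 F r0]_(x in box) (2 * (A / e))%:E)%E.
    rewrite integral_cst// mu0E leb2_rect_cc; [|exact: sym|exact: sym].
    by rewrite -!EFinM; congr EFin; rewrite /A; field; rewrite !gt_eqF.
  rewrite [leRHS]integral_mkcond; apply: le_ge0_integral => x.
  - by move=> _; rewrite lee_fin sqrtr_ge0.
  - move=> _; rewrite /patch; case: ifP => _; last exact: lexx.
    by rewrite lee_fin mulr_ge0// divr_ge0// ltW.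
  move=> _; split => //; rewrite /patch; case: ifPn => xb.
    by rewrite lee_fin norm_gradA_spike//; exact: set_mem.
  rewrite norm_gradA_spike_out; first exact: lexx.
  by move=> bx; rewrite mem_set in xb.
have cJ : (c%:E * J <= (`|c| * (8 / V))%:E)%E.
  apply: (@le_trans _ _ (`|c|%:E * J)%E).
    by apply: lee_wpmul2r => //; rewrite lee_fin ler_norm.
  by rewrite EFinM; apply: lee_wpmul2l => //; rewrite lee_fin.
move=> /le_trans/(_ cJ); move: I1; case: I => [u||]//=; rewrite !lee_fin => u1.
by apply: le_trans; apply: (Phi_inv_ge (ltW m1) v0); exact: le_trans u1.
Qed.

End fixed_scale.
End spike_test.

Section failure.
Variables (R : realType) (m sigma : R).
Hypotheses (m1 : 1 < m) (s0 : 0 < sigma) (sm : (m - 1)^-1 < sigma).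

(** [X^p] is the gain [(ln (1/h))^(1 - 1/m)] of [Phi] on a spike, up to lower order terms in
    [ln (1/h)]. The assumption on [sigma] says exactly that [p > 1], so the gain beats the loss of
    area [exp (- X)]. *)
Let p := (1 + sigma) * (1 - m^-1).

Let p1 : 1 < p.
Proof.
have mp : 0 < m by exact: lt_trans m1.
have mp1 : 0 < m - 1 by rewrite subr_gt0.
have : 1 < sigma * (m - 1) by rewrite -ltr_pdivrMr// div1r.
rewrite /p (_ : 1 - m^-1 = (m - 1) / m); last by field; rewrite gt_eqF.
by rewrite mulrA ltr_pdivlMr// mul1r; lra.
Qed.

(* At [e = exp (- X)] the height of the spike is [exp (X + X ^ (1 + sigma))]. *)
Lemma spike_energy X e h : 3 <= X -> Ebump m <= expR (X + X `^ (1 + sigma)) / 4 ->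
  e = expR (- X) -> h = e * fF (Fks 1 sigma) e ->
  4^-1 * expR (X `^ p - X) <= e * h * Phi m (h^-1 / 4).
Proof.
move=> X3 Xm eE hE; have X0 : 0 < X by lra.
have e0 : 0 < e by rewrite eE; exact: expR_gt0.
have eV : ln e^-1 = X by rewrite eE lnV ?posrE ?expR_gt0// expRK opprK.
have XX : X * X `^ sigma = X `^ (1 + sigma).
  by rewrite powRD ?(gt_eqF X0) ?implybT// powRr1// ltW.
have hV : h^-1 = expR (X + X `^ (1 + sigma)).
  rewrite hE fF_pos// FksE /grow /iln/= eV XX eE -expRD -expRN.
  by congr expR; ring.
rewrite -hV in Xm; set A := h^-1 in hV Xm *.
have h0 : 0 < h by rewrite hE mulr_gt0// f_gt0.
have A0 : 0 < A by rewrite invr_gt0.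
have Y0 : 0 < X `^ (1 + sigma) by exact: powR_gt0.
(* [3 <= X] absorbs [ln 4]. *)
have lnA : X `^ (1 + sigma) <= ln (A / 4).
  rewrite ln_div ?posrE// hV expRK; have := ln4_le3 R; lra.
have l0 : 0 < ln (A / 4) by exact: lt_le_trans lnA.
have q0 : 0 <= 1 - m^-1 by rewrite subr_ge0 invf_le1 ?(ltW m1)// (lt_trans ltr01).
have PA : A / 4 * expR (X `^ p) <= Phi m (A / 4).
  rewrite PhiE Xm bump.unlock.
  have {1}-> : A / 4 = expR (ln (A / 4)) by rewrite lnK// posrE divr_gt0.
  rewrite -expRD ler_expR; apply: le_trans (elog_lb (ltW m1) l0); rewrite lerD2l.
  by rewrite /p powRrM; apply: ge0_ler_powR; rewrite ?nnegrE ?(ltW Y0) ?(ltW l0).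
have eh : 0 <= e * h by exact: ltW (mulr_gt0 e0 h0).
apply: le_trans (ler_wpM2l eh PA).
rewrite expRD -eE le_eqVlt; apply/orP; left; apply/eqP.
by rewrite /A; field; rewrite gt_eqF.
Qed.

(** For [v = K + 1] the conclusion of [standard_sobolev_spike] reads [K + 1 <= K], and a
    sufficiently narrow spike meets its hypotheses. *)
Lemma standard_sobolev_fails r0 c : 0 < r0 -> r0 <= iln_radius R 1 ->
  ~ standard_sobolev_orlicz (Fks 1 sigma) m r0 c.
Proof.
move=> r00 rb std; have P := profile_Fks (ltnSn 0) s0.
have V0 := vol_cball0_gt0 P r00 rb.
set V := vol _ in V0.
set K := `|c| * (8 / V); have K0 : 0 <= K by rewrite mulr_ge0// divr_ge0// ltW.
have PK : 0 < Phi m (K + 1) by apply: Phi_gt0; [exact: ltW|lra].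
(* Each summand of [X] meets one demand: [M1] gives [4 e < r0], [M2] puts a quarter of the spike's
   height beyond [Ebump m], [M3] makes [exp X] at least [4 V Phi (K + 1)], and [M4] gives
   [X^p >= 2 X]. *)
pose M1 := `|ln (r0 / 8)|; pose M2 := `|ln (4 * Ebump m)|.
pose M3 := `|ln (4 * V * Phi m (K + 1))|; pose M4 := 2 `^ (p - 1)^-1.
have M10 : 0 <= M1 := normr_ge0 _.
have M20 : 0 <= M2 := normr_ge0 _.
have M30 : 0 <= M3 := normr_ge0 _.
have M40 : 0 <= M4 by exact: powR_ge0.
pose X := 3 + M1 + M2 + M3 + M4; have X3 : 3 <= X by rewrite /X; lra.
have X0 : 0 < X by lra.
set e := expR (- X); have e0 : 0 < e by exact: expR_gt0.
have er : 4 * e < r0.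
  have : e <= r0 / 8.
    rewrite -[leRHS]lnK ?posrE ?divr_gt0// ler_expR.
    have : - ln (r0 / 8) <= M1 by rewrite /M1 -normrN ler_norm.
    by rewrite /X; lra.
  lra.
have eb : e <= iln_radius R 1 by lra.
have Xm : Ebump m <= expR (X + X `^ (1 + sigma)) / 4.
  rewrite ler_pdivlMr// mulrC.
  have E0 : 0 < 4 * Ebump m by rewrite mulr_gt0// Ebump_gt0.
  rewrite -[leLHS]lnK ?posrE// ler_expR.
  have : ln (4 * Ebump m) <= M2 by exact: ler_norm.
  by have := powR_ge0 X (1 + sigma); rewrite /X; lra.
have p10 : 0 < p - 1 by rewrite subr_gt0.
have M4X : M4 <= X by rewrite /X; lra.
have Xp : 2 * X <= X `^ p.
  have -> : X `^ p = X `^ (p - 1) * X.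
    rewrite -[in X in _ = _ * X](powRr1 (ltW X0)) -powRD ?(gt_eqF X0) ?implybT//.
    by rewrite subrK.
  rewrite ler_pM2r//; apply: (@le_trans _ _ (M4 `^ (p - 1))).
    by rewrite /M4 -powRrM mulVf ?(lt0r_neq0 p10)// powRr1//; exact: lexx.
  by apply: ge0_ler_powR; rewrite ?nnegrE ?(ltW X0) ?(ltW p10).
have energy := spike_energy X3 Xm erefl erefl.
have := @standard_sobolev_spike _ _ _ _ _ m P m1 e e0 eb r0 c (K + 1) er rb std.
rewrite -/V -/K => big.
suff : K + 1 <= K by rewrite gerDl ler10.
apply: big; first by rewrite addr_ge0.
apply: (@le_trans _ _ (V^-1 * (4^-1 * expR (X `^ p - X)))); last first.
  by rewrite ler_pM2l ?invr_gt0.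
have -> : Phi m (K + 1) = V^-1 * (4^-1 * (4 * V * Phi m (K + 1))).
  by field; rewrite gt_eqF.
rewrite !ler_pM2l ?invr_gt0//.
have T0 : 0 < 4 * V * Phi m (K + 1) by apply: mulr_gt0 => //; exact: mulr_gt0.
rewrite -[leLHS]lnK ?posrE// ler_expR.
have : ln (4 * V * Phi m (K + 1)) <= M3 by exact: ler_norm.
by rewrite /X in Xp *; lra.
Qed.

End failure.

Theorem corollary92 (R : realType) (m sigma : R) (hm : 1 < m) (hsigma : 0 < sigma) :
  (exists Cm : R, 0 < Cm /\
    forall k : nat, (2 <= k)%N ->
    exists beta : R, 0 < beta /\
    exists C : R, 0 < C /\
    forall r0 : R, 0 < r0 <= beta ->
      strong_sobolev_orlicz (Fks k sigma) m r0
        (C * r0 `^ (1 - Cm * ((iter k (@ln R) (r0^-1)) `^ (sigma * (m - 1))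
                              / ln (r0^-1)))))
  /\
  (sigma < (m - 1)^-1 ->
    exists Cm : R, 0 < Cm /\
    exists beta : R, 0 < beta /\
    exists C : R, 0 < C /\
    forall r0 : R, 0 < r0 <= beta ->
      strong_sobolev_orlicz (Fks 1 sigma) m r0
        (C * r0 `^ (1 - Cm * (1 / (ln (r0^-1)) `^ (1 - sigma * (m - 1))))))
  /\
  ((m - 1)^-1 < sigma ->
    exists beta : R, 0 < beta /\
    forall r0 : R, 0 < r0 <= beta ->
    forall c : R, ~ standard_sobolev_orlicz (Fks 1 sigma) m r0 c).
Proof.
have C0 : 0 < loss_const m sigma.
  rewrite /loss_const mulr_gt0// ?powR_gt0// mulr_gt0 ?powR_gt0//.
  by rewrite addr_gt0.
split; [|split].
- exists (loss_const m sigma); split => // k k2.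
  exact: strong_sobolev_iterated.
- move=> sm; exists (loss_const m sigma); split => //.
  exact: strong_sobolev_log.
- move=> sm; exists (iln_radius R 1); split; first exact: iln_radius_gt0.
  by move=> r0 /andP[r00 r0b] c; exact: standard_sobolev_fails.
Qed.
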